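(* Let $M=G_1\times G_2/K$ be an aligned homogeneous space with $K=K_0\times\dots\times K_t$ and associated constants $c_1$ and $\lambda_0=0,\lambda_1,\dots,\lambda_t$, and let $\mathfrak p=\mathfrak p_1\oplus\mathfrak p_2\oplus\mathfrak p_3^0\oplus\dots\oplus\mathfrak p_3^t$ be the decomposition of the $g_{\mathrm B}$-orthogonal complement $\mathfrak p$ of $\mathfrak k$. For $i=1,2$ let $\mathfrak p_i=\mathfrak p_i^1\oplus\dots\oplus\mathfrak p_i^{q_i}$ be a decomposition in $\mathrm{Ad}(K)$-irreducible summands and let $\kappa_{i,l}^j$ be the numbers defined by $\mathrm C_{\chi_{i,l}}|_{\mathfrak p_i^j}=\kappa_{i,l}^jI_{\mathfrak p_i^j}$. Then for any $G$-invariant metric $g=(x_1,x_2,x_{3,0},\dots,x_{3,t})_{g_{\mathrm B}}$ with all $x$'s positive, the decomposition $\mathfrak p=\mathfrak p_1\oplus\mathfrak p_2\oplus\mathfrak p_3^0\oplus\dots\oplus\mathfrak p_3^t$ is orthogonal with respect to the Ricci tensor $\mathrm{Rc}(g)$, $$\mathrm{Rc}(g)(\mathfrak p_i^j,\mathfrak p_i^k)=0,\qquad \forall\, 1\le j<k\le q_i,\quad i=1,2,$$ and the Ricci eigenvalues $r_1^j$ on $\mathfrak p_1^j$, $r_2^j$ on $\mathfrak p_2^j$ and $r_3^l$ on $\mathfrak p_3^l$ are given by $$r_1^j=\frac{1}{2x_1}\sum_{l=0}^t\Big(1-\frac{(c_1-1)x_{3,l}}{c_1x_1}\Big)\kappa_{1,l}^j+\frac1{4x_1},\qquad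 j=1,\dots,q_1,$$ $$r_2^j=\frac{1}{2x_2}\sum_{l=0}^t\Big(1-\frac{x_{3,l}}{c_1x_2}\Big)\kappa_{2,l}^j+\frac1{4x_2},\qquad j=1,\dots,q_2,$$ $$r_3^l=\frac{(c_1-1)\lambda_l}{4x_{3,l}}\Big(\frac{c_1^2}{(c_1-1)^2}-\frac{x_{3,l}^2}{x_1^2}-\frac{x_{3,l}^2}{(c_1-1)^2x_2^2}\Big)+\frac{(c_1-1)x_{3,l}}{4c_1}\Big(\frac1{x_1^2}+\frac1{(c_1-1)x_2^2}\Big),\qquad l=0,1,\dots,t.$$
   Context: Let $G=G_1\times G_2$ be a compact connected Lie group with $\mathfrak g=\mathfrak g_1\oplus\mathfrak g_2$, $\mathfrak g_1,\mathfrak g_2$ simple, acting almost-effectively on $M=G/K$, $K$ closed, with $\mathfrak k=\mathfrak k_0\oplus\mathfrak k_1\oplus\dots\oplus\mathfrak k_t$, $\mathfrak k_0$ the center and $\mathfrak k_1,\dots,\mathfrak k_t$ simple ideals (up to finite cover $K=K_0\times\dots\times K_t$). Let $\pi_i:\mathfrak g\to\mathfrak g_i$ be the projection, $Z_i:=\pi_i(Z)$, $\mathrm B_{\mathfrak h}$ the Killing form of $\mathfrak h$, and $a_{ij}$ the constants with $\mathrm B_{\pi_i(\mathfrak k_j)}=a_{ij}\mathrm B_{\mathfrak g_i}|_{\pi_i(\mathfrak k_j)}$ (so $a_{i0}=0$). $M=G/K$ is aligned if $\pi_i(\mathfrak k_j)\neq0$ for all $i$ and all $j\geq 1$, and there are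 $c_1,c_2>0$ with $\frac1{c_1}+\frac1{c_2}=1$ (so $c_2=\frac{c_1}{c_1-1}$) and $\lambda_1,\dots,\lambda_t>0$ with $(a_{1l},a_{2l})=\lambda_l(c_1,c_2)$ for $l=1,\dots,t$, and if $\mathfrak k_0\ne0$, also $\mathrm B_{\mathfrak g_i}(Z_i,W_i)=\frac1{c_i}\mathrm B_{\mathfrak g}(Z,W)$ for all $Z,W\in\mathfrak k_0$, $i=1,2$. Set $\lambda_0:=0$. The standard metric $g_{\mathrm B}$ is the $G$-invariant metric defined by $-\mathrm B_{\mathfrak g}|_{\mathfrak p\times\mathfrak p}$, where $\mathfrak g=\mathfrak k\oplus\mathfrak p$ is the $\mathrm B_{\mathfrak g}$-orthogonal reductive decomposition and $T_oM\equiv\mathfrak p$. For $i=1,2$, $\mathfrak p_i\subset\mathfrak g_i$ is the $\mathrm B_{\mathfrak g_i}$-orthogonal complement of $\pi_i(\mathfrak k)$ in $\mathfrak g_i$, and $\mathfrak p_3^l:=\{(Z_1,-\tfrac{c_2}{c_1}Z_2):Z\in\mathfrak k_l\}$, $l=0,\dots,t$; then $\mathfrak p=\mathfrak p_1\oplus\mathfrak p_2\oplus\mathfrak p_3^0\oplus\dots\oplus\mathfrak p_3^t$ is $g_{\mathrm B}$-orthogonal and $\mathrm{Ad}(K)$-invariant (terms with $l=0$ are absent if $\mathfrak k_0=0$). $g=(x_1,x_2,x_{3,0},\dots,x_{3,t})_{g_{\mathrm B}}$ denotes the $G$-invariant metric for which this decomposition is orthogonal and $g=x_ig_{\mathrm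 B}$ on $\mathfrak p_i$ ($i=1,2$), $g=x_{3,l}g_{\mathrm B}$ on $\mathfrak p_3^l$. $\mathrm C_{\chi_{i,l}}:\mathfrak p_i\to\mathfrak p_i$ is the Casimir operator $-\sum_\alpha(\mathrm{ad}\,U_\alpha|_{\mathfrak p_i})^2$, with $\{U_\alpha\}$ a basis of $\pi_i(\mathfrak k_l)$ orthonormal with respect to $-\mathrm B_{\mathfrak g_i}$; it acts as a scalar on each $\mathrm{Ad}(K)$-irreducible summand of $\mathfrak p_i$. $\mathrm{Rc}(g)$ is the Ricci tensor; Ricci eigenvalues are those of the Ricci operator $\mathrm{Ric}(g)$, $\mathrm{Rc}(g)=g(\mathrm{Ric}(g)\cdot,\cdot)$.
   Formalization: The claim Rc(g)(p_i^j, p_i^k)=0 is stated for pairs of summands that are g_B-orthogonal, since it fails for non-orthogonal decompositions with equivalent summands; compact Lie groups are taken as compact matrix groups (no loss up to isomorphism). *)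

(* Defs.v *)
From HB Require Import structures.
From mathcomp Require Import all_boot all_order all_algebra.
From mathcomp Require Import all_classical all_reals all_analysis.

Set Implicit Arguments.
Unset Strict Implicit.
Unset Printing Implicit Defensive.

Import Order.TTheory GRing.Theory Num.Theory.
Import numFieldNormedType.Exports.

Local Open Scope classical_set_scope.
Local Open Scope ring_scope.

(* A compact Lie group is represented by a compact subgroup of GL_n(R); by the *)
(* Peter-Weyl theorem every compact Lie group is isomorphic to one of these.   *)
(* Lie algebras are then subspaces of 'M[R]_n with the commutator bracket.     *)

Section LieGroups.
Variables (R : realType) (n : nat).
Local Notation mat := 'M[R]_n.
Implicit Types (A B X Y Z : mat) (G K : set mat) (g h k I : {vspace mat}).

Definition expmx X : mat :=
  limn (series (fun m : nat => (m`!%:R)^-1 *: X ^+ m)).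

Definition matrix_group G : Prop :=
  [/\ G 1%:M,
      forall A B, G A -> G B -> G (A *m B)
    & forall A, G A -> A \in unitmx /\ G (invmx A)].

Definition lie_algebra_of G g : Prop :=
  forall X, X \in g <-> forall s : R, G (expmx (s *: X)).

Definition Ad A X : mat := A *m X *m invmx A.

Definition lieb X Y : mat := X *m Y - Y *m X.

Definition lie_ideal I g : Prop :=
  (I <= g)%VS /\ forall X Y, X \in g -> Y \in I -> lieb X Y \in I.

Definition simple_lie_algebra g : Prop :=
  (exists X Y, [/\ X \in g, Y \in g & lieb X Y != 0]) /\
  (forall I, lie_ideal I g -> I = 0%VS \/ I = g).

Definition lie_center k h : Prop :=
  forall X, X \in h <-> X \in k /\ forall Y, Y \in k -> lieb X Y = 0.

(* The trace on U of an endomorphism f that maps U to itself. *)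
Definition trace_on (U : {vspace mat}) (f : mat -> mat) : R :=
  \sum_(i < \dim U) coord (vbasis U) i (f (vbasis U)`_i).

Definition killing h X Y : R := trace_on h (fun Z => lieb X (lieb Y Z)).

Definition product_group (G1 G2 : set mat) : set mat :=
  [set C | exists A B, [/\ G1 A, G2 B & C = A *m B]].

(* G is the internal direct product of G1 and G2.  External products are of    *)
(* this form through block diagonal matrices.                                  *)
Definition direct_product (G1 G2 : set mat) : Prop :=
  (forall A B, G1 A -> G2 B -> A *m B = B *m A) /\ G1 `&` G2 = [set 1%:M].

(* The kernel of the action of G on G/K is finite: A fixes the coset B K if    *)
(* and only if B^-1 A B lies in K.                                             *)
Definition almost_effective G K : Prop :=
  finite_set [set A | G A /\ forall B, G B -> K (invmx B *m A *m B)].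

Definition Ad_invariant K (W : {vspace mat}) : Prop :=
  forall A X, K A -> X \in W -> Ad A X \in W.

Definition Ad_irreducible K (W : {vspace mat}) : Prop :=
  [/\ W <> 0%VS, Ad_invariant K W
    & forall V : {vspace mat}, (V <= W)%VS -> Ad_invariant K V ->
        V = 0%VS \/ V = W].

Definition irreducible_decomposition K (W : {vspace mat}) (q : nat)
    (Ws : 'I_q -> {vspace mat}) : Prop :=
  [/\ W = (\sum_(j < q) Ws j)%VS, directv (\sum_(j < q) Ws j)
    & forall j, Ad_irreducible K (Ws j)].

(* The orthogonal complement of W in U for the bilinear form F. *)
Definition orthv (F : mat -> mat -> R) (U W : {vspace mat}) : {vspace mat} :=
  (U :&: \bigcap_(i < \dim W)
     lker (linfun (fun X => F X (vbasis W)`_i : R^o)))%VS.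

Definition orthogonal_on (F : mat -> mat -> R) (U W : {vspace mat}) : Prop :=
  forall X Y, X \in U -> Y \in W -> F X Y = 0 /\ F Y X = 0.

Definition orthonormal_basis (F : mat -> mat -> R) (U : {vspace mat})
    (e : seq mat) : Prop :=
  basis_of U e /\
  forall i j, (i < size e)%N -> (j < size e)%N -> F e`_i e`_j = (i == j)%:R.

(* The operator - \sum_alpha (ad U_alpha)^2. *)
Definition casimir (e : seq mat) X : mat := - \sum_(u <- e) lieb u (lieb u X).

End LieGroups.

Section Aligned.
Variables (R : realType) (n : nat) (g1 g2 : {vspace 'M[R]_n}).
Local Notation mat := 'M[R]_n.

Definition pi1 : 'End(mat) := daddv_pi g1 g2.
Definition pi2 : 'End(mat) := daddv_pi g2 g1.

(* B_h = a B_g on h. *)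
Definition killing_ratio (h g : {vspace mat}) (a : R) : Prop :=
  forall X Y, X \in h -> Y \in h -> killing h X Y = a * killing g X Y.

(* k_ ord0 is the center of k, and k_ l is a simple ideal of k for l != 0. *)
Definition aligned (t : nat) (k_ : 'I_t.+1 -> {vspace mat})
    (c1 c2 : R) (lam : 'I_t.+1 -> R) : Prop :=
  [/\ forall l, l != ord0 -> (pi1 @: k_ l)%VS <> 0%VS /\ (pi2 @: k_ l)%VS <> 0%VS,
      [/\ 0 < c1, 0 < c2 & c1^-1 + c2^-1 = 1],
      lam ord0 = 0,
      forall l, l != ord0 ->
        [/\ 0 < lam l,
            killing_ratio (pi1 @: k_ l) g1 (lam l * c1)
          & killing_ratio (pi2 @: k_ l) g2 (lam l * c2)]
    & forall Z W, Z \in k_ ord0 -> W \in k_ ord0 ->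
        killing g1 (pi1 Z) (pi1 W) = c1^-1 * killing (g1 + g2) Z W /\
        killing g2 (pi2 Z) (pi2 W) = c2^-1 * killing (g1 + g2) Z W].

Definition gB (X Y : mat) : R := - killing (g1 + g2) X Y.

Definition pspace (k : {vspace mat}) : {vspace mat} :=
  orthv (killing (g1 + g2)) (g1 + g2) k.

Definition pspace1 (k : {vspace mat}) : {vspace mat} :=
  orthv (killing g1) g1 (pi1 @: k).

Definition pspace2 (k : {vspace mat}) : {vspace mat} :=
  orthv (killing g2) g2 (pi2 @: k).

Definition pspace3 (c1 c2 : R) (kl : {vspace mat}) : {vspace mat} :=
  ((pi1 - (c2 / c1) *: pi2)%VF @: kl)%VS.

End Aligned.

Definition orthogonal_decomposition (R : realType) (n t : nat)
    (F : 'M[R]_n -> 'M[R]_n -> R) (p1 p2 : {vspace 'M[R]_n})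
    (p3 : 'I_t.+1 -> {vspace 'M[R]_n}) : Prop :=
  [/\ orthogonal_on F p1 p2,
      forall l, orthogonal_on F p1 (p3 l),
      forall l, orthogonal_on F p2 (p3 l)
    & forall l m, l != m -> orthogonal_on F (p3 l) (p3 m)].

(* A G-invariant Riemannian metric on M = G/K, given by its value q at the     *)
(* origin o, an Ad(K)-invariant inner product on T_oM = p.                     *)
Definition invariant_metric (R : realType) (n : nat) (K : set 'M[R]_n)
    (p : {vspace 'M[R]_n}) (q : 'M[R]_n -> 'M[R]_n -> R) : Prop :=
  [/\ forall (a : R) X Y Z, X \in p -> Y \in p -> Z \in p ->
        q (a *: X + Y) Z = a * q X Z + q Y Z,
      forall X Y, X \in p -> Y \in p -> q X Y = q Y X,
      forall X, X \in p -> X != 0 -> 0 < q X X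
    & forall A X Y, K A -> X \in p -> Y \in p -> q (Ad A X) (Ad A Y) = q X Y].

(* The metric (x1, x2, x3_0, ..., x3_t)_{g_B}, where gB' is g_B. *)
Definition diagonal_metric (R : realType) (n t : nat)
    (gB' : 'M[R]_n -> 'M[R]_n -> R) (p1 p2 : {vspace 'M[R]_n})
    (p3 : 'I_t.+1 -> {vspace 'M[R]_n}) (x1 x2 : R) (x3 : 'I_t.+1 -> R)
    (q : 'M[R]_n -> 'M[R]_n -> R) : Prop :=
  [/\ orthogonal_decomposition q p1 p2 p3,
      forall X Y, X \in p1 -> Y \in p1 -> q X Y = x1 * gB' X Y,
      forall X Y, X \in p2 -> Y \in p2 -> q X Y = x2 * gB' X Y
    & forall l X Y, X \in p3 l -> Y \in p3 l -> q X Y = x3 l * gB' X Y].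

(* The Ricci tensor at o of the G-invariant metric on G/K determined by q, in  *)
(* the coordinates X |-> exp(X) K on a neighbourhood of 0 in p, where p is a   *)
(* complement of k in the Lie algebra and e is a basis of p.  Partial          *)
(* derivatives in these coordinates are the derivatives 'D_(e i).              *)
Section Ricci.
Variables (R : realType) (n : nat) (k p : {vspace 'M[R]_n}).
Variable q : 'M[R]_n -> 'M[R]_n -> R.
Local Notation mat := 'M[R]_n.
Local Notation d := (\dim p).

Definition frame (i : 'I_d) : mat := (vbasis p)`_i.
Local Notation e := frame.

(* The image of the coordinate vector V at X under the translation by exp(-X), *)
(* which maps exp(X) K to o: the class in g/k = p of exp(-X) (d exp)_X V.      *)
Definition coord_field (V X : mat) : mat :=
  daddv_pi p k (expmx (- X) *m ('D_V (@expmx R n) X : mat)).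

Definition metric_coef (X : mat) : 'M[R]_d :=
  \matrix_(i, j) q (coord_field (e i) X) (coord_field (e j) X).

Definition partial (i : 'I_d) (f : mat -> R) (X : mat) : R :=
  'D_(e i) (f : mat -> R^o) X.

(* christoffel a i j is Gamma^a_{ij}. *)
Definition christoffel (a i j : 'I_d) (X : mat) : R :=
  2^-1 * \sum_(b < d) invmx (metric_coef X) a b *
    (partial i (fun Y => metric_coef Y j b) X
     + partial j (fun Y => metric_coef Y i b) X
     - partial b (fun Y => metric_coef Y i j) X).

Definition ricci_coef (i j : 'I_d) : R :=
  \sum_(a < d) (partial a (christoffel a i j) 0
                - partial j (christoffel a i a) 0)
  + \sum_(a < d) \sum_(b < d)
      (christoffel a a b 0 * christoffel b i j 0
       - christoffel a j b 0 * christoffel b i a 0).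

Definition ricci (X Y : mat) : R :=
  \sum_(i < d) \sum_(j < d)
    coord (vbasis p) i X * coord (vbasis p) j Y * ricci_coef i j.

(* The Ricci operator, obtained by raising an index of the Ricci tensor:       *)
(* ricci X Y = q (ricci_op X) Y on p.                                          *)
Definition ricci_op (X : mat) : mat :=
  \sum_(i < d) \sum_(j < d)
    (invmx (\matrix_(a, b) q (e a) (e b)) i j * ricci X (e j)) *: e i.

End Ricci.

Lemma mem_orthv (R : realType) (n : nat) (F : 'M[R]_n -> 'M[R]_n -> R)
    (U W : {vspace 'M[R]_n}) (X : 'M[R]_n) :
  (forall Y, linear (fun Z => F Z Y : R^o)) ->
  (forall Y, linear (fun Z => F Y Z : R^o)) ->
  X \in orthv F U W <-> X \in U /\ forall Y, Y \in W -> F X Y = 0.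
Proof.
move=> Fl Fr.
pose ll Y := GRing.isLinear.Build _ _ _ _ (fun Z => F Z Y : R^o) (Fl Y).
have kerE Y Z : (Z \in lker (linfun (fun Z => F Z Y : R^o))) = (F Z Y == 0).
  pose f : {linear 'M[R]_n -> R^o} := HB.pack (fun Z => F Z Y : R^o) (ll Y).
  by rewrite memv_ker (lfunE f).
have F0 : F X 0 = 0.
  by have := Fr X (-1) 0 0; rewrite scaler0 add0r scaleN1r addNr.
have bigE (s : seq 'I_(\dim W)) f :
    (X \in (\bigcap_(i <- s) f i)%VS) = all (fun i => X \in f i) s.
  by elim: s => [|i s IH]; rewrite ?big_nil ?memvf// big_cons memv_cap IH.
rewrite /orthv memv_cap; split=> [/andP[XU]|[XU FX]].
  rewrite bigE// => /allP FX; split=> // Y YW; rewrite (coord_vbasis YW).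
  apply: (big_ind (fun S => F X S = 0)) => // [A B FA FB|i _].
    by have := Fr X 1 A B; rewrite !scale1r FA FB addr0.
  have := FX i (mem_index_enum i); rewrite kerE => /eqP FXi.
  have := Fr X (coord (vbasis W) i Y) (vbasis W)`_i 0.
  by rewrite addr0 F0 FXi scaler0 addr0.
rewrite XU bigE//; apply/allP => i _; rewrite kerE FX//.
by rewrite vbasis_mem// mem_nth// size_tuple.
Qed.

(* Main.v *)
(* Idea.  In the chart X |-> exp(X) K the metric is computed from the map
   V |-> exp(-X) (d exp)_X V.  The derivatives of exp are corners of exponentials
   of block triangular matrices, and they give the 2-jet of the metric at o; for
   a basis e_a of p with q-dual basis e'_a this yields
     Rc(X, Y) = - B(X, Y) / 2 - sum_a q([X, e_a]_p, [Y, e'_a]_p) / 2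
                + sum_{a, c} q([e_a, e_c]_p, X) q([e'_a, e'_c]_p, Y) / 4,
   the mean curvature term vanishing because pr_p ad(W) has trace zero on p.
   If q = x_s g_B on the summand p_s of p, both sums are linear combinations,
   with coefficients monomials in the x_s, of the traces of
   pr_r ad(Y) pr_s ad(X) on p_r.  Since [p_1, p_2] = 0 and p_3^l is a twisted
   copy of k_l, these traces reduce to the Casimir operators on p_1, p_2 and to
   the Killing forms of g_1, g_2 and k_l on p_3^l, which the alignment hypothesis
   makes proportional.  The negative definiteness of B on k, which the splitting
   g = k + p needs, comes from the orthonormal bases of the projections of k. *)

Require Import Defs.
From HB Require Import structures.
From mathcomp Require Import all_boot all_order all_algebra.
From mathcomp Require Import all_classical all_reals all_analysis.
From mathcomp Require Import ring lra.

Set Implicit Arguments.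
Unset Strict Implicit.
Unset Printing Implicit Defensive.

Import Order.TTheory GRing.Theory Num.Theory.
Import numFieldNormedType.Exports.

Local Open Scope classical_set_scope.
Local Open Scope ring_scope.

(** * The matrix exponential *)

(** The curvature computation needs Lie algebra data only, while the hypotheses speak of groups. The
    delicate passage is [k <= g1 + g2]: a one-parameter group inside [G1 G2] factors at each time,
    with no control on how the factors vary, so their tangent vectors have to be produced as limits,
    and compactness supplies the convergence. The central ideal and the simple ideals of [k] are put
    on one footing: on each [k_ l] the Killing form of [g_i], pulled back by the projection, is B /
    c_i, and that of [k_ l] is [lam l] times B, which for [l = 0] reads 0 = 0. All later traces are
    therefore uniform in [l]. The coefficient -c2/c1 of p_3^l is forced by orthogonality to [k]: the
    two components contribute 1/c1 and (c2/c1)(1/c2), which must cancel. The identity c1 + c2 = c1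
    c2 then gives the lift of [k_ l] onto p_3^l the constant factor c2/c1 for g_B. Since
    [p_1, p_3^l] stays in p_1, and likewise for p_2, few products of weights survive: on p_1 only
    those of x_1 with itself and with the x_{3,l}. This is why r_1^j does not involve x_2. *)

Section MatrixLimits.
Variable R : realType.

Lemma cvg_mxP (T : Type) (F : set_system T) {FF : Filter F} m n
    (f : T -> 'M[R]_(m, n)) (L : 'M[R]_(m, n)) :
  f x @[x --> F] --> L <-> forall i j, f x i j @[x --> F] --> L i j.
Proof.
split=> [fL i j|fL].
  exact: (cvg_comp f (fun M : 'M[R]_(m, n) => M i j) fL
            (@coord_continuous _ _ _ i j L)).
apply/cvg_ballP => e e0.
have : \forall x \near F, forall ij : 'I_m * 'I_n,
    ball (L ij.1 ij.2) e (f x ij.1 ij.2).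
  apply: filter_forall => -[i j] /=.
  by move/cvg_ballP : (fL i j) => /(_ e e0).
by apply: filterS => x fx; split=> // i j; exact: (fx (i, j)).
Qed.

Lemma cvg_mulmx (T : Type) (F : set_system T) {FF : Filter F} m n p
    (f : T -> 'M[R]_(m, n)) (g : T -> 'M[R]_(n, p)) (A : 'M[R]_(m, n)) (B : 'M[R]_(n, p)) :
  f x @[x --> F] --> A -> g x @[x --> F] --> B ->
  f x *m g x @[x --> F] --> A *m B.
Proof.
move=> /cvg_mxP fA /cvg_mxP gB; apply/cvg_mxP => i j.
rewrite mxE (_ : (fun x => _) = fun x => \sum_k f x i k * g x k j); last first.
  by apply/funext => x; rewrite mxE.
apply: cvg_big => [|k _]; first exact: add_continuous.
exact: cvgM.
Qed.

Lemma ler_mx_entry m n (A : 'M[R]_(m, n)) i j : `|A i j| <= `|A|.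
Proof.
rewrite [X in _ <= X](mx_normrE A).
exact: (le_bigmax _ (fun ij : 'I_m * 'I_n => `|A ij.1 ij.2|) (i, j)).
Qed.

Lemma mx_norm_le m n (A : 'M[R]_(m, n)) (e : R) : 0 <= e ->
  (forall i j, `|A i j| <= e) -> `|A| <= e.
Proof.
move=> e0 Ae; rewrite [X in X <= _](mx_normrE A).
by apply/bigmax_leP; split=> // -[i j] _; exact: Ae.
Qed.

(** The norm is the maximum of the entries, which is not submultiplicative: every product costs the
    inner dimension. *)
Lemma mx_norm_mul m n p (A : 'M[R]_(m, n)) (B : 'M[R]_(n, p)) :
  `|A *m B| <= n%:R * `|A| * `|B|.
Proof.
apply: mx_norm_le => [|i j]; first by rewrite !mulr_ge0.
rewrite mxE (le_trans (ler_norm_sum _ _ _))//.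
rewrite -mulrA mulr_natl -[X in _ *+ X]card_ord -sumr_const.
by apply: ler_sum => k _; rewrite normrM ler_pM// ler_mx_entry.
Qed.

Lemma mx_norm_exp n (A : 'M[R]_n) m : `|A ^+ m| <= (n%:R * `|A|) ^+ m.
Proof.
elim: m => [|m IH]; rewrite ?expr0.
  apply: mx_norm_le => // i j; rewrite mxE.
  by case: (i == j); rewrite ?normr0 ?normr1.
rewrite !exprS (le_trans (mx_norm_mul _ _))// ler_wpM2l// mulr_ge0//.
Qed.

End MatrixLimits.

Section Exponential.
Variable R : realType.

Definition exp_term n (X : 'M[R]_n) (m : nat) : 'M[R]_n :=
  (m`!%:R)^-1 *: X ^+ m.

Lemma exp_term_le n (X : 'M[R]_n) m i j :
  `|exp_term X m i j| <= exp_coeff (n%:R * `|X|) m.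
Proof.
rewrite mxE normrM ger0_norm ?invr_ge0// /exp_coeff/= mulrC ler_wpM2r ?invr_ge0//.
exact: le_trans (ler_mx_entry _ _ _) (mx_norm_exp _ _).
Qed.

Lemma cvg_exp_term_entry n (X : 'M[R]_n) i j :
  cvgn [normed series (fun m => exp_term X m i j)].
Proof.
apply: (series_le_cvg (v_ := exp_coeff (n%:R * `|X|))).
- by move=> m; exact: normr_ge0.
- by move=> m; rewrite exp_coeff_ge0// mulr_ge0.
- by move=> m /=; exact: exp_term_le.
- exact: is_cvg_series_exp_coeff.
Qed.

(** [expmx] is a [limn], meaningful only once convergence is known; each entry is dominated by the
    scalar series at [n%:R * |X|]. *)
Lemma expmx_cvg n (X : 'M[R]_n) : series (exp_term X) @ \oo --> expmx X.
Proof.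
suff : cvgn (series (exp_term X)) by [].
pose L := \matrix_(i, j) limn (series (fun m => exp_term X m i j)).
apply/cvg_ex; exists L; apply/cvg_mxP => i j; rewrite mxE.
rewrite (_ : (fun x => _) = series (fun m => exp_term X m i j)); last first.
  by apply/funext => N; rewrite /series/= summxE.
exact: (normed_cvg (@cvg_exp_term_entry _ X i j)).
Qed.

Lemma expmx_entry_cvg n (X : 'M[R]_n) i j :
  series (fun m => exp_term X m i j) @ \oo --> expmx X i j.
Proof.
have /cvg_mxP/(_ i j) := @expmx_cvg n X.
rewrite (_ : (fun x => _) = series (fun m => exp_term X m i j))//.
by apply/funext => N; rewrite /series/= summxE.
Qed.

Lemma expmx_unique n (X : 'M[R]_n) L :
  series (exp_term X) @ \oo --> L -> expmx X = L.
Proof. by move=> XL; apply: cvg_lim XL; exact: norm_hausdorff. Qed.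

Lemma mx_intertwine_exp m n (A : 'M[R]_(m, n)) (X : 'M[R]_n) (Y : 'M[R]_m) k :
  A *m X = Y *m A -> A *m X ^+ k = Y ^+ k *m A.
Proof.
move=> AX; elim: k => [|k IH]; first by rewrite !expr0 mulmx1 mul1mx.
by rewrite exprSr [in RHS]exprSr -!mulmxE mulmxA IH -mulmxA AX mulmxA.
Qed.

(** The matrix [A] may be rectangular. With [A] a block row this reads off corners of exponentials
    of block matrices; with [A] square it gives commutation and conjugation. *)
Lemma expmx_intertwine m n (A : 'M[R]_(m, n)) (X : 'M[R]_n) (Y : 'M[R]_m) :
  A *m X = Y *m A -> A *m expmx X = expmx Y *m A.
Proof.
move=> AX.
have lhs : A *m series (exp_term X) N @[N --> \oo] --> A *m expmx X.
  by apply: cvg_mulmx; [exact: cvg_cst|exact: expmx_cvg].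
have rhs : series (exp_term Y) N *m A @[N --> \oo] --> expmx Y *m A.
  by apply: cvg_mulmx; [exact: expmx_cvg|exact: cvg_cst].
have eqs : (fun N => A *m series (exp_term X) N) =
           (fun N => series (exp_term Y) N *m A).
  apply/funext => N; rewrite /series/= mulmx_sumr mulmx_suml.
  apply: eq_bigr => k _.
  by rewrite /exp_term -scalemxAr -scalemxAl (mx_intertwine_exp _ AX).
rewrite eqs in lhs.
exact: cvg_unique _ lhs rhs.
Qed.

(** Induction on X^(m+1) - Y^(m+1) = X (X^m - Y^m) + (X - Y) Y^m. The factor 2 makes room for the
    two terms, and [1 <= r] absorbs the dimension produced by the second product. *)
Lemma mx_norm_exp_sub n (X Y : 'M[R]_n) (r : R) m : 1 <= r ->
  `|X| <= r -> `|Y| <= r ->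
  `|X ^+ m - Y ^+ m| <= `|X - Y| * (2 * (n%:R * r)) ^+ m.
Proof.
move=> r1 Xr Yr; have r0 : 0 <= r by exact: le_trans r1.
elim: m => [|m IH]; first by rewrite !expr0 subrr normr0 mulr1.
have -> : X ^+ m.+1 - Y ^+ m.+1 = X *m (X ^+ m - Y ^+ m) + (X - Y) *m Y ^+ m.
  by rewrite mulmxBr mulmxBl addrA subrK !exprS !mulmxE.
rewrite (le_trans (ler_normD _ _))//.
set a := n%:R * r; have a0 : 0 <= a by rewrite mulr_ge0.
apply: (@le_trans _ _ (a * (`|X - Y| * (2 * a) ^+ m) + `|X - Y| * (a * a ^+ m))).
  apply: lerD.
    rewrite (le_trans (mx_norm_mul _ _))// ler_pM ?mulr_ge0//.
    by rewrite ler_wpM2l.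
  rewrite (le_trans (mx_norm_mul _ _))// -mulrA mulrCA ler_wpM2l//.
  apply: ler_pM => //; first by rewrite ler_peMr.
  rewrite (le_trans (mx_norm_exp _ _))// lerXn2r ?nnegrE ?mulr_ge0//.
  by rewrite ler_wpM2l.
have -> : (2 * a) ^+ m.+1 = a * (2 * a) ^+ m + a * (2 * a) ^+ m.
  by rewrite exprS; ring.
rewrite mulrCA -mulrDr ler_wpM2l// lerD2l.
rewrite ler_wpM2l// lerXn2r ?nnegrE ?mulr_ge0//.
by rewrite ler_peMl// ler1n.
Qed.

(** Dividing the bounds on the differences of powers by [m!] and summing gives a scalar exponential
    series. Besides continuity of [expmx], this yields uniform bounds on powers of exponentials near
    1. *)
Lemma expmx_lipschitz n (X Y : 'M[R]_n) (r : R) : 1 <= r ->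
  `|X| <= r -> `|Y| <= r ->
  `|expmx X - expmx Y| <= `|X - Y| * expR (2 * (n%:R * r)).
Proof.
move=> r1 Xr Yr; have r0 : 0 <= r by exact: le_trans r1.
apply: mx_norm_le => [|i j]; first by rewrite mulr_ge0// expR_ge0.
rewrite [X in `|X|](_ : _ = expmx X i j - expmx Y i j); last by rewrite !mxE.
set c := 2 * (n%:R * r).
have cvgE : `|X - Y| *: series (exp_coeff c) N @[N --> \oo] --> `|X - Y| * expR c.
  by apply: cvgZr; exact: is_cvg_series_exp_coeff.
have cvgD : series (fun m => exp_term X m i j) N -
            series (fun m => exp_term Y m i j) N @[N --> \oo] -->
            expmx X i j - expmx Y i j.
  by apply: cvgB; exact: expmx_entry_cvg.
have cvgN : `|series (fun m => exp_term X m i j) N -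
            series (fun m => exp_term Y m i j) N| @[N --> \oo] -->
            `|expmx X i j - expmx Y i j| by exact: cvg_norm.
rewrite -(cvg_lim _ cvgN)// -(cvg_lim _ cvgE)//.
apply: ler_lim; [by apply/cvg_ex; eexists; exact: cvgN
                |by apply/cvg_ex; eexists; exact: cvgE|].
apply: nearW => N; rewrite /series/= -sumrB scaler_sumr.
rewrite (le_trans (ler_norm_sum _ _ _))//; apply: ler_sum => m _.
rewrite /exp_term !mxE -mulrBr normrM ger0_norm ?invr_ge0//.
rewrite [leRHS](_ : _ = (m`!%:R)^-1 * (`|X - Y| * c ^+ m)); last first.
  by rewrite /exp_coeff/= /GRing.scale/=; ring.
rewrite ler_wpM2l ?invr_ge0//.
apply: le_trans (mx_norm_exp_sub m r1 Xr Yr).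
by apply: le_trans (ler_mx_entry _ i j); rewrite !mxE.
Qed.

Lemma continuous_expmx n : continuous (@expmx R n).
Proof.
move=> X; apply/(@cvgrPdist_lt _ _ _ (nbhs X)) => e e0.
set r := `|X| + 1; have r1 : 1 <= r by rewrite lerDr.
set c := expR (2 * (n%:R * r)); have c0 : 0 < c by exact: expR_gt0.
have : \forall Y \near X, `|X - Y| < Num.min 1 (e / c).
  have /(@cvgrPdist_lt _ _ _ (nbhs X)) : id Y @[Y --> X] --> X by exact: cvg_id.
  by apply; rewrite lt_min ltr01 divr_gt0.
apply: filterS => Y; rewrite lt_min => /andP[XY1 XYe].
rewrite (le_lt_trans (@expmx_lipschitz _ X Y r r1 _ _))//.
- by rewrite lerDl.
- by rewrite -[Y](subKr X) (le_trans (ler_normB _ _))// lerD2l ltW.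
- by rewrite -/c -ltr_pdivlMr.
Qed.

End Exponential.

Section Derivatives.
Variable R : realType.

Lemma is_deriveP (V W : normedModType R) (f : V -> W) (x v : V) (df : W) :
  is_derive x v f df <->
  h^-1 *: (f (h *: v + x) - f x) @[h --> 0^'] --> df.
Proof.
split=> [[fx <-]//|fdf].
apply: DeriveDef; first by apply/cvg_ex; exists df.
exact: cvg_lim fdf.
Qed.

Lemma is_derive_mxP (V : normedModType R) m n (f : V -> 'M[R]_(m, n)) x v df :
  is_derive x v f df <-> forall i j, is_derive x v (fun y => f y i j) (df i j).
Proof.
split=> [/is_deriveP/cvg_mxP fdf i j|fdf].
  apply/is_deriveP.
  rewrite (_ : (fun h => _) = fun h => (h^-1 *: (f (h *: v + x) - f x)) i j).
    exact: fdf.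
  by apply/funext => h; rewrite !mxE.
apply/is_deriveP; apply/cvg_mxP => i j; have /is_deriveP := fdf i j.
rewrite (_ : (fun h => _) = fun h => (h^-1 *: (f (h *: v + x) - f x)) i j)//.
by apply/funext => h; rewrite !mxE.
Qed.

Lemma cvg_line (V : normedModType R) (x v : V) :
  h *: v + x @[h --> (0 : R)^'] --> x.
Proof.
rewrite -[X in _ --> X]add0r -[X in _ --> X + _](scale0r v).
apply: cvgD; last exact: cvg_cst.
by apply: cvgZl; exact: nbhs_dnbhs.
Qed.

Lemma expmx_colblock n (X V Y : 'M[R]_n) :
  row_mx 0 1%:M *m expmx (block_mx X V 0 Y) = expmx Y *m row_mx 0 1%:M.
Proof.
apply: expmx_intertwine.
by rewrite mul_row_block mul_mx_row !mul0mx !mul1mx !mulmx0 !mulmx1 !add0r.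
Qed.

Lemma drsubmx_expmx n (X V Y : 'M[R]_n) :
  drsubmx (expmx (block_mx X V 0 Y)) = expmx Y.
Proof.
have := expmx_colblock X V Y; rewrite -[in LHS](submxK (expmx _)).
rewrite mul_row_block mul_mx_row !mul0mx !mul1mx !mulmx0 !mulmx1 !add0r.
by case/eq_row_mx.
Qed.

(* The upper right corner of exp [[X, V], [0, X]] is the derivative of exp at X
   along V; applied to block matrices it gives the higher derivatives. *)
Definition dexp n (X V : 'M[R]_n) : 'M[R]_n :=
  ursubmx (expmx (block_mx X V 0 X)).

(* [[A, V], [0, X]] is intertwined with A = X + s V by (1, 1 / s), so the
   difference quotient is the corner of one exponential, continuous in s. *)
Lemma expmx_difference n (X V : 'M[R]_n) (s : R) : s != 0 ->
  s^-1 *: (expmx (s *: V + X) - expmx X) =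
  ursubmx (expmx (block_mx (s *: V + X) V 0 X)).
Proof.
move=> s0; set A := s *: V + X; set M := block_mx A V 0 X.
have : row_mx 1%:M (s^-1)%:M *m expmx M = expmx A *m row_mx 1%:M (s^-1)%:M.
  apply: expmx_intertwine.
  rewrite mul_row_block mul_mx_row !mul1mx !mulmx0 !mulmx1 !addr0.
  congr row_mx; rewrite mul_scalar_mx mul_mx_scalar /A scalerDr scalerA.
  by rewrite mulVf// scale1r.
rewrite -[in LHS](submxK (expmx M)) mul_row_block mul_mx_row !mul1mx mulmx1.
case/eq_row_mx => _; rewrite drsubmx_expmx mul_scalar_mx mul_mx_scalar => E.
by rewrite scalerBr -E addrK.
Qed.

Lemma is_derive_expmx n (X V : 'M[R]_n) : is_derive X V (@expmx R n) (dexp X V).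
Proof.
apply/is_deriveP; apply/cvg_mxP => i j.
pose D : 'M[R]_(n + n) := block_mx V 0 0 0.
pose B : 'M[R]_(n + n) := block_mx X V 0 X.
have DB h : h *: D + B = block_mx (h *: V + X) V 0 X.
  by rewrite scale_block_mx add_block_mx !scaler0 !add0r.
have : expmx (h *: D + B) @[h --> (0 : R)^'] --> expmx B.
  apply: cvg_comp (@cvg_line _ B D) _; exact: continuous_expmx.
move=> /cvg_mxP/(_ (lshift n i) (rshift n j)).
rewrite /dexp [X in _ --> X -> _](_ : _ = ursubmx (expmx B) i j); last by rewrite !mxE.
apply: cvg_trans; apply: near_eq_cvg; near=> h.
have h0 : h != 0 by near: h; exact: nbhs_dnbhs_neq.
by rewrite expmx_difference// DB !mxE.
Unshelve. all: by end_near. Qed.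

(** Only the restriction of [F] to the line through [X] along [V] matters, so no chain rule is
    required. The block matrices below are affine on such lines, which allows the differentiation to
    be iterated. *)
Lemma is_derive_expmx_affine (E : normedModType R) n (F : E -> 'M[R]_n) X V D :
  (forall h : R, F (h *: V + X) = h *: D + F X) ->
  is_derive X V (fun Y => expmx (F Y)) (dexp (F X) D).
Proof.
move=> FD; apply/is_deriveP.
have /is_deriveP := is_derive_expmx (F X) D.
rewrite (_ : (fun h => _) = (fun h => h^-1 *: (expmx (F (h *: V + X)) - expmx (F X))))//.
by apply/funext => h; rewrite FD.
Qed.

Lemma is_derive_ursubmx (E : normedModType R) n (F : E -> 'M[R]_(n + n)) X V D :
  is_derive X V F D -> is_derive X V (fun Y => ursubmx (F Y)) (ursubmx D).
Proof.
move=> /is_derive_mxP FD; apply/is_derive_mxP => i j.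
have := FD (lshift n i) (rshift n j).
rewrite (_ : (fun y => F y _ _) = (fun y => ursubmx (F y) i j)).
  by rewrite [X in is_derive _ _ _ X -> _](_ : _ = ursubmx D i j)// !mxE.
by apply/funext => y; rewrite !mxE.
Qed.

(** Moving [X] along [W] moves the block matrix behind [dexp X V] along diag(W, W), so the second
    derivative is a corner of a corner; [dexp3] repeats this once more. *)
Definition dexp2 n (X V W : 'M[R]_n) : 'M[R]_n :=
  ursubmx (dexp (block_mx X V 0 X) (block_mx W 0 0 W)).

Definition dexp3 n (X V W U : 'M[R]_n) : 'M[R]_n :=
  ursubmx (ursubmx (dexp
    (block_mx (block_mx X V 0 X) (block_mx W 0 0 W) 0 (block_mx X V 0 X))
    (block_mx (block_mx U 0 0 U) 0 0 (block_mx U 0 0 U)))).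

Lemma is_derive_dexp n (X V W : 'M[R]_n) :
  is_derive X W (fun Y => dexp Y V) (dexp2 X V W).
Proof.
apply: is_derive_ursubmx; apply: is_derive_expmx_affine => h.
by rewrite scale_block_mx add_block_mx !scaler0 !add0r.
Qed.

Lemma is_derive_dexp2 n (X V W U : 'M[R]_n) :
  is_derive X U (fun Y => dexp2 Y V W) (dexp3 X V W U).
Proof.
do 2!apply: is_derive_ursubmx; apply: is_derive_expmx_affine => h.
by rewrite !scale_block_mx !add_block_mx !scaler0 !add0r.
Qed.

(** At the origin the block matrices behind [dexp], [dexp2] and [dexp3] have fourth power zero, so
    the derivatives of [expmx] at 0 are finite computations. *)
Lemma expmx_nil4 n (X : 'M[R]_n) : X ^+ 4 = 0 ->
  expmx X = 1%:M + X + 2^-1 *: X ^+ 2 + 6^-1 *: X ^+ 3.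
Proof.
move=> X4; apply: expmx_unique; apply: cvg_near_cst; exists 4%N => // N /= N4.
rewrite /series/= (big_cat_nat _ (n := 4))//= [X in _ + X]big_nat [X in _ + X]big1; last first.
  by move=> k /andP[k4 _]; rewrite /exp_term -(subnK k4) exprD X4 mulr0 scaler0.
rewrite addr0 !big_nat_recl// big_nil addr0 /exp_term expr0 expr1 !addrA.
by rewrite !factS fact0 invr1 !scale1r.
Qed.

Lemma dexp_nil4 n (X V : 'M[R]_n) : (block_mx X V 0 X) ^+ 4 = 0 ->
  dexp X V = V + 2^-1 *: (X *m V + V *m X)
    + 6^-1 *: (X *m X *m V + X *m V *m X + V *m X *m X).
Proof.
move=> X4; rewrite /dexp expmx_nil4// !exprS expr0 !mulr1 -!mulmxE.
rewrite !mulmx_block !(mulmx0, mul0mx, addr0, add0r) scalar_mx_block.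
rewrite !scale_block_mx !add_block_mx block_mxKur add0r.
by rewrite mulmxDr !mulmxA.
Qed.

Lemma dexp0 n (V : 'M[R]_n) : dexp 0 V = V.
Proof.
rewrite dexp_nil4 ?(mulmx0, mul0mx, addr0, scaler0)//.
rewrite !exprS expr0 mulr1 -!mulmxE.
by rewrite !mulmx_block !(mulmx0, mul0mx, addr0) block_mx0.
Qed.

Lemma dexp20 n (V W : 'M[R]_n) : dexp2 0 V W = 2^-1 *: (V *m W + W *m V).
Proof.
rewrite /dexp2 dexp_nil4; last first.
  rewrite !exprS expr0 mulr1 -!mulmxE.
  rewrite !(mulmx_block, mulmx0, mul0mx, addr0, add0r, add_block_mx).
  by rewrite !block_mx0.
rewrite !(mulmx_block, mulmx0, mul0mx, addr0, add0r, add_block_mx).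
by rewrite !(scale_block_mx, add_block_mx, block_mxKur, scaler0, addr0, add0r).
Qed.

Lemma dexp30 n (V W U : 'M[R]_n) : dexp3 0 V W U =
  6^-1 *: (V *m W *m U + V *m U *m W + W *m V *m U + W *m U *m V
           + U *m V *m W + U *m W *m V).
Proof.
rewrite /dexp3 dexp_nil4; last first.
  rewrite !exprS expr0 mulr1 -!mulmxE.
  rewrite !(mulmx_block, mulmx0, mul0mx, addr0, add0r, add_block_mx).
  by rewrite !block_mx0.
rewrite !(mulmx_block, mulmx0, mul0mx, addr0, add0r, add_block_mx).
rewrite !(scale_block_mx, add_block_mx, block_mxKur, scaler0, addr0, add0r).
by rewrite mulmxDl !addrA (addrAC (V *m W *m U)).
Qed.

End Derivatives.

(** * Linear maps, products and subspaces under limits *)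

Section LinearLimits.
Variable R : realType.

Lemma cvg_linear (T : Type) (F : set_system T) {FF : Filter F} m n
    (phi : {linear 'M[R]_(m, n) -> R^o}) (f : T -> 'M[R]_(m, n))
    (A : 'M[R]_(m, n)) :
  f x @[x --> F] --> A -> phi (f x) @[x --> F] --> phi A.
Proof.
have phiE (B : 'M[R]_(m, n)) : phi B = \sum_i \sum_j B i j * phi (delta_mx i j).
  rewrite {1}(matrix_sum_delta B) linear_sum; apply: eq_bigr => i _.
  by rewrite linear_sum; apply: eq_bigr => j _; rewrite linearZ.
move=> /cvg_mxP fA; rewrite phiE.
rewrite (_ : (fun x => _) =
  fun x => \sum_i \sum_j f x i j * phi (delta_mx i j)); last first.
  by apply/funext => x; rewrite phiE.
apply: cvg_big => [|i _]; first exact: add_continuous.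
apply: cvg_big => [|j _]; first exact: add_continuous.
by apply: cvgM; [exact: fA|exact: cvg_cst].
Qed.

Lemma is_derive_linear (V : normedModType R) m n
    (phi : {linear 'M[R]_(m, n) -> R^o}) (F : V -> 'M[R]_(m, n)) x v D :
  is_derive x v F D -> is_derive x v (fun y => phi (F y)) (phi D).
Proof.
move=> /is_deriveP FD; apply/is_deriveP; have := @cvg_linear _ _ _ m n phi _ _ FD.
have E (h : R) : phi (h^-1 *: (F (h *: v + x) - F x)) =
    h^-1 *: (phi (F (h *: v + x)) - phi (F x)) by rewrite linearZ linearB.
by rewrite (funext E); exact.
Qed.

Lemma is_derive_mulmx (V : normedModType R) m n p
    (F : V -> 'M[R]_(m, n)) (G : V -> 'M[R]_(n, p)) x v DF DG :
  is_derive x v F DF -> is_derive x v G DG ->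
  is_derive x v (fun y => F y *m G y) (DF *m G x + F x *m DG).
Proof.
move=> /is_derive_mxP FD /is_derive_mxP GD; apply/is_derive_mxP => i j.
rewrite (_ : (fun y => _) =
    \sum_(k < n) ((fun y => F y i k) * (fun y => G y k j))); last first.
  by apply/funext => y; rewrite mxE fct_sumE.
apply: is_derive_eq (is_derive_sum (fun k => is_deriveM (FD i k) (GD k j))) _.
rewrite !mxE -big_split/=; apply: eq_bigr => k _.
by rewrite addrC [DF i k * _]mulrC.
Qed.

(** Membership in [W] says that [B - projv W B] vanishes, and the entries of this matrix are linear
    forms in [B], hence continuous. *)
Lemma cvg_vspace (T : Type) (F : set_system T) {FF : ProperFilter F} n
    (W : {vspace 'M[R]_n}) (f : T -> 'M[R]_n) (A : 'M[R]_n) :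
  (forall x, f x \in W) -> f x @[x --> F] --> A -> A \in W.
Proof.
move=> fW fA.
have projE (B : 'M[R]_n) : (B \in W) = (B - projv W B == 0).
  apply/idP/idP => [BW|]; first by rewrite projv_id// subrr.
  by rewrite subr_eq0 => /eqP ->; exact: memv_proj.
rewrite projE; apply/eqP/matrixP => i j; rewrite [RHS]mxE.
pose phi (B : 'M[R]_n) : R^o := (B - projv W B) i j.
have phi_lin : linear phi.
  by move=> a B C; rewrite /phi linearP/= !mxE /GRing.scale/=; ring.
pose phiL := GRing.isLinear.Build _ _ _ _ phi phi_lin.
pose phil : {linear 'M[R]_n -> R^o} := HB.pack phi phiL.
have c1 : phil (f x) @[x --> F] --> phil A by exact: cvg_linear.
have phif0 : (fun x => phil (f x)) = fun=> 0.
  apply/funext => x; rewrite /phil/= /phi.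
  by have /eqP -> : f x - projv W (f x) == 0; [rewrite -projE|rewrite mxE].
rewrite phif0 in c1.
have c2 : (fun _ : T => 0 : R^o) x @[x --> F] --> (0 : R^o) by exact: cvg_cst.
exact: (cvg_unique (@norm_hausdorff _ R^o) c1 c2).
Qed.

Lemma derive_vspace n (W : {vspace 'M[R]_n}) (V : normedModType R)
    (f : V -> 'M[R]_n) x v D :
  (forall y, f y \in W) -> is_derive x v f D -> D \in W.
Proof.
move=> fW /is_deriveP; apply: cvg_vspace => h.
by rewrite memvZ// memvB.
Qed.

End LinearLimits.

(** * One-parameter groups *)

Section OneParameter.
Variable R : realType.

(** When [X] and [V] commute, the corner of the power k + 1 of the block matrix is (k + 1) V X^k,
    and the factor k + 1 turns 1/(k + 1)! into 1/k!. *)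
Lemma dexp_comm n (X V : 'M[R]_n) : X *m V = V *m X -> dexp X V = V *m expmx X.
Proof.
move=> XV.
have powE k : (block_mx X V 0 X) ^+ k.+1 =
    block_mx (X ^+ k.+1) (k.+1%:R *: (V *m X ^+ k)) 0 (X ^+ k.+1).
  elim: k => [|k IH]; first by rewrite !expr1 expr0 mulmx1 scale1r.
  rewrite exprS IH -mulmxE mulmx_block !(mulmx0, mul0mx, addr0, add0r).
  have XXk : X *m X ^+ k.+1 = X ^+ k.+2 by rewrite [RHS]exprS mulmxE.
  rewrite XXk; congr block_mx; rewrite -scalemxAr mulmxA XV -mulmxA.
  have -> : X *m X ^+ k = X ^+ k.+1 by rewrite [RHS]exprS mulmxE.
  by rewrite -[X in _ + X]scale1r -scalerDl natr1.
apply/matrixP => i j.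
(* The partial sums are shifted by one because the term of degree 0, the identity, has zero
   corner. *)
have cvg1 : series (fun m => exp_term (block_mx X V 0 X) m
    (lshift n i) (rshift n j)) N.+1 @[N --> \oo] -->
    expmx (block_mx X V 0 X) (lshift n i) (rshift n j).
  by rewrite (cvg_shiftS (series _)); exact: expmx_entry_cvg.
have /cvg_mxP/(_ i j) cvg2 : V *m series (exp_term X) N @[N --> \oo] --> V *m expmx X.
  by apply: cvg_mulmx; [exact: cvg_cst|exact: expmx_cvg].
have termE k : exp_term (block_mx X V 0 X) k.+1 (lshift n i) (rshift n j) =
    (V *m exp_term X k) i j.
  rewrite /exp_term powE -scalemxAr [LHS]mxE [RHS]mxE block_mxEur [X in _ * X]mxE mulrA.
  by congr (_ * _); rewrite factS natrM invfM mulrAC mulVf ?mul1r ?pnatr_eq0.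
have term0 : exp_term (block_mx X V 0 X) 0 (lshift n i) (rshift n j) = 0.
  by rewrite /exp_term expr0 !mxE/= eq_lrshift mulr0.
have seriesE N : series (fun m => exp_term (block_mx X V 0 X) m
    (lshift n i) (rshift n j)) N.+1 = (V *m series (exp_term X) N) i j.
  rewrite /series/= big_nat_recl// term0 add0r mulmx_sumr summxE.
  by apply: eq_bigr => k _; rewrite termE.
rewrite (funext seriesE) in cvg1.
by rewrite [LHS](_ : _ = expmx (block_mx X V 0 X) (lshift n i) (rshift n j));
  [exact: (cvg_unique (@norm_hausdorff _ R^o) cvg1 cvg2)|rewrite !mxE].
Qed.

Lemma is_derive_expZ n (X : 'M[R]_n) (s : R) :
  is_derive s 1 (fun s : R => expmx (s *: X)) (X *m expmx (s *: X)).
Proof.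
rewrite -dexp_comm; last by rewrite -scalemxAl -scalemxAr.
by apply: is_derive_expmx_affine => h; rewrite scalerDl -[h *: 1]/(h * 1) mulr1.
Qed.

Lemma expmx0 n : expmx 0 = 1%:M :> 'M[R]_n.
Proof. by rewrite expmx_nil4 !expr0n// !scaler0 !addr0. Qed.

Lemma expmxD n (X : 'M[R]_n) (a b : R) :
  expmx ((a + b) *: X) = expmx (a *: X) *m expmx (b *: X).
Proof.
(* This path joins the two sides, and its derivative vanishes because [X] commutes with its
   exponentials. *)
pose f (s : R) := expmx ((a + b - s) *: X) *m expmx (s *: X).
suff f_cst : f 0 = f b.
  by move: f_cst; rewrite /f scale0r expmx0 mulmx1 subr0 addrK.
have df (s : R) : is_derive s 1 f 0.
  have d1 : is_derive s 1 (fun s : R => expmx ((a + b - s) *: X))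
      (- X *m expmx ((a + b - s) *: X)).
    rewrite -dexp_comm; last by rewrite mulmxN mulNmx -scalemxAl -scalemxAr.
    apply: is_derive_expmx_affine => h.
    by rewrite scalerN -scaleNr -scalerDl -[h *: 1]/(h * 1) mulr1; congr (_ *: _); ring.
  apply: is_derive_eq (is_derive_mulmx d1 (is_derive_expZ X s)) _.
  rewrite mulNmx mulNmx mulmxA.
  rewrite (expmx_intertwine (A := X) (Y := (a + b - s) *: X)) ?addNr//.
  by rewrite -scalemxAl -scalemxAr.
apply/matrixP => i j.
apply: (is_derive_0_is_cst (f := fun s => f s i j)) => s.
by have /is_derive_mxP/(_ i j) := df s; rewrite mxE.
Qed.

Lemma expmxNl n (X : 'M[R]_n) : expmx (- X) *m expmx X = 1%:M.
Proof.
by rewrite -[X in _ *m expmx X]scale1r -scaleN1r -expmxD addNr scale0r expmx0.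
Qed.

Lemma expmx_unit n (X : 'M[R]_n) : expmx X \in unitmx.
Proof. by have /mulmx1_unit[] := expmxNl X. Qed.

Lemma invmx_expmx n (X : 'M[R]_n) : invmx (expmx X) = expmx (- X).
Proof.
by rewrite -[RHS](mulmxK (expmx_unit X)) expmxNl mul1mx.
Qed.

Lemma expmxMn n (X : 'M[R]_n) (N : nat) : expmx (N%:R *: X) = expmx X ^+ N.
Proof.
elim: N => [|N IH]; first by rewrite scale0r expmx0 expr0.
by rewrite -natr1 expmxD IH scale1r exprSr.
Qed.

Lemma expmx_Ad n (A X : 'M[R]_n) : A \in unitmx ->
  expmx (Ad A X) = Ad A (expmx X).
Proof.
move=> Au; rewrite /Ad.
rewrite (expmx_intertwine (A := A) (Y := Ad A X)) ?mulmxK//.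
by rewrite /Ad mulmxKV.
Qed.

End OneParameter.

(** * Lie algebras of compact matrix groups *)

Section UltraLimits.
Variable R : realType.

(** Along an ultrafilter a cluster point is a limit. Several bounded sequences thus converge along
    one common filter, with no successive extraction of subsequences. *)
Lemma ultra_compact_cvg (I : Type) (F : set_system I) (FU : UltraFilter F)
    (T : topologicalType) (C : set T) (f : I -> T) :
  compact C -> (forall i, C (f i)) -> exists2 l, C l & f x @[x --> F] --> l.
Proof.
move=> Cc Cf; have FP : ProperFilter F := @ultra_proper _ _ FU.
have [|l [Cl fl]] := Cc (f @ F) (fmap_proper_filter f FP) _; first by apply: (@filterS _ F _ setT) => [i _|]; [exact: Cf|exact: filterT].
exists l => // N Nl; have [//|FN] := in_ultra_setVsetC (f @^-1` N) FU.
by have [x [nNx Nx]] := fl (~` N) N FN Nl.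
Qed.

Lemma ultra_bounded_cvg (I : Type) (F : set_system I) (FU : UltraFilter F)
    (f : I -> R) (c : R) :
  (forall i, `|f i| <= c) -> exists2 l, `|l| <= c & f x @[x --> F] --> l.
Proof.
move=> fc.
have [i|l] := @ultra_compact_cvg _ _ FU _ `[- c, c] f (@segment_compact _ _ _).
  by rewrite /= in_itv/= -ler_norml.
by rewrite /= in_itv/= -ler_norml => lc fl; exists l.
Qed.

Lemma ultra_mx_cvg (I : Type) (F : set_system I) (FU : UltraFilter F)
    m n (f : I -> 'M[R]_(m, n)) (c : R) :
  (forall i, `|f i| <= c) -> exists l : 'M[R]_(m, n), f x @[x --> F] --> l.
Proof.
move=> fc; have FP : ProperFilter F := @ultra_proper _ _ FU.
have /choice[l lP] : forall ij : 'I_m * 'I_n,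
    exists l : R, f x ij.1 ij.2 @[x --> F] --> l.
  move=> [i j]; have [|l _ fl] := @ultra_bounded_cvg _ _ FU (fun x => f x i j) c.
    by move=> x; exact: le_trans (ler_mx_entry _ _ _) (fc x).
  by exists l.
exists (\matrix_(i, j) l (i, j)); apply/cvg_mxP => i j.
by rewrite mxE; exact: (lP (i, j)).
Qed.

Lemma cvg_ursubmx (T : Type) (F : set_system T) {FF : Filter F} n
    (f : T -> 'M[R]_(n + n)) (A : 'M[R]_(n + n)) :
  f x @[x --> F] --> A -> ursubmx (f x) @[x --> F] --> ursubmx A.
Proof.
move=> /cvg_mxP fA; apply/cvg_mxP => i j.
have fE x : ursubmx (f x) i j = f x (lshift n i) (rshift n j) by rewrite !mxE.
by rewrite (funext fE) !mxE; exact: fA.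
Qed.

End UltraLimits.

Section LieAlgebras.
Variables (R : realType) (n : nat).
Implicit Types (G : set 'M[R]_n) (g : {vspace 'M[R]_n}) (X Y : 'M[R]_n).

Lemma matrix_group_exp G A N : matrix_group G -> G A -> G (A ^+ N).
Proof.
move=> [G1 GM _] GA; elim: N => [|N IH]; first by rewrite expr0.
by rewrite exprS -mulmxE; exact: GM.
Qed.

Lemma lie_algebra_Ad G g A X : matrix_group G -> lie_algebra_of G g ->
  G A -> X \in g -> Ad A X \in g.
Proof.
move=> [_ GM GV] Gg GA Xg; apply/Gg => s; have [Au GAV] := GV _ GA.
rewrite (_ : s *: Ad A X = Ad A (s *: X)); last first.
  by rewrite /Ad -scalemxAr -scalemxAl.
rewrite expmx_Ad//; apply: (GM) GAV; apply: (GM) => //.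
exact: (Gg X).1.
Qed.

(** The bracket is the derivative at 0 of Ad(exp(sX)) Y, a path that stays in the closed subspace
    [g]. *)
Lemma lieb_lie_algebra G g X Y : matrix_group G -> lie_algebra_of G g ->
  X \in g -> Y \in g -> lieb X Y \in g.
Proof.
move=> Gm Gg Xg Yg.
pose f (s : R) := expmx (s *: X) *m Y *m expmx (s *: (- X)).
have df : is_derive (0 : R) 1 f (lieb X Y).
  have d1 : is_derive (0 : R) 1 (fun s => expmx (s *: X) *m Y) (X *m Y).
    apply: is_derive_eq (is_derive_mulmx (is_derive_expZ X 0)
      (is_derive_cst Y (0 : R) 1)) _.
    by rewrite scale0r expmx0 mulmx0 addr0 mulmx1.
  apply: is_derive_eq (is_derive_mulmx d1 (is_derive_expZ (- X) 0)) _.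
  by rewrite !scale0r expmx0 mul1mx !mulmx1 mulmxN.
apply: derive_vspace df => s.
rewrite /f scalerN -invmx_expmx; apply: (lie_algebra_Ad Gm (Gg) _ Yg).
exact: (Gg X).1.
Qed.

(** Differentiating at 0, first in [s] and then in [u]. *)
Lemma commuting_expmx X Y :
  (forall s u : R, expmx (s *: X) *m expmx (u *: Y) =
                   expmx (u *: Y) *m expmx (s *: X)) -> lieb X Y = 0.
Proof.
move=> XY.
have XeY (u : R) : X *m expmx (u *: Y) = expmx (u *: Y) *m X.
  have dl := is_derive_mulmx (is_derive_expZ X 0) (is_derive_cst (expmx (u *: Y)) (0 : R) 1).
  have dr := is_derive_mulmx (is_derive_cst (expmx (u *: Y)) (0 : R) 1) (is_derive_expZ X 0).
  have : (fun s : R => expmx (s *: X) *m cst (expmx (u *: Y)) s) =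
         (fun s : R => cst (expmx (u *: Y)) s *m expmx (s *: X)).
    by apply/funext => s; exact: XY.
  move=> E; rewrite E in dl.
  have := etrans (esym (@derive_val _ _ _ _ _ _ _ dl)) (@derive_val _ _ _ _ _ _ _ dr).
  by rewrite scale0r expmx0 !mulmx1 !(mulmx0, mul0mx, addr0, add0r).
have dl := is_derive_mulmx (is_derive_cst X (0 : R) 1) (is_derive_expZ Y 0).
have dr := is_derive_mulmx (is_derive_expZ Y 0) (is_derive_cst X (0 : R) 1).
have : (fun s : R => cst X s *m expmx (s *: Y)) =
       (fun s : R => expmx (s *: Y) *m cst X s).
  by apply/funext => s; exact: XeY.
move=> E; rewrite E in dl.
have := etrans (esym (@derive_val _ _ _ _ _ _ _ dl)) (@derive_val _ _ _ _ _ _ _ dr).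
rewrite scale0r expmx0 !mulmx1 !(mulmx0, mul0mx, addr0, add0r) => XYE.
by rewrite /lieb XYE subrr.
Qed.

Lemma expmx_cst1 X : (forall s : R, expmx (s *: X) = 1%:M) -> X = 0.
Proof.
move=> X1; have d0 := is_derive_expZ X 0.
rewrite (funext X1) in d0.
have := etrans (esym (@derive_val _ _ _ _ _ _ _ d0))
  (@derive_val _ _ _ _ _ _ _ (is_derive_cst (1%:M : 'M[R]_n) (0 : R) 1)).
by rewrite scale0r expmx0 mulmx1.
Qed.

(** The corner is the value at [E] of the entire function (e^z - 1)/z. It measures how far [expmx E]
    is from 1 + E without any division by [E]. *)
Lemma expmx_sub1 (E : 'M[R]_n) :
  expmx E - 1%:M = E *m ursubmx (expmx (block_mx E 1%:M 0 0)).
Proof.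
set M := block_mx E 1%:M 0 0.
have : row_mx E 1%:M *m expmx M = expmx E *m row_mx E 1%:M.
  apply: expmx_intertwine.
  by rewrite mul_row_block mul_mx_row !mulmx0 !mulmx1 !addr0.
rewrite -[in LHS](submxK (expmx M)) mul_row_block mul_mx_row !mul1mx mulmx1.
case/eq_row_mx => _; rewrite drsubmx_expmx expmx0 => <-.
by rewrite addrK.
Qed.

(* A x ^+ N, with N the integral part of s / t x, tends to expmx (s *: Y), since
   A x and expmx (A x - 1) differ by o(t x). *)
Lemma lie_algebra_limit (I : Type) (F : set_system I) (FP : ProperFilter F)
    G g (A : I -> 'M[R]_n) (t : I -> R) (Y : 'M[R]_n) :
  matrix_group G -> compact G -> lie_algebra_of G g ->
  (forall i, G (A i)) -> (forall i, 0 < t i) -> t x @[x --> F] --> (0 : R) ->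
  (t x)^-1 *: (A x - 1%:M) @[x --> F] --> Y -> Y \in g.
Proof.
move=> Gm Gc Gg GA t0 tF AY; apply/Gg => s.
wlog s0 : s / 0 <= s => [pos|].
  have [/pos//|s0] := leP 0 s; have /pos GNs : 0 <= - s by rewrite oppr_ge0 ltW.
  have [_ _ /(_ _ GNs)[_]] := Gm.
  by rewrite invmx_expmx -scaleNr opprK.
(* [N] is the integral part of s/t, so that N t lies within t of s and tends to s. *)
pose E i := A i - 1%:M; pose e i := (t i)^-1 *: E i.
pose N i := Num.truncn (s / t i).
have Nts x : (N x)%:R * t x <= s.
  have st0 : 0 <= s / t x by rewrite divr_ge0// ltW.
  by have /andP[N1 _] := truncn_itv st0; rewrite -ler_pdivlMr.
have NtE : (N x)%:R * t x @[x --> F] --> s.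
  have tF' : s - t x @[x --> F] --> s.
    by rewrite -[X in _ --> X]subr0; apply: cvgB => //; exact: cvg_cst.
  apply: (squeeze_cvgr _ tF' (cvg_cst s)); apply: nearW => x.
  have st0 : 0 <= s / t x by rewrite divr_ge0// ltW.
  have /andP[_ N2] := truncn_itv st0.
  rewrite Nts andbT lerBlDr -[X in _ + X]mul1r -mulrDl natr1.
  by rewrite -ler_pdivrMr// ltW.
have EF : E x @[x --> F] --> (0 : 'M[R]_n).
  have : t x *: e x @[x --> F] --> 0 *: Y.
    by apply: cvgZ; [exact: tF|exact: AY].
  rewrite scale0r (_ : (fun x => t x *: e x) = E)//.
  by apply/funext => x; rewrite /e scalerA divff ?scale1r// gt_eqF.
have QF : expmx (E x) ^+ N x @[x --> F] --> expmx (s *: Y).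
  have : expmx (((N x)%:R * t x) *: e x) @[x --> F] --> expmx (s *: Y).
    by apply: (cvg_comp _ (@expmx R n)); [apply: cvgZ; [exact: NtE|exact: AY]|exact: continuous_expmx].
  rewrite (_ : (fun x => expmx _) = fun x => expmx (E x) ^+ N x)//.
  apply/funext => x; rewrite -expmxMn /e scalerA -mulrA divff ?mulr1//.
  by rewrite gt_eqF.
suff AF : A x ^+ N x @[x --> F] --> expmx (s *: Y).
  apply: (closed_cvg G _ _ _ AF); last by apply: nearW => x; exact: matrix_group_exp.
  exact: compact_closed (@norm_hausdorff _ _) Gc.
suff dF : (A x ^+ N x - expmx (E x) ^+ N x) @[x --> F] --> (0 : 'M[R]_n).
  have : (A x ^+ N x - expmx (E x) ^+ N x + expmx (E x) ^+ N x) @[x --> F] -->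
      0 + expmx (s *: Y) by exact: cvgD.
  rewrite add0r.
  have DE x : A x ^+ N x - expmx (E x) ^+ N x + expmx (E x) ^+ N x = A x ^+ N x.
    by rewrite subrK.
  by rewrite (funext DE).
pose psi x := ursubmx (expmx (block_mx (E x) 1%:M 0 0)).
have psiF : psi x @[x --> F] --> (1%:M : 'M[R]_n).
  rewrite -(dexp0 1%:M) /psi /dexp; apply: cvg_ursubmx.
  apply: (cvg_comp _ (@expmx R (n + n))); last exact: continuous_expmx.
  pose L : 'M[R]_(n + n, n) := col_mx 1%:M 0.
  pose L' : 'M[R]_(n, n + n) := row_mx 1%:M 0.
  have LE (B : 'M[R]_n) : block_mx B 1%:M 0 0 = L *m B *m L' + block_mx 0 1%:M 0 0.
    rewrite /L /L' mul_col_mx mul_col_row !mul1mx !mul0mx mulmx1 mulmx0.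
    by rewrite add_block_mx !(addr0, add0r).
  have : (L *m E x *m L' + block_mx 0 1%:M 0 0) @[x --> F] -->
      L *m 0 *m L' + block_mx 0 1%:M 0 0.
    apply: cvgD; last exact: cvg_cst.
    apply: cvg_mulmx; last exact: cvg_cst.
    by apply: cvg_mulmx; [exact: cvg_cst|exact: EF].
  have EL x : L *m E x *m L' + block_mx 0 1%:M 0 0 = block_mx (E x) 1%:M 0 0.
    by rewrite -LE.
  by rewrite (funext EL) mulmx0 mul0mx add0r.
(* All powers of [A x] lie in the compact group, which bounds them independently of the exponent. *)
have [C C0 GC] : exists2 C : R, 0 <= C & forall B, G B -> `|B| <= C.
  have [M [_ GM]] := compact_bounded Gc.
  exists (Num.max 0 (M + 1)); first by rewrite le_max lexx.
  by move=> B GB; rewrite le_max (GM (M + 1)) ?orbT// ltrDl.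
(* For j <= N the matrix j E has norm at most s |e|. The summand 1 meets the requirement [1 <= r] of
   [expmx_lipschitz], and [D] bounds the powers of exp(E) by comparison with exp(0) = 1. *)
pose rho x := 1 + s * `|e x|; have rho1 x : 1 <= rho x by rewrite lerDl mulr_ge0.
have rho0 x : 0 <= rho x by exact: le_trans (rho1 x).
pose D x := 1 + rho x * expR (2 * (n%:R * rho x)).
have D0 x : 0 <= D x by rewrite addr_ge0// mulr_ge0// expR_ge0.
have QD x j : (j <= N x)%N -> `|expmx (E x) ^+ j| <= D x.
  move=> jN; rewrite -expmxMn.
  have jE : `|j%:R *: E x| <= rho x.
    rewrite normrZ ger0_norm// /rho.
    have -> : `|E x| = t x * `|e x|.
      by rewrite /e normrZ ger0_norm ?invr_ge0 ?ltW// mulrA divff ?mul1r// gt_eqF.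
    rewrite mulrA (@le_trans _ _ (s * `|e x|))// ?lerDr// ler_wpM2r//.
    apply: le_trans (Nts x); rewrite ler_wpM2r ?ler_nat// ltW//.
  rewrite -[X in `|X|](subrK (expmx 0)) (le_trans (ler_normD _ _))// addrC lerD//.
    rewrite expmx0; apply: mx_norm_le => // i j'; rewrite mxE.
    by case: (i == j'); rewrite ?normr0 ?normr1.
  apply: le_trans (expmx_lipschitz (rho1 x) jE _) _; first by rewrite normr0.
  by rewrite subr0 ler_wpM2r ?expR_ge0.
apply/norm_cvg0P.
have bF : n%:R * (n%:R * (s * `|e x|) * `|1%:M - psi x|) * (n%:R * C * D x)
    @[x --> F] --> (0 : R).
  have eN : `|e x| @[x --> F] --> `|Y| by apply: cvg_norm; exact: AY.
  have rhoF : rho x @[x --> F] --> 1 + s * `|Y|.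
    by apply: cvgD; [exact: cvg_cst|apply: cvgM; [exact: cvg_cst|exact: eN]].
  have DF : D x @[x --> F] -->
      1 + (1 + s * `|Y|) * expR (2 * (n%:R * (1 + s * `|Y|))).
    apply: cvgD; first exact: cvg_cst.
    apply: cvgM; first exact: rhoF.
    apply: (cvg_comp _ expR); last exact: continuous_expR.
    apply: cvgM; first exact: cvg_cst.
    by apply: cvgM; [exact: cvg_cst|exact: rhoF].
  rewrite (_ : 0 = n%:R * (n%:R * (s * `|Y|) * `|1%:M - 1%:M : 'M[R]_n|) *
    (n%:R * C * (1 + (1 + s * `|Y|) * expR (2 * (n%:R * (1 + s * `|Y|)))))); last first.
    by rewrite subrr normr0 mulr0 mulr0 mul0r.
  apply: cvgM; last by apply: cvgM; [exact: cvg_cst|exact: DF].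
  apply: cvgM; first exact: cvg_cst.
  apply: cvgM; last by apply: cvg_norm; apply: cvgB; [exact: cvg_cst|exact: psiF].
  apply: cvgM; first exact: cvg_cst.
  by apply: cvgM; [exact: cvg_cst|exact: eN].
apply: squeeze_cvgr (cvg_cst 0) bF; apply: nearW => x; rewrite normr_ge0/=.
(* The difference of the N-th powers has A - exp(E) = E (1 - psi) as a factor, since [A] commutes
   with exp(E). The N terms of the cofactor are absorbed by N |E| <= s |e|, and what remains tends
   to 0 with 1 - psi. *)
rewrite subrXX_comm; last first.
  rewrite /GRing.comm -!mulmxE; apply: expmx_intertwine.
  by rewrite /E mulmxBl mulmxBr mul1mx mulmx1.
rewrite -mulmxE (le_trans (mx_norm_mul _ _))//.
have AQ : A x - expmx (E x) = E x *m (1%:M - psi x).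
  by rewrite mulmxBr mulmx1 -expmx_sub1 /E opprB addrA subrK.
rewrite AQ.
have sumN : `|\sum_(i < N x) A x ^+ ((N x).-1 - i) * expmx (E x) ^+ i| <=
    (N x)%:R * (n%:R * C * D x).
  rewrite (le_trans (ler_norm_sum _ _ _))// mulr_natl -[X in _ *+ X]card_ord.
  rewrite -sumr_const; apply: ler_sum => i _; rewrite -mulmxE.
  rewrite (le_trans (mx_norm_mul _ _))// ler_pM ?mulr_ge0//.
    by rewrite ler_wpM2l// GC//; exact: matrix_group_exp.
  by apply: QD; exact: ltnW.
have EN : (N x)%:R * `|E x| <= s * `|e x|.
  have -> : `|E x| = t x * `|e x|.
    by rewrite /e normrZ ger0_norm ?invr_ge0 ?ltW// mulrA divff ?mul1r// gt_eqF.
  by rewrite mulrA ler_wpM2r// Nts.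
apply: (@le_trans _ _ (n%:R * (n%:R * `|E x| * `|1%:M - psi x|) *
    ((N x)%:R * (n%:R * C * D x)))).
  by rewrite ler_pM// ?mulr_ge0// ler_wpM2l// mx_norm_mul.
rewrite (_ : _ * _ = n%:R * (n%:R * ((N x)%:R * `|E x|) * `|1%:M - psi x|) *
  (n%:R * C * D x)); last by ring.
by rewrite ler_wpM2r ?mulr_ge0// ler_wpM2l// ler_wpM2r// ler_wpM2l.
Qed.

End LieAlgebras.

(** * The Lie algebra of a direct product *)

Section DirectProduct.
Variables (R : realType) (n : nat).
Variables (G1 G2 : set 'M[R]_n) (g1 g2 : {vspace 'M[R]_n}).
Hypotheses (G1m : matrix_group G1) (G1c : compact G1).
Hypotheses (G2m : matrix_group G2) (G2c : compact G2).
Hypotheses (G12 : direct_product G1 G2).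
Hypotheses (G1g : lie_algebra_of G1 g1) (G2g : lie_algebra_of G2 g2).

Lemma lieb_direct_product X Y : X \in g1 -> Y \in g2 -> lieb X Y = 0.
Proof.
move=> X1 Y2; apply: commuting_expmx => s u; apply: G12.1.
  exact: (G1g X).1.
exact: (G2g Y).1.
Qed.

Lemma capv_direct_product : (g1 :&: g2 = 0)%VS.
Proof.
apply/eqP; rewrite -subv0; apply/subvP => X; rewrite memv_cap => /andP[X1 X2].
rewrite memv0; apply/eqP; apply: expmx_cst1 => s.
have : (G1 `&` G2) (expmx (s *: X)).
  by split; [exact: (G1g X).1|exact: (G2g X).1].
by rewrite G12.2.
Qed.

(* The factors A i, B i of expmx (X / (i + 1)) tend to 1 along an ultrafilter.
   Dividing A i - 1 and B i - 1 by |A i - 1| + 1 / (i + 1) keeps both bounded, and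
   their limits Y and c X - Y lie in g1 and g2; c = 0 would force Y = 0. *)
Lemma lie_product_group X :
  (forall s : R, product_group G1 G2 (expmx (s *: X))) -> X \in (g1 + g2)%VS.
Proof.
move=> XG; pose h (i : nat) : R := i.+1%:R^-1.
have h0 i : 0 < h i by rewrite invr_gt0.
have /choice[AB ABP] : forall i, exists AB : 'M[R]_n * 'M[R]_n,
    [/\ G1 AB.1, G2 AB.2 & expmx (h i *: X) = AB.1 *m AB.2].
  by move=> i; have [A [B [? ? ?]]] := XG (h i); exists (A, B).
pose A i := (AB i).1; pose B i := (AB i).2.
have GA i : G1 (A i) by have [] := ABP i.
have GB i : G2 (B i) by have [] := ABP i.
have XAB i : expmx (h i *: X) = A i *m B i by have [] := ABP i.
have [F [FU Foo]] := @ultraFilterLemma nat \oo _.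
have FP : ProperFilter F := @ultra_proper _ _ FU.
have hF : h x @[x --> F] --> (0 : R).
  by move=> N N0; apply: Foo; exact: (@cvg_harmonic R) N N0.
have expF : expmx (h x *: X) @[x --> F] --> (1%:M : 'M[R]_n).
  rewrite -expmx0 -(scale0r X).
  apply: (cvg_comp _ (@expmx R n)); last exact: continuous_expmx.
  by apply: cvgZ; [exact: hF|exact: cvg_cst].
have [a Ga Aa] := ultra_compact_cvg FU G1c GA.
have [b Gb Bb] := ultra_compact_cvg FU G2c GB.
have ab : a *m b = 1%:M.
  have := cvg_mulmx Aa Bb.
  rewrite (_ : (fun x => _) = fun x => expmx (h x *: X)); last first.
    by apply/funext => x; rewrite XAB.
  by move=> /(_ _) c; exact: (cvg_unique (@norm_hausdorff _ _) c expF).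
(* The limit [a] is the inverse of [b], hence lies in both factors. *)
have a1 : a = 1%:M.
  have : (G1 `&` G2) a.
    split=> //; have [_ _ /(_ _ Gb)[bu]] := G2m.
    by rewrite -[invmx b]mul1mx -ab -mulmxA mulmxV// mulmx1.
  by rewrite G12.2.
have b1 : b = 1%:M by rewrite -ab a1 mul1mx.
pose m i := `|A i - 1%:M| + h i.
have m0 i : 0 < m i by rewrite ltr_wpDl.
have mF : m x @[x --> F] --> (0 : R).
  rewrite -[X in _ --> X]addr0; apply: cvgD hF.
  rewrite -[X in _ --> X](normr0 'M[R]_n); apply: cvg_norm.
  by rewrite -[X in _ --> X](subrr 1%:M) -[in X in _ --> X - _]a1; apply: cvgB;
    [exact: Aa|exact: cvg_cst].
pose e i := (m i)^-1 *: (A i - 1%:M).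
have [Y eY] : exists Y : 'M[R]_n, e x @[x --> F] --> Y.
  apply: (ultra_mx_cvg FU (c := 1)) => i.
  rewrite normrZ gtr0_norm ?invr_gt0// mulrC ler_pdivrMr// mul1r.
  by rewrite lerDl ltW.
have [c _ hc] : exists2 c, `|c| <= 1 & h x / m x @[x --> F] --> c.
  apply: (ultra_bounded_cvg FU) => i.
  rewrite normrM gtr0_norm// gtr0_norm ?invr_gt0// ler_pdivrMr// mul1r.
  by rewrite lerDr.
have Y1 : Y \in g1 by exact: (lie_algebra_limit FP G1m G1c G1g GA m0 mF eY).
have Y2 : c *: X - Y \in g2.
  apply: (lie_algebra_limit FP G2m G2c G2g GB m0 mF).
  (* B - 1 is the difference of exp(hX) - 1 and (A - 1) B. After division by [m] the first tends to
     c X and the second to Y. *)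
  have BE i : (m i)^-1 *: (B i - 1%:M) =
      (h i / m i) *: ((h i)^-1 *: (expmx (h i *: X) - 1%:M)) - e i *m B i.
    rewrite scalerA mulrAC divff ?gt_eqF// mul1r XAB /e -scalemxAl -scalerBr.
    congr (_ *: _); rewrite mulmxBl mul1mx opprB.
    by rewrite [RHS]addrC addrA subrK.
  rewrite (funext BE).
  apply: cvgB; last first.
    by rewrite -[Y]mulmx1 -b1; apply: cvg_mulmx.
  apply: cvgZ => //.
  have h0' : h x @[x --> F] `=>` (0 : R)^'.
    move=> N [d d0 dN]; have : \forall x \near F, `|0 - h x| < d.
      by move/cvgrPdist_lt : hF; apply.
    by apply: filterS => x hd; apply: dN => //; rewrite gt_eqF.
  have /is_deriveP := is_derive_expZ X 0; rewrite scale0r expmx0 mulmx1 => dX.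
  have := cvg_comp _ _ h0' dX.
  rewrite (_ : _ \o _ = fun x => (h x)^-1 *: (expmx (h x *: X) - 1%:M))//.
  by apply/funext => x /=; rewrite addr0 -[h x *: 1]/(h x * 1) mulr1.
have [c0|c0] := eqVneq c 0; last first.
  rewrite -[X](scalerK c0) memvZ// -(subrK Y (c *: X)) addrC.
  by apply: memv_add.
have Y0 : Y = 0.
  apply/eqP; rewrite -memv0 -capv_direct_product memv_cap Y1 -memvN.
  by move: Y2; rewrite c0 scale0r sub0r.
(* By the choice of [m] the two quotients have norms adding up to 1, so their limits cannot both
   vanish. *)
have : `|e x| + h x / m x @[x --> F] --> `|Y| + c.
  by apply: cvgD; [apply: cvg_norm|].
have e1 i : `|e i| + h i / m i = 1.
  by rewrite normrZ gtr0_norm ?invr_gt0// mulrC -mulrDl -/(m i) divff// gt_eqF.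
rewrite (funext e1) Y0 c0 normr0 addr0 => c1.
have c2 : (fun _ : nat => 1 : R^o) x @[x --> F] --> (1 : R^o) by exact: cvg_cst.
have /eqP : (0 : R) = 1 by exact: (cvg_unique (@norm_hausdorff _ R^o) c1 c2).
by rewrite eq_sym oner_eq0.
Qed.

End DirectProduct.

Section LieBracket.
Variables (R : realType) (n : nat).
Implicit Types X Y Z : 'M[R]_n.

Lemma lieb_linear_l (a : R) X Y Z :
  lieb (a *: X + Y) Z = a *: lieb X Z + lieb Y Z.
Proof.
rewrite /lieb mulmxDl mulmxDr -scalemxAl -scalemxAr scalerBr opprD.
by rewrite !addrA; congr (_ + _); rewrite addrAC.
Qed.

Lemma liebC X Y : lieb X Y = - lieb Y X.
Proof. by rewrite /lieb opprB. Qed.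

Lemma lieb_linear_r (a : R) X Y Z :
  lieb Z (a *: X + Y) = a *: lieb Z X + lieb Z Y.
Proof. by rewrite liebC lieb_linear_l opprD -scalerN -!(liebC Z). Qed.

Lemma jacobi X Y Z : lieb X (lieb Y Z) = lieb (lieb X Y) Z + lieb Y (lieb X Z).
Proof.
rewrite /lieb !(mulmxBl, mulmxBr) !mulmxA.
move: (X *m Y *m Z) (X *m Z *m Y) (Y *m Z *m X) (Z *m Y *m X) (Y *m X *m Z)
  (Z *m X *m Y) => a b c d f g.
by apply/matrixP => i j; rewrite !mxE; ring.
Qed.

End LieBracket.

(** * Differentiating the inverse of a matrix *)

Section InverseDerivative.
Variable R : realType.

Lemma cvg_det (T : Type) (F : set_system T) {FF : Filter F} n
    (f : T -> 'M[R]_n) (A : 'M[R]_n) :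
  f x @[x --> F] --> A -> \det (f x) @[x --> F] --> \det A.
Proof.
move=> /cvg_mxP fA; rewrite /determinant.
apply: cvg_big => [|s _]; first exact: add_continuous.
apply: cvgM; first exact: cvg_cst.
apply: cvg_big => [|i _]; last exact: fA.
exact: mul_continuous.
Qed.

Lemma cvg_adj (T : Type) (F : set_system T) {FF : Filter F} n
    (f : T -> 'M[R]_n) (A : 'M[R]_n) :
  f x @[x --> F] --> A -> \adj (f x) @[x --> F] --> \adj A.
Proof.
move=> fA; apply/cvg_mxP => i j; rewrite mxE /cofactor.
have E x : (\adj (f x)) i j = (-1) ^+ (j + i) * \det (row' j (col' i (f x))).
  by rewrite mxE.
rewrite (funext E); apply: cvgM; first exact: cvg_cst.
apply: cvg_det; apply/cvg_mxP => k l; rewrite !mxE.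
have E' x : row' j (col' i (f x)) k l = f x (lift j k) (lift i l).
  by rewrite !mxE.
by rewrite (funext E'); move/cvg_mxP : fA; exact.
Qed.

Lemma near_unitmx (T : Type) (F : set_system T) {FF : Filter F} n
    (f : T -> 'M[R]_n) (A : 'M[R]_n) :
  f x @[x --> F] --> A -> A \in unitmx -> \forall x \near F, f x \in unitmx.
Proof.
move=> fA; rewrite unitmxE unitfE => A0.
have dA : \det (f x) @[x --> F] --> \det A by exact: cvg_det.
move/cvgrPdist_lt : dA => /(_ `|\det A|); rewrite normr_gt0 => /(_ A0).
apply: filterS => x; rewrite unitmxE unitfE; apply: contraTneq => ->.
by rewrite subr0 ltxx.
Qed.

(** Cramer's rule: determinant and adjugate are polynomial in the entries, and near an invertible
    limit the determinant stays nonzero. *)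
Lemma cvg_invmx (T : Type) (F : set_system T) {FF : Filter F} n
    (f : T -> 'M[R]_n) (A : 'M[R]_n) :
  f x @[x --> F] --> A -> A \in unitmx -> invmx (f x) @[x --> F] --> invmx A.
Proof.
move=> fA Au; have A0 : \det A != 0 by move: Au; rewrite unitmxE unitfE.
have : (\det (f x))^-1 *: \adj (f x) @[x --> F] --> invmx A.
  rewrite /invmx Au; apply: cvgZ; last exact: cvg_adj.
  by apply: cvgV => //; exact: cvg_det.
apply: cvg_trans; apply: near_eq_cvg.
by apply: filterS (near_unitmx fA Au) => x xu; rewrite /invmx xu.
Qed.

(** A directional derivative gives continuity along its own line, and that is where the difference
    quotient of the inverse is taken. *)
Lemma is_derive_cvg (V W : normedModType R) (f : V -> W) x v D :
  is_derive x v f D -> f (h *: v + x) @[h --> (0 : R)^'] --> f x.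
Proof.
move=> /is_deriveP fD.
have : h *: (h^-1 *: (f (h *: v + x) - f x)) + f x @[h --> (0 : R)^'] --> f x.
  rewrite -[X in _ --> X]add0r -[X in _ --> X + _](scale0r D).
  apply: cvgD; last exact: cvg_cst.
  by apply: cvgZ; [exact: nbhs_dnbhs|exact: fD].
apply: cvg_trans; apply: near_eq_cvg; near=> h.
have h0 : h != 0 by near: h; exact: nbhs_dnbhs_neq.
by rewrite scalerA divff// scale1r subrK.
Unshelve. all: by end_near. Qed.

(** The identity A^-1 - B^-1 = - A^-1 (A - B) B^-1 reduces the derivative to continuity of the
    inverse along the line. *)
Lemma is_derive_invmx (V : normedModType R) n (F : V -> 'M[R]_n) x v D :
  is_derive x v F D -> F x \in unitmx ->
  is_derive x v (fun y => invmx (F y)) (- (invmx (F x) *m D *m invmx (F x))).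
Proof.
move=> FD Fu; have Fc := is_derive_cvg FD; apply/is_deriveP.
have : - (invmx (F (h *: v + x)) *m (h^-1 *: (F (h *: v + x) - F x)) *m
    invmx (F x)) @[h --> (0 : R)^'] --> - (invmx (F x) *m D *m invmx (F x)).
  apply: cvgN; apply: cvg_mulmx; last exact: cvg_cst.
  apply: cvg_mulmx; [|exact/is_deriveP].
  by apply: cvg_invmx Fu; exact: Fc.
apply: cvg_trans; apply: near_eq_cvg.
have : \forall h \near (0 : R)^', F (h *: v + x) \in unitmx by exact: near_unitmx Fc Fu.
apply: filterS => h hu.
rewrite -scalemxAr -scalemxAl -scalerN; congr (_ *: _).
by rewrite mulmxBr mulmxBl mulVmx// mul1mx mulmxK// opprB.
Qed.

End InverseDerivative.

Section BilinearForms.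
Variables (R : realType) (n : nat).
Local Notation mat := 'M[R]_n.
Implicit Types (X Y Z : mat) (f : mat -> R) (b : mat -> mat -> R).

Definition linear_form f : Prop :=
  forall (a : R) X Y, f (a *: X + Y) = a * f X + f Y.

Definition bilinear_form b : Prop :=
  (forall Z, linear_form (b^~ Z)) /\ (forall Z, linear_form (b Z)).

Section LinearForm.
Variable f : mat -> R.
Hypothesis fl : linear_form f.

Lemma linear_form0 : f 0 = 0.
Proof. by have := fl (-1) 0 0; rewrite scaler0 addr0 mulN1r addNr. Qed.

Lemma linear_formZ a X : f (a *: X) = a * f X.
Proof. by rewrite -[a *: X]addr0 fl linear_form0 addr0. Qed.

Lemma linear_formD X Y : f (X + Y) = f X + f Y.
Proof. by rewrite -[X in f (X + _)]scale1r fl mul1r. Qed.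

Lemma linear_formN X : f (- X) = - f X.
Proof. by rewrite -scaleN1r linear_formZ mulN1r. Qed.

Lemma linear_formB X Y : f (X - Y) = f X - f Y.
Proof. by rewrite linear_formD linear_formN. Qed.

Lemma linear_form_sum (I : Type) (r : seq I) (Q : pred I) (F : I -> mat) :
  f (\sum_(i <- r | Q i) F i) = \sum_(i <- r | Q i) f (F i).
Proof. by apply: big_morph; [exact: linear_formD|exact: linear_form0]. Qed.

Lemma is_derive_form (V : normedModType R) (F : V -> mat) x v D :
  is_derive x v F D -> is_derive x v (fun y => f (F y)) (f D).
Proof.
have fll : linear (f : mat -> R^o) by move=> a X Y; rewrite fl.
pose fL := GRing.isLinear.Build _ _ _ _ (f : mat -> R^o) fll.
pose fl' : {linear mat -> R^o} := HB.pack (f : mat -> R^o) fL.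
exact: (is_derive_linear fl').
Qed.

End LinearForm.

Section BilinearForm.
Variable b : mat -> mat -> R.
Hypothesis bb : bilinear_form b.

Lemma bform0l Z : b 0 Z = 0. Proof. exact: (linear_form0 (bb.1 Z)). Qed.
Lemma bform0r Z : b Z 0 = 0. Proof. exact: (linear_form0 (bb.2 Z)). Qed.
Lemma bformDl X Y Z : b (X + Y) Z = b X Z + b Y Z.
Proof. exact: (linear_formD (bb.1 Z)). Qed.
Lemma bformDr X Y Z : b Z (X + Y) = b Z X + b Z Y.
Proof. exact: (linear_formD (bb.2 Z)). Qed.
Lemma bformBl X Y Z : b (X - Y) Z = b X Z - b Y Z.
Proof. exact: (linear_formB (bb.1 Z)). Qed.
Lemma bformZl a X Z : b (a *: X) Z = a * b X Z.
Proof. exact: (linear_formZ (bb.1 Z)). Qed.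
Lemma bformZr a X Z : b Z (a *: X) = a * b Z X.
Proof. exact: (linear_formZ (bb.2 Z)). Qed.
Lemma bformNl X Z : b (- X) Z = - b X Z.
Proof. exact: (linear_formN (bb.1 Z)). Qed.
Lemma bformNr X Z : b Z (- X) = - b Z X.
Proof. exact: (linear_formN (bb.2 Z)). Qed.
Lemma bform_suml (I : Type) (r : seq I) (Q : pred I) (F : I -> mat) Z :
  b (\sum_(i <- r | Q i) F i) Z = \sum_(i <- r | Q i) b (F i) Z.
Proof. exact: (linear_form_sum (bb.1 Z)). Qed.
Lemma bform_sumr (I : Type) (r : seq I) (Q : pred I) (F : I -> mat) Z :
  b Z (\sum_(i <- r | Q i) F i) = \sum_(i <- r | Q i) b Z (F i).
Proof. exact: (linear_form_sum (bb.2 Z)). Qed.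

Lemma is_derive_bform (V : normedModType R) (F G : V -> mat) x v DF DG :
  is_derive x v F DF -> is_derive x v G DG ->
  is_derive x v (fun y => b (F y) (G y)) (b DF (G x) + b (F x) DG).
Proof.
move=> dF dG.
have bE X Y : b X Y = \sum_(i < n) \sum_(j < n) X i j * b (delta_mx i j) Y.
  rewrite {1}(matrix_sum_delta X) bform_suml; apply: eq_bigr => i _.
  by rewrite bform_suml; apply: eq_bigr => j _; rewrite bformZl.
rewrite (_ : (fun y => _) = \sum_(i < n) \sum_(j < n)
    ((fun y => F y i j) * (fun y => b (delta_mx i j) (G y)))); last first.
  apply/funext => y; rewrite bE fct_sumE; apply: eq_bigr => i _.
  by rewrite fct_sumE; apply: eq_bigr => j _.
have dij i j : is_derive x v
    ((fun y => F y i j) * (fun y => b (delta_mx i j) (G y)))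
    (F x i j *: b (delta_mx i j) DG + b (delta_mx i j) (G x) *: DF i j).
  apply: is_deriveM; first by move/is_derive_mxP : dF; exact.
  exact: (is_derive_form (bb.2 _)).
apply: is_derive_eq (is_derive_sum (fun i => is_derive_sum (dij i))) _.
rewrite [b DF _]bE [b (F x) _]bE -big_split/=; apply: eq_bigr => i _.
rewrite -big_split/=; apply: eq_bigr => j _.
by rewrite addrC; congr (_ + _); exact: mulrC.
Qed.

End BilinearForm.

End BilinearForms.

(** * The exponential chart to second order *)

Section CoordinateFields.
Variables (R : realType) (n : nat).
Local Notation mat := 'M[R]_n.
Implicit Types X V W U : mat.

(** The differential of exp in left trivialisation, before projection to [p]: [coord_field] is its
    image under the projection along [k]. *)
Definition expfield V X : mat := expmx (- X) *m dexp X V.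

Definition dexpfield V X W : mat :=
  dexp (- X) (- W) *m dexp X V + expmx (- X) *m dexp2 X V W.

Lemma is_derive_expmxN X W :
  is_derive X W (fun Y : mat => expmx (- Y)) (dexp (- X) (- W)).
Proof.
by apply: is_derive_expmx_affine => h; rewrite opprD scalerN.
Qed.

Lemma is_derive_dexpN X V U :
  is_derive X U (fun Y : mat => dexp (- Y) V) (dexp2 (- X) V (- U)).
Proof.
apply: is_derive_ursubmx; apply: is_derive_expmx_affine => h.
by rewrite scale_block_mx add_block_mx !scaler0 !add0r opprD scalerN.
Qed.

Lemma is_derive_expfield V X W :
  is_derive X W (expfield V) (dexpfield V X W).
Proof.
exact: is_derive_mulmx (is_derive_expmxN X W) (is_derive_dexp X V W).
Qed.

Lemma expfield0 V : expfield V 0 = V.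
Proof. by rewrite /expfield oppr0 expmx0 dexp0 mul1mx. Qed.

Lemma dexpfield0 V W : dexpfield V 0 W = - 2^-1 *: lieb W V.
Proof.
rewrite /dexpfield oppr0 expmx0 !dexp0 dexp20 mul1mx mulNmx /lieb.
move: (W *m V) (V *m W) => a b.
by apply/matrixP => i j; rewrite !mxE; field.
Qed.

Lemma is_derive_dexpfield0 V W U :
  is_derive 0 U (fun X => dexpfield V X W)
    (6^-1 *: (lieb U (lieb W V) + lieb W (lieb U V))).
Proof.
apply: is_derive_eq (is_deriveD
  (is_derive_mulmx (is_derive_dexpN 0 (- W) U) (is_derive_dexp 0 V U))
  (is_derive_mulmx (is_derive_expmxN 0 U) (is_derive_dexp2 0 V W U))) _.
rewrite oppr0 expmx0 !dexp0 !dexp20 dexp30 mul1mx /lieb.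
rewrite !(mulmxDl, mulmxDr, mulmxN, mulNmx, opprK, =^~ scalemxAl, =^~ scalemxAr).
rewrite !mulmxA.
move: (U *m W *m V) (W *m U *m V) (U *m V *m W) (V *m W *m U) (W *m V *m U)
  (V *m U *m W) => a b c d f g.
by apply/matrixP => i j; rewrite !mxE; field.
Qed.

End CoordinateFields.

(** * The Ricci tensor of an invariant metric *)

Section RicciJet.
Variables (R : realType) (n : nat) (k p : {vspace 'M[R]_n}).
Local Notation mat := 'M[R]_n.
Variable q : mat -> mat -> R.
Hypothesis pk0 : (p :&: k = 0)%VS.
Hypothesis q_lin : forall (a : R) X Y Z, X \in p -> Y \in p -> Z \in p ->
  q (a *: X + Y) Z = a * q X Z + q Y Z.
Hypothesis q_sym : forall X Y, X \in p -> Y \in p -> q X Y = q Y X.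
Hypothesis q_pos : forall X, X \in p -> X != 0 -> 0 < q X X.
Implicit Types X Y Z W U : mat.

Definition pproj X : mat := daddv_pi p k X.
(** The form [q] is controlled on [p] only. Composing with the projection along [k] gives a form
    bilinear on all matrices, into which brackets leaving [p] can be inserted; it supplies the
    subscript p of the brackets. *)
Definition pform X Y : R := q (pproj X) (pproj Y).

Local Notation P := pproj.
Local Notation b := pform.
Local Notation d := (\dim p).
Local Notation e := (@frame R n p).

Lemma pproj_mem X : P X \in p.
Proof. exact: memv_pi. Qed.

Lemma pproj_id X : X \in p -> P X = X.
Proof. exact: daddv_pi_id. Qed.

Lemma pproj_linear a X Y : P (a *: X + Y) = a *: P X + P Y.
Proof. exact: linearP. Qed.

Lemma pform_bilinear : bilinear_form b.
Proof.
have bl Z : linear_form (b^~ Z).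
  by move=> a X Y; rewrite /b pproj_linear q_lin// pproj_mem.
split=> // Z a X Y; rewrite /b q_sym ?pproj_mem//.
by have := bl Z a X Y; rewrite /b => ->; rewrite !(q_sym (pproj_mem Z)) ?pproj_mem.
Qed.

Lemma pformC X Y : b X Y = b Y X.
Proof. by rewrite /b q_sym// pproj_mem. Qed.

Lemma pform_projl X Y : b (P X) Y = b X Y.
Proof. by rewrite /b (pproj_id (pproj_mem X)). Qed.

Lemma pform_p X Y : X \in p -> Y \in p -> b X Y = q X Y.
Proof. by move=> Xp Yp; rewrite /b !pproj_id. Qed.

Lemma frame_mem i : e i \in p.
Proof. by rewrite vbasis_mem// mem_nth// size_tuple. Qed.

Definition gram : 'M[R]_d := \matrix_(i, j) b (e i) (e j).

(** A vector in the kernel gives an element of [p] that is [q]-orthogonal to [p], in particular to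
    itself. *)
Lemma gram_unit : gram \in unitmx.
Proof.
rewrite -row_free_unit; apply: inj_row_free => v v0.
pose X : mat := \sum_i v 0 i *: e i.
have Xp : X \in p by apply: memv_suml => i _; rewrite memvZ// frame_mem.
have bX Y : Y \in p -> b X Y = 0.
  move=> Yp; rewrite (coord_vbasis Yp) (bform_sumr pform_bilinear) big1// => j _.
  rewrite (bformZr pform_bilinear) /X (bform_suml pform_bilinear).
  have /matrixP/(_ 0 j) := v0; rewrite !mxE => vj.
  rewrite [X in _ * X](_ : _ = 0) ?mulr0// -[RHS]vj; apply: eq_bigr => i _.
  by rewrite (bformZl pform_bilinear) mxE.
have X0 : X = 0.
  apply/eqP; apply: contraT => X0; have := q_pos Xp X0.
  by rewrite -pform_p// bX// ltxx.
apply/rowP => i; rewrite mxE.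
have /freeP := basis_free (vbasisP p); apply.
by rewrite -[RHS]X0; apply: eq_bigr.
Qed.

Definition dual (a : 'I_d) : mat := \sum_c invmx gram a c *: e c.
Local Notation e' := dual.

Lemma dual_mem i : e' i \in p.
Proof. by apply: memv_suml => j _; rewrite memvZ// frame_mem. Qed.

Lemma invmx_gram_sym a c : invmx gram a c = invmx gram c a.
Proof.
have gT : gram^T = gram by apply/matrixP => i j; rewrite !mxE pformC.
by rewrite -[in LHS]gT -trmx_inv mxE.
Qed.

Lemma linear_form_dual f a : linear_form f ->
  \sum_c invmx gram a c * f (e c) = f (e' a).
Proof.
move=> fl; rewrite /e' (linear_form_sum fl); apply: eq_bigr => c _.
by rewrite (linear_formZ fl).
Qed.

Lemma pform_dual i j : b (e i) (e' j) = (i == j)%:R.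
Proof.
rewrite -(linear_form_dual _ (pform_bilinear.2 _)).
have /matrixP/(_ i j) := mulmxV gram_unit; rewrite !mxE => <-.
by apply: eq_bigr => c _; rewrite invmx_gram_sym mxE mulrC.
Qed.

Lemma coord_frame X i : X \in p -> coord (vbasis p) i X = b X (e' i).
Proof.
move=> Xp; rewrite {2}(coord_vbasis Xp) (bform_suml pform_bilinear).
rewrite (bigD1 i)//= big1 ?addr0 => [|j ji]; rewrite (bformZl pform_bilinear).
  by rewrite -/(e i) pform_dual eqxx mulr1.
by rewrite -/(e j) pform_dual (negbTE ji) mulr0.
Qed.

Lemma dual_expand X : \sum_a b X (e' a) *: e a = P X.
Proof.
rewrite [RHS](coord_vbasis (pproj_mem X)); apply: eq_bigr => a _.
by rewrite coord_frame ?pproj_mem// pform_projl.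
Qed.

(** The tensor with components the inverse Gram matrix is symmetric. This moves the prime from one
    slot of a bilinear expression to the other and replaces the choice of an orthonormal basis. *)
Lemma dual_swap (F : mat -> mat -> R) : bilinear_form F ->
  \sum_a F (e a) (e' a) = \sum_a F (e' a) (e a).
Proof.
move=> Fb; under eq_bigr do rewrite -(linear_form_dual _ (Fb.2 _)).
rewrite exchange_big/=; apply: eq_bigr => c _.
rewrite -(linear_form_dual _ (Fb.1 _)).
by apply: eq_bigr => a _; rewrite invmx_gram_sym.
Qed.

Lemma frame_expand X : \sum_a b X (e a) *: e' a = P X.
Proof.
rewrite -dual_expand; apply/matrixP => i j; rewrite !summxE.
pose F Y Z := b X Y * Z i j.
have Fb : bilinear_form F.
  by split=> Z a U V; rewrite /F ?pform_bilinear.2 ?mxE; ring.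
have := dual_swap Fb; rewrite /F => FE.
under eq_bigr do rewrite mxE; rewrite FE.
by apply: eq_bigr => a _; rewrite mxE.
Qed.

(* The first two derivatives at 0 of the metric coefficients, read off
   exp(-X) (d exp)_X V = V - [X, V] / 2 + [X, [X, V]] / 6 - ... *)
Definition H1 W X Y : R := - 2^-1 * (b (lieb W X) Y + b X (lieb W Y)).

Definition H2 W U X Y : R :=
  6^-1 * (b (lieb U (lieb W X)) Y + b (lieb W (lieb U X)) Y
          + b X (lieb U (lieb W Y)) + b X (lieb W (lieb U Y)))
  + 4^-1 * (b (lieb W X) (lieb U Y) + b (lieb U X) (lieb W Y)).

(* Lowering an index, Gam is the Christoffel symbol at 0 and Gam2 the part of its
   derivative along U that comes from second derivatives of the metric. *)
Definition Gam Z X Y : R := 2^-1 * (b (lieb Z X) Y + b X (lieb Z Y)).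

Definition Gam2 Z X Y U : R := 2^-1 * (H2 X U Y Z + H2 Y U X Z - H2 Z U X Y).

(** The terms with [X, Y] cancel, as they must for a torsion-free connection in coordinates. What is
    left is the symmetric tensor U of homogeneous geometry, 2 q(U(X, Y), Z) = q([Z, X], Y) + q(X,
    [Z, Y]). *)
Lemma Gam_H1 Z X Y : Gam Z X Y = 2^-1 * (H1 X Y Z + H1 Y X Z - H1 Z X Y).
Proof.
rewrite /Gam /H1 (liebC Y X) (liebC Z X) (liebC Z Y).
rewrite !(bformNl pform_bilinear) !(bformNr pform_bilinear).
by rewrite (pformC Y (lieb X Z)); field.
Qed.

(** Compatibility of the connection with the metric at the origin. It removes first derivatives of
    the metric in favour of Christoffel symbols. *)
Lemma H1_Gam W X Y : H1 W X Y = Gam Y W X + Gam X W Y.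
Proof.
rewrite /Gam /H1 (liebC Y W) (liebC X W) (liebC X Y).
rewrite !(bformNl pform_bilinear) !(bformNr pform_bilinear).
by rewrite (pformC (lieb W Y) X); field.
Qed.

Local Notation linE :=
  (pform_bilinear.1, pform_bilinear.2, lieb_linear_l, lieb_linear_r).

Lemma H1_bilinear W : bilinear_form (H1 W).
Proof. by split=> Z a X Y; rewrite /H1 !linE; ring. Qed.

Lemma H2_linear1 a V W U X Y :
  H2 (a *: V + W) U X Y = a * H2 V U X Y + H2 W U X Y.
Proof. by rewrite /H2 !linE; ring. Qed.

Lemma H2C W U X Y : H2 W U X Y = H2 U W X Y.
Proof. by rewrite /H2; ring. Qed.

Lemma H2_sym W U X Y : H2 W U X Y = H2 W U Y X.
Proof.
rewrite /H2 ![b (lieb _ (lieb _ _)) _]pformC !(pformC (lieb _ Y)); ring.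
Qed.

Lemma H2_linear2 a V W U X Y :
  H2 U (a *: V + W) X Y = a * H2 U V X Y + H2 U W X Y.
Proof. by rewrite H2C H2_linear1 !(H2C U). Qed.

Lemma H2_linear3 a V W U X Y :
  H2 U X (a *: V + W) Y = a * H2 U X V Y + H2 U X W Y.
Proof. by rewrite /H2 !linE; ring. Qed.

Lemma H2_linear4 a V W U X Y :
  H2 U X Y (a *: V + W) = a * H2 U X Y V + H2 U X Y W.
Proof. by rewrite H2_sym H2_linear3 ![H2 U X _ Y]H2_sym. Qed.

Local Notation H2_linear := (H2_linear1, H2_linear2, H2_linear3, H2_linear4).

Lemma Gam_linear X Y : linear_form (fun Z => Gam Z X Y).
Proof. by move=> a Z W; rewrite /Gam !linE; ring. Qed.

Lemma Gam_bilinear Z : bilinear_form (Gam Z).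
Proof. by split=> W a X Y; rewrite /Gam !linE; ring. Qed.

Local Notation Gam_lin :=
  (Gam_linear, (fun Z => (Gam_bilinear Z).1), (fun Z => (Gam_bilinear Z).2)).

Lemma Gam2_linear X Y U : linear_form (fun Z => Gam2 Z X Y U).
Proof. by move=> a Z W; rewrite /Gam2 !H2_linear; ring. Qed.

Definition metric_derivative W X (i j : 'I_d) : R :=
  b (dexpfield (e i) X W) (expfield (e j) X)
  + b (expfield (e i) X) (dexpfield (e j) X W).

Lemma metric_coefE X i j :
  metric_coef k p q X i j = b (expfield (e i) X) (expfield (e j) X).
Proof.
by rewrite mxE /coord_field !(@derive_val _ _ _ _ _ _ _ (is_derive_expmx _ _)).
Qed.

Lemma is_derive_metric_coef X W i j :
  is_derive X W (fun Y => metric_coef k p q Y i j) (metric_derivative W X i j).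
Proof.
rewrite (funext (fun X => metric_coefE X i j)).
by apply: (is_derive_bform pform_bilinear); exact: is_derive_expfield.
Qed.

Lemma metric_derivative0 W i j : metric_derivative W 0 i j = H1 W (e i) (e j).
Proof.
rewrite /metric_derivative /H1 !dexpfield0 !expfield0.
by rewrite (bformZl pform_bilinear) (bformZr pform_bilinear) mulrDr.
Qed.

Lemma is_derive_metric_derivative W U i j :
  is_derive (0 : mat) U (fun X => metric_derivative W X i j) (H2 W U (e i) (e j)).
Proof.
have d1 V := is_derive_expfield V 0 U; have d2 V := is_derive_dexpfield0 V W U.
apply: is_derive_eq (is_deriveD
  (is_derive_bform pform_bilinear (d2 (e i)) (d1 (e j)))
  (is_derive_bform pform_bilinear (d1 (e i)) (d2 (e j)))) _.
rewrite !dexpfield0 !expfield0 /H2.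
rewrite !(bformZl pform_bilinear) !(bformZr pform_bilinear).
by rewrite !(bformDl pform_bilinear) !(bformDr pform_bilinear); field.
Qed.

Lemma metric_coef0 : metric_coef k p q 0 = gram.
Proof. by apply/matrixP => i j; rewrite metric_coefE !expfield0 mxE. Qed.

Lemma christoffelE a i j X : christoffel k q a i j X =
  \sum_(c < d) 2^-1 * invmx (metric_coef k p q X) a c *
    (metric_derivative (e i) X j c + metric_derivative (e j) X i c
     - metric_derivative (e c) X i j).
Proof.
rewrite /christoffel mulr_sumr; apply: eq_bigr => c _; rewrite -mulrA.
by rewrite /partial !(@derive_val _ _ _ _ _ _ _ (is_derive_metric_coef _ _ _ _)).
Qed.

Lemma christoffel0 a i j : christoffel k q a i j 0 = Gam (e' a) (e i) (e j).
Proof.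
rewrite christoffelE metric_coef0 -(linear_form_dual _ (Gam_linear _ _)).
by apply: eq_bigr => c _; rewrite Gam_H1 !metric_derivative0; ring.
Qed.

(** Product rule: second derivatives of the metric give [Gam2], and the derivative of the inverse
    metric gives the sum. *)
Lemma partial_christoffel0 c a i j : partial c (christoffel k q a i j) 0 =
  Gam2 (e' a) (e i) (e j) (e c)
  - \sum_l H1 (e c) (e' a) (e' l) * Gam (e l) (e i) (e j).
Proof.
pose A : 'M[R]_d := \matrix_(i, j) H1 (e c) (e i) (e j).
have dM : is_derive (0 : mat) (e c) (metric_coef k p q) A.
  apply/is_derive_mxP => u v.
  by apply: is_derive_eq (is_derive_metric_coef _ _ _ _) _; rewrite metric_derivative0 mxE.
have Mu : metric_coef k p q 0 \in unitmx by rewrite metric_coef0 gram_unit.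
have /is_derive_mxP dJ := is_derive_invmx dM Mu.
pose C c' X := metric_derivative (e i) X j c' + metric_derivative (e j) X i c'
  - metric_derivative (e c') X i j.
pose C2 c' := H2 (e i) (e c) (e j) (e c') + H2 (e j) (e c) (e i) (e c')
  - H2 (e c') (e c) (e i) (e j).
have dC c' : is_derive (0 : mat) (e c) (C c') (C2 c').
  exact: (is_deriveB (is_deriveD (is_derive_metric_derivative (e i) (e c) j c')
    (is_derive_metric_derivative (e j) (e c) i c'))
    (is_derive_metric_derivative (e c') (e c) i j)).
have chrE : christoffel k q a i j = 2^-1 \*: (\sum_(c' < d)
    ((fun X => invmx (metric_coef k p q X) a c') * C c')).
  apply/funext => X; rewrite christoffelE/= fct_sumE scaler_sumr.
  by apply: eq_bigr => c' _; rewrite -mulrA.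
have dchr := is_deriveZ 2^-1 (is_derive_sum (fun c' => is_deriveM (dJ a c') (dC c'))).
rewrite /partial chrE (@derive_val _ _ _ _ _ _ _ dchr) metric_coef0.
rewrite big_split/= scalerDr; congr (_ + _).
  rewrite -(linear_form_dual _ (Gam2_linear _ _ _)) scaler_sumr.
  apply: eq_bigr => c' _; rewrite /Gam2 /C2.
  by move: (_ + _ - _) => x; rewrite /GRing.scale/=; ring.
have JAJ c' : (invmx gram *m A *m invmx gram) a c' = \sum_l invmx gram c' l *
    H1 (e c) (e' a) (e l).
  rewrite mxE; apply: eq_bigr => l _; rewrite mulrC invmx_gram_sym; congr (_ * _).
  rewrite mxE -(linear_form_dual _ ((H1_bilinear (e c)).1 _)).
  by apply: eq_bigr => m _; rewrite mxE.
rewrite scaler_sumr -sumrN; apply: eq_bigr => c' _.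
rewrite mxE JAJ (linear_form_dual _ ((H1_bilinear (e c)).2 _)) Gam_H1.
have -> : C c' 0 = H1 (e i) (e j) (e c') + H1 (e j) (e i) (e c')
    - H1 (e c') (e i) (e j) by rewrite /C !metric_derivative0.
by move: (H1 _ (e' a) _) (_ + _ - _) => x y; rewrite /GRing.scale/=; ring.
Qed.

Hypothesis trace0 : forall W, W \in p -> \sum_a b (lieb W (e a)) (e' a) = 0.

(** An antisymmetric bracket is contracted with a symmetric tensor. *)
Lemma sum_lieb_dual : \sum_a lieb (e a) (e' a) = 0.
Proof.
have E : \sum_a lieb (e a) (e' a) = \sum_a lieb (e' a) (e a).
  apply/matrixP => i j; rewrite !summxE.
  pose F Y Z := (lieb Y Z) i j.
  have Fb : bilinear_form F.
    by split=> Z a U V; rewrite /F ?lieb_linear_l ?lieb_linear_r !mxE; ring.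
  exact: (dual_swap Fb).
have : (2 : R) *: (\sum_a lieb (e a) (e' a)) = 0.
  rewrite scaler_nat mulr2n {2}E -big_split/= big1// => a _.
  by rewrite (liebC (e' a)) subrr.
by move/eqP; rewrite scaler_eq0 pnatr_eq0/= => /eqP.
Qed.

Lemma sum_lieb_dual' : \sum_a lieb (e' a) (e a) = 0.
Proof.
under eq_bigr do rewrite liebC.
by rewrite sumrN sum_lieb_dual oppr0.
Qed.

Lemma trace0' W : W \in p -> \sum_a b (e' a) (lieb (e a) W) = 0.
Proof.
move=> Wp; transitivity (- \sum_a b (lieb W (e a)) (e' a)); last by rewrite trace0// oppr0.
rewrite -sumrN; apply: eq_bigr => a _; by rewrite liebC (bformNr pform_bilinear) pformC.
Qed.

(** The divergence of the metric coefficients vanishes at the origin; this removes the inverse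
    metric term from the derivative of Gamma^a_{ij} summed over [a]. *)
Lemma H1_trace Z : Z \in p -> \sum_a H1 (e a) (e' a) Z = 0.
Proof.
move=> Zp; rewrite /H1 -mulr_sumr big_split/= trace0'// addr0.
by rewrite -(bform_suml pform_bilinear) sum_lieb_dual (bform0l pform_bilinear) mulr0.
Qed.

(** The contraction Gamma^a_{aZ} is the logarithmic derivative of the volume density, which is
    stationary at the origin because the traces of the projected ad(W) vanish. *)
Lemma Gam_trace Z : Z \in p -> \sum_a Gam (e' a) (e a) Z = 0.
Proof.
move=> Zp; rewrite /Gam -mulr_sumr big_split/=.
rewrite -(bform_suml pform_bilinear) sum_lieb_dual' (bform0l pform_bilinear) add0r.
pose F X Y := b X (lieb Y Z).
have Fb : bilinear_form F by split=> W a X Y; rewrite /F !linE; ring.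
by have := dual_swap Fb; rewrite /F => ->; rewrite trace0'// mulr0.
Qed.

Definition ricci_sum X Y : R :=
  \sum_a (Gam2 (e' a) X Y (e a) - Gam2 (e' a) X (e a) Y)
  + \sum_a \sum_c Gam (e c) Y (e' a) * Gam (e' c) X (e a).

Lemma ricci_coefE i j : ricci_coef k q i j = ricci_sum (e i) (e j).
Proof.
rewrite /ricci_coef; under eq_bigr do rewrite !partial_christoffel0.
under [X in _ + X]eq_bigr do under eq_bigr do rewrite !christoffel0.
have -> : \sum_a (Gam2 (e' a) (e i) (e j) (e a)
      - \sum_l H1 (e a) (e' a) (e' l) * Gam (e l) (e i) (e j)
      - (Gam2 (e' a) (e i) (e a) (e j)
      - \sum_l H1 (e j) (e' a) (e' l) * Gam (e l) (e i) (e a))) =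
    \sum_a (Gam2 (e' a) (e i) (e j) (e a) - Gam2 (e' a) (e i) (e a) (e j))
    + \sum_a \sum_l H1 (e j) (e' a) (e' l) * Gam (e l) (e i) (e a).
  transitivity (\sum_a (Gam2 (e' a) (e i) (e j) (e a) - Gam2 (e' a) (e i) (e a) (e j)
    + \sum_l H1 (e j) (e' a) (e' l) * Gam (e l) (e i) (e a))
    - \sum_a \sum_l H1 (e a) (e' a) (e' l) * Gam (e l) (e i) (e j)).
    by rewrite -sumrB; apply: eq_bigr => a _; ring.
  rewrite [X in _ - X]exchange_big/= [X in _ - X]big1 ?subr0 ?big_split// => l _.
  by rewrite -mulr_suml H1_trace ?dual_mem// mul0r.
rewrite /ricci_sum -addrA; congr (_ + _).
(* The product containing the contraction Gamma^a_{ac} drops out by [Gam_trace]. *)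
have -> : \sum_a \sum_c (Gam (e' a) (e a) (e c) * Gam (e' c) (e i) (e j)
      - Gam (e' a) (e j) (e c) * Gam (e' c) (e i) (e a)) =
    - \sum_a \sum_c Gam (e' a) (e j) (e c) * Gam (e' c) (e i) (e a).
  under eq_bigr do rewrite big_split/=.
  rewrite big_split/= exchange_big/= big1 ?add0r => [|c _].
    by rewrite -sumrN; apply: eq_bigr => a _; rewrite -sumrN.
  by rewrite -mulr_suml Gam_trace ?frame_mem// mul0r.
have -> : \sum_a \sum_l H1 (e j) (e' a) (e' l) * Gam (e l) (e i) (e a) =
    \sum_a \sum_l H1 (e j) (e' a) (e l) * Gam (e' l) (e i) (e a).
  apply: eq_bigr => a _.
  pose F X Y := H1 (e j) (e' a) X * Gam Y (e i) (e a).
  have Fb : bilinear_form F.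
    split=> W c X Y; rewrite /F; first by rewrite (H1_bilinear _).2; ring.
    by rewrite Gam_linear; ring.
  by have := dual_swap Fb; rewrite /F => ->.
(* By [H1_Gam] the derivative of the metric is a sum of two Christoffel symbols, one of which
   cancels the remaining quadratic term. *)
rewrite -sumrB; apply: eq_bigr => a _; rewrite -sumrB; apply: eq_bigr => l _.
by rewrite H1_Gam; ring.
Qed.

Lemma ricci_sum_bilinear : bilinear_form ricci_sum.
Proof.
split=> Z a X Y; rewrite /ricci_sum mulrDr addrACA; congr (_ + _).
- rewrite mulr_sumr -big_split/=; apply: eq_bigr => c _.
  by rewrite /Gam2 !H2_linear; ring.
- rewrite mulr_sumr -big_split/=; apply: eq_bigr => c _.
  rewrite mulr_sumr -big_split/=; apply: eq_bigr => l _.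
  by rewrite !Gam_lin; ring.
- rewrite mulr_sumr -big_split/=; apply: eq_bigr => c _.
  by rewrite /Gam2 !H2_linear; ring.
- rewrite mulr_sumr -big_split/=; apply: eq_bigr => c _.
  rewrite mulr_sumr -big_split/=; apply: eq_bigr => l _.
  by rewrite !Gam_lin; ring.
Qed.

Lemma ricciE X Y : X \in p -> Y \in p -> ricci k p q X Y = ricci_sum X Y.
Proof.
move=> Xp Yp; have rb := ricci_sum_bilinear.
rewrite {2}(coord_vbasis Xp) (bform_suml rb) /ricci; apply: eq_bigr => i _.
rewrite (bformZl rb) {2}(coord_vbasis Yp) (bform_sumr rb) mulr_sumr.
by apply: eq_bigr => j _; rewrite (bformZr rb) ricci_coefE mulrA.
Qed.

End RicciJet.

(** * The Ricci tensor as a combination of traces *)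

Section RicciFormula.
Variables (R : realType) (n : nat) (k p : {vspace 'M[R]_n}).
Local Notation mat := 'M[R]_n.
Variable q : mat -> mat -> R.
Hypothesis pk0 : (p :&: k = 0)%VS.
Hypothesis q_lin : forall (a : R) X Y Z, X \in p -> Y \in p -> Z \in p ->
  q (a *: X + Y) Z = a * q X Z + q Y Z.
Hypothesis q_sym : forall X Y, X \in p -> Y \in p -> q X Y = q Y X.
Hypothesis q_pos : forall X, X \in p -> X != 0 -> 0 < q X X.

Local Notation P := (pproj k p).
Local Notation b := (pform k p q).
Local Notation e := (@frame R n p).
Local Notation e' := (@dual R n k p q).

Hypothesis lieb_pp : forall X Y, X \in p -> Y \in p -> lieb X Y \in (p + k)%VS.
Hypothesis lieb_kp : forall Z X, Z \in k -> X \in p -> lieb Z X \in p.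
Hypothesis skew_k : forall Z X Y, Z \in k -> X \in p -> Y \in p ->
  q (lieb Z X) Y + q X (lieb Z Y) = 0.
Hypothesis trace_p : forall W, W \in p -> \sum_a b (lieb W (e a)) (e' a) = 0.
Variable B : mat -> mat -> R.
Hypothesis B_sym : forall X Y, X \in p -> Y \in p -> B X Y = B Y X.
Hypothesis B_trace : forall X Y, X \in p -> Y \in p -> B X Y =
  \sum_a b (lieb X (lieb Y (e a))) (e' a)
  + \sum_a b (lieb Y (lieb X (e a) - P (lieb X (e a)))) (e' a).
Implicit Types X Y Z W : mat.

Let bb := pform_bilinear k q_lin q_sym.
Let bC := pformC k q_sym.
Let swap F := @dual_swap R n k p q q_sym F.
Let e_in := @frame_mem R n p.
Let e'_in := @dual_mem R n k p q.
Let PE := @pproj_linear R n k p.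
Local Notation linE := (bb.1, bb.2, lieb_linear_l, lieb_linear_r).
Local Notation bE := (bformNl bb, bformNr bb).

Lemma lieb_sumr (I : Type) (r : seq I) (Q : pred I) (F : I -> mat) X :
  lieb X (\sum_(i <- r | Q i) F i) = \sum_(i <- r | Q i) lieb X (F i).
Proof.
apply: (big_morph (lieb X)) => [U V|]; last by rewrite /lieb mulmx0 mul0mx subrr.
by rewrite -[U in lieb X (U + _)]scale1r lieb_linear_r scale1r.
Qed.

Lemma lieb0r X : lieb X 0 = 0.
Proof. by rewrite /lieb mulmx0 mul0mx subrr. Qed.

Lemma liebZr (c : R) X Y : lieb X (c *: Y) = c *: lieb X Y.
Proof. by rewrite -[c *: Y]addr0 lieb_linear_r lieb0r addr0. Qed.

Let PZ (c : R) X : P (c *: X) = c *: P X.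
Proof. exact: linearZ. Qed.

Lemma sub_pproj_mem V : V \in (p + k)%VS -> V - P V \in k.
Proof.
move=> Vpk; rewrite -[V in V - _](daddv_pi_add pk0 Vpk) /pproj addrC addKr.
exact: memv_pi.
Qed.

(** On the [k] component, ad(Z) is [q]-skew on [p], so its trace equals its negative. *)
Lemma trace_pk W : W \in (p + k)%VS -> \sum_a b (lieb W (e a)) (e' a) = 0.
Proof.
move=> Wpk; pose Z := W - P W; have Zk : Z \in k by exact: sub_pproj_mem.
have -> : W = P W + Z by rewrite /Z addrC subrK.
have lD U V X : lieb (U + V) X = lieb U X + lieb V X.
  by rewrite -[U in lieb (U + V)]scale1r lieb_linear_l scale1r.
under eq_bigr do rewrite lD (bformDl bb).
rewrite big_split/= trace_p ?add0r; last exact: memv_pi.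
have E : \sum_a b (lieb Z (e a)) (e' a) = - \sum_a b (lieb Z (e' a)) (e a).
  rewrite -sumrN; apply: eq_bigr => a _; apply/eqP; rewrite -addr_eq0.
  have := skew_k Zk (e_in a) (e'_in a).
  rewrite -!(pform_p q pk0)// ?lieb_kp// => /eqP.
  by rewrite (bC (e a)).
pose F X Y := b (lieb Z X) Y.
have Fb : bilinear_form F by split=> V a X Y; rewrite /F !linE; ring.
move: E; rewrite -(swap Fb) /F => /eqP; rewrite -addr_eq0 -mulr2n mulrn_eq0/=.
by move/eqP.
Qed.

(** The second order terms of the Ricci tensor are expressed by these sums. [beta] and [gamma] are
    the parts of the Killing form whose inner loops run over [p] and through [k]; [rho] and [rho_p]
    are intermediate and cancel in [ricci_formula]. *)
Definition sigma X Y : R := \sum_a b (lieb X (e a)) (lieb Y (e' a)).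
Definition tau X Y : R :=
  \sum_a \sum_c b (lieb (e a) (e c)) X * b (lieb (e' a) (e' c)) Y.
Definition beta X Y : R := \sum_a b (lieb X (lieb Y (e a))) (e' a).
Definition rho X Y : R := \sum_a b Y (lieb (e a) (lieb X (e' a))).
Definition rho_p X Y : R := \sum_a b Y (lieb (e a) (P (lieb X (e' a)))).
Definition gamma X Y : R :=
  \sum_a b (lieb Y (lieb X (e a) - P (lieb X (e a)))) (e' a).

Lemma sigmaC X Y : sigma X Y = sigma Y X.
Proof.
pose F U V := b (lieb X U) (lieb Y V).
have Fb : bilinear_form F by split=> V a U W; rewrite /F !linE; ring.
have := swap Fb; rewrite /F /sigma => ->.
by apply: eq_bigr => a _; rewrite bC.
Qed.

Lemma lieb_dual0 : \sum_a lieb (e a) (e' a) = 0.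
Proof. exact: sum_lieb_dual. Qed.

Lemma lieb_dual_swap X : \sum_a b X (lieb (e a) (e' a)) = 0.
Proof. by rewrite -(bform_sumr bb) lieb_dual0 (bform0r bb). Qed.

(** The difference is the trace of the projected ad([X, Y]), by the Jacobi identity. *)
Lemma betaC X Y : X \in p -> Y \in p -> beta X Y = beta Y X.
Proof.
move=> Xp Yp; apply/eqP; rewrite -subr_eq0 -sumrB.
have /eqP := trace_pk (lieb_pp Xp Yp); congr (_ == _); apply: eq_bigr => a _.
by rewrite (jacobi X Y) (bformDl bb) addrK.
Qed.

Lemma gammaC X Y : X \in p -> Y \in p -> gamma X Y = gamma Y X.
Proof.
move=> Xp Yp; have BE U V : U \in p -> V \in p -> B U V = beta U V + gamma U V.
  exact: B_trace.
by have := B_sym Xp Yp; rewrite !BE// betaC// => /addrI.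
Qed.

(** The inner bracket is split along p + k. Its [k] part acts skewly and can be moved to the other
    argument, where it produces [gamma]. *)
Lemma rhoE X Y : X \in p -> Y \in p -> rho X Y = rho_p X Y - gamma X Y.
Proof.
move=> Xp Yp; rewrite -[LHS](subrK (rho_p X Y)) addrC; congr (_ + _).
pose F U V := b (lieb Y (lieb X U - P (lieb X U))) V.
have Fb : bilinear_form F.
  split=> V a U W; rewrite /F; last by rewrite !linE.
  rewrite lieb_linear_r PE opprD addrACA -scalerBr.
  by rewrite lieb_linear_r bb.1.
rewrite /gamma (swap Fb) /F -sumrB -sumrN; apply: eq_bigr => a _.
set V := lieb X (e' a).
have Vk : V - P V \in k by apply: sub_pproj_mem; exact: lieb_pp.
have := skew_k Vk Yp (e_in a); rewrite -!(pform_p q pk0)// ?lieb_kp//.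
have -> : b Y (lieb (e a) V) - b Y (lieb (e a) (P V)) = b Y (lieb (e a) (V - P V)).
  have -> : V - P V = -1 *: P V + V by rewrite scaleN1r addrC.
  by rewrite lieb_linear_r bb.2 mulN1r addrC.
move/eqP; rewrite addrC addr_eq0 => /eqP sk.
by rewrite (liebC (e a)) (liebC Y) !bE sk opprK.
Qed.

(** [H2] is symmetric in its two differentiation arguments and in its two metric arguments, so a
    pair can be contracted in three ways: across the two groups, as here, or inside one of them, as
    in the next two lemmas. *)
Lemma sum_H2_14 X Y : X \in p -> Y \in p ->
  \sum_a H2 k p q X (e a) Y (e' a) =
  - 6^-1 * beta X Y + 6^-1 * rho X Y - 4^-1 * sigma X Y.
Proof.
move=> Xp Yp; rewrite /H2 big_split/= -!mulr_sumr !big_split/=.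
have -> : \sum_a b (lieb (e a) (lieb X Y)) (e' a) = 0.
  transitivity (- \sum_a b (lieb (lieb X Y) (e a)) (e' a)).
    by rewrite -sumrN; apply: eq_bigr => a _; rewrite liebC bE.
  by rewrite trace_pk ?oppr0//; exact: lieb_pp.
have -> : \sum_a b (lieb X (lieb (e a) Y)) (e' a) = - beta X Y.
  rewrite -sumrN; apply: eq_bigr => a _.
  by rewrite (liebC (e a)) -scaleN1r liebZr (bformZl bb) mulN1r.
have -> : \sum_a b Y (lieb X (lieb (e a) (e' a))) = 0.
  by rewrite -(bform_sumr bb) -lieb_sumr lieb_dual0 lieb0r (bform0r bb).
have -> : \sum_a b (lieb (e a) Y) (lieb X (e' a)) = - sigma X Y.
  by rewrite sigmaC -sumrN; apply: eq_bigr => a _; rewrite liebC bE.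
by rewrite lieb_dual_swap -/(rho X Y); ring.
Qed.

Lemma sum_H2_12 X Y : X \in p -> Y \in p ->
  \sum_a H2 k p q (e' a) (e a) X Y =
  - 3^-1 * (rho X Y + rho Y X) + 2^-1 * sigma X Y.
Proof.
move=> Xp Yp; rewrite /H2 big_split/= -!mulr_sumr !big_split/=.
have rho1 U V : \sum_a b V (lieb (e a) (lieb (e' a) U)) = - rho U V.
  rewrite -sumrN; apply: eq_bigr => a _.
  by rewrite (liebC (e' a)) -scaleN1r liebZr (bformZr bb) mulN1r.
have rho2 U V : \sum_a b V (lieb (e' a) (lieb (e a) U)) = - rho U V.
  pose F W Z := b V (lieb W (lieb Z U)).
  have Fb : bilinear_form F by split=> W a Z Z'; rewrite /F !linE; ring.
  by rewrite -(swap Fb) /F rho1.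
under eq_bigr do rewrite bC.
rewrite rho1; under eq_bigr do rewrite bC.
rewrite rho2 rho1 rho2.
have sig : \sum_a b (lieb (e a) X) (lieb (e' a) Y) = sigma X Y.
  by apply: eq_bigr => a _; rewrite (liebC (e a)) (liebC (e' a)) !bE opprK.
have -> : \sum_a b (lieb (e' a) X) (lieb (e a) Y) = sigma X Y.
  pose F W Z := b (lieb W X) (lieb Z Y).
  have Fb : bilinear_form F by split=> W a Z Z'; rewrite /F !linE; ring.
  by rewrite -(swap Fb) /F sig.
by rewrite sig; field.
Qed.

Lemma sum_H2_34 X Y : X \in p -> Y \in p ->
  \sum_a H2 k p q X Y (e a) (e' a) = 2 / 3 * beta X Y + 2^-1 * sigma X Y.
Proof.
move=> Xp Yp; rewrite /H2 big_split/= -!mulr_sumr !big_split/=.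
rewrite -!/(beta _ _) -!/(sigma _ _).
have beta' U V : \sum_a b (e a) (lieb U (lieb V (e' a))) = beta U V.
  pose F W Z := b W (lieb U (lieb V Z)).
  have Fb : bilinear_form F by split=> W a Z Z'; rewrite /F !linE; ring.
  by rewrite (swap Fb) /F; apply: eq_bigr => a _; rewrite bC.
by rewrite !beta' (betaC Yp Xp) (sigmaC Y X); field.
Qed.

Lemma sum_pform_dual U V : \sum_a b U (e' a) * b V (e a) = b U V.
Proof.
rewrite -(pform_projl q pk0 U) -(dual_expand pk0 q_lin q_sym q_pos U).
rewrite (bform_suml bb); apply: eq_bigr => a _.
by rewrite (bformZl bb) (bC (e a)).
Qed.

(** Of the four products, the sum over [a] collapses by duality in all but the one that gives [tau].
    It restores only the [p] component of a bracket, hence [rho_p] where the second derivatives give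
    [rho]. *)
Lemma sum_Gam X Y : X \in p -> Y \in p ->
  \sum_a \sum_c Gam k p q (e c) Y (e' a) * Gam k p q (e' c) X (e a) =
  4^-1 * (sigma X Y + tau X Y - rho_p X Y - rho_p Y X).
Proof.
move=> Xp Yp.
have t1 : \sum_c \sum_a b (lieb (e c) Y) (e' a) * b (lieb (e' c) X) (e a) = sigma X Y.
  rewrite sigmaC; apply: eq_bigr => c _; rewrite sum_pform_dual.
  by rewrite (liebC (e c)) (liebC (e' c)) !bE opprK.
have t23 U V : \sum_c b V (lieb (e c) (P (lieb (e' c) U))) = - rho_p U V.
  rewrite -sumrN; apply: eq_bigr => c _.
  by rewrite (liebC (e' c)) -scaleN1r PZ liebZr (bformZr bb) mulN1r.
have t2 : \sum_c \sum_a b (lieb (e c) Y) (e' a) * b X (lieb (e' c) (e a)) =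
    - rho_p Y X.
  pose F W Z := b X (lieb W (P (lieb Z Y))).
  have Fb : bilinear_form F.
    by split=> W a Z Z'; rewrite /F ?linE ?PE ?linE.
  rewrite -t23 (swap Fb) /F; apply: eq_bigr => c _.
  rewrite -(dual_expand pk0 q_lin q_sym q_pos) lieb_sumr (bform_sumr bb).
  by apply: eq_bigr => a _; rewrite liebZr (bformZr bb).
have t3 : \sum_c \sum_a b Y (lieb (e c) (e' a)) * b (lieb (e' c) X) (e a) =
    - rho_p X Y.
  rewrite -t23; apply: eq_bigr => c _.
  rewrite -(frame_expand pk0 q_lin q_sym q_pos) lieb_sumr (bform_sumr bb).
  by apply: eq_bigr => a _; rewrite liebZr (bformZr bb) mulrC.
have t4 : \sum_c \sum_a b Y (lieb (e c) (e' a)) * b X (lieb (e' c) (e a)) = tau X Y.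
  rewrite exchange_big/=.
  pose F U V := \sum_a b Y (lieb U (e' a)) * b X (lieb V (e a)).
  have Fb : bilinear_form F.
    split=> W a Z Z'; rewrite /F mulr_sumr -big_split/=; apply: eq_bigr => c _;
      by rewrite !linE; ring.
  transitivity (\sum_c F (e c) (e' c)); first by rewrite exchange_big.
  rewrite (swap Fb) exchange_big/=; apply: eq_bigr => a _; apply: eq_bigr => c _.
  rewrite mulrC (liebC (e c)) (liebC (e' c)) !bE mulrNN.
  by rewrite (bC X) (bC Y).
rewrite exchange_big/=.
transitivity (4^-1 * (\sum_c \sum_a (b (lieb (e c) Y) (e' a) * b (lieb (e' c) X) (e a))
  + \sum_c \sum_a (b (lieb (e c) Y) (e' a) * b X (lieb (e' c) (e a)))
  + \sum_c \sum_a (b Y (lieb (e c) (e' a)) * b (lieb (e' c) X) (e a))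
  + \sum_c \sum_a (b Y (lieb (e c) (e' a)) * b X (lieb (e' c) (e a))))).
  rewrite -!big_split/= mulr_sumr; apply: eq_bigr => c _.
  rewrite -!big_split/= mulr_sumr; apply: eq_bigr => a _.
  by rewrite /Gam; field.
by rewrite t1 t2 t3 t4; congr (_ * _); ring.
Qed.

Lemma ricci_formula X Y : X \in p -> Y \in p -> ricci k p q X Y =
  - 2^-1 * B X Y - 2^-1 * sigma X Y + 4^-1 * tau X Y.
Proof.
move=> Xp Yp; rewrite (ricciE pk0 q_lin q_sym q_pos trace_p Xp Yp) /ricci_sum.
rewrite sum_Gam//.
have E1 := sum_H2_14 Xp Yp; have E2 := sum_H2_14 Yp Xp.
have E3 := sum_H2_12 Xp Yp; have E4 := sum_H2_34 Xp Yp.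
set s1 := \sum_a _ in E1; set s2 := \sum_a _ in E2.
set s3 := \sum_a _ in E3; set s4 := \sum_a _ in E4.
have -> : \sum_a (Gam2 k p q (e' a) X Y (e a) - Gam2 k p q (e' a) X (e a) Y) =
    2^-1 * (s1 + s2 - s3 - s4).
  pose F U V := H2 k p q U Y X V.
  have Fb : bilinear_form F.
    by split=> V a U W; rewrite /F ?(H2_linear1 k q_lin q_sym) ?(H2_linear4 k q_lin q_sym).
  have := swap Fb; rewrite /F => swE.
  have -> : s2 = \sum_a H2 k p q (e' a) Y X (e a).
    by rewrite -swE; apply: eq_bigr => a _; rewrite H2C.
  rewrite -big_split/= -!sumrB mulr_sumr; apply: eq_bigr => a _.
  by rewrite /Gam2 (H2C k p q (e a) Y); ring.
have -> : B X Y = beta X Y + gamma X Y by rewrite B_trace.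
move: s1 s2 s3 s4 E1 E2 E3 E4 => s1 s2 s3 s4 -> -> -> ->.
(* The [rho_p] terms cancel those of [sum_Gam], and the two halves of [gamma] complete [beta] to the
   Killing form. *)
rewrite (rhoE Xp Yp) (rhoE Yp Xp).
rewrite (sigmaC Y X) (betaC Yp Xp) (gammaC Yp Xp).
move: (beta X Y) (gamma X Y) (sigma X Y) (tau X Y) (rho_p X Y) (rho_p Y X).
by move=> x1 x2 x3 x4 x5 x6; field.
Qed.

End RicciFormula.

(** * Traces and Killing forms *)

Section Traces.
Variables (R : realType) (n : nat).
Local Notation mat := 'M[R]_n.
Implicit Types (U V W : {vspace mat}) (f g h : mat -> mat) (X Y Z : mat).

Definition linear_map f : Prop :=
  forall (a : R) X Y, f (a *: X + Y) = a *: f X + f Y.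

Definition maps f U V : Prop := forall X, X \in U -> f X \in V.

(** Traces can be evaluated in any family with reconstructing forms, so a frame of [k_ l] can be
    transported to its images as it stands, with rescaled coordinate forms. *)
Definition coord_system (I : finType) U (e : I -> mat) (eps : I -> mat -> R) :=
  [/\ forall i, e i \in U, forall i, linear_form (eps i)
    & forall X, X \in U -> X = \sum_i eps i X *: e i].

Lemma linear_map0 f : linear_map f -> f 0 = 0.
Proof.
by move=> fl; have := fl (-1) 0 0; rewrite scaler0 addr0 scaleN1r addNr.
Qed.

Lemma linear_mapD f X Y : linear_map f -> f (X + Y) = f X + f Y.
Proof. by move=> fl; have := fl 1 X Y; rewrite !scale1r. Qed.

Lemma linear_mapZ f a X : linear_map f -> f (a *: X) = a *: f X.
Proof. by move=> fl; rewrite -[a *: X]addr0 fl (linear_map0 fl) addr0. Qed.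

Lemma linear_mapN f X : linear_map f -> f (- X) = - f X.
Proof. by move=> fl; rewrite -scaleN1r linear_mapZ// scaleN1r. Qed.

Lemma linear_mapB f X Y : linear_map f -> f (X - Y) = f X - f Y.
Proof. by move=> fl; rewrite linear_mapD// linear_mapN. Qed.

Lemma linear_map_sum (I : Type) (r : seq I) (Q : pred I) (F : I -> mat) f :
  linear_map f -> f (\sum_(i <- r | Q i) F i) = \sum_(i <- r | Q i) f (F i).
Proof.
move=> fl; apply: big_morph; [move=> X Y; exact: linear_mapD|exact: linear_map0].
Qed.

Lemma linear_map_lieb X : linear_map (lieb X).
Proof. by move=> a Y Z; rewrite lieb_linear_r. Qed.

Lemma linear_map_comp f g : linear_map f -> linear_map g ->
  linear_map (fun X => f (g X)).
Proof. by move=> fl gl a X Y; rewrite gl fl. Qed.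

Lemma linear_map_id : linear_map id.
Proof. by []. Qed.

Lemma linear_map_add f g : linear_map f -> linear_map g ->
  linear_map (fun X => f X + g X).
Proof. by move=> fl gl a X Y; rewrite fl gl scalerDr addrACA. Qed.

Lemma linear_map_scale c f : linear_map f -> linear_map (fun X => c *: f X).
Proof. by move=> fl a X Y; rewrite fl scalerDr !scalerA mulrC. Qed.

Lemma linear_map_opp f : linear_map f -> linear_map (fun X => - f X).
Proof. by move=> fl a X Y; rewrite fl opprD scalerN. Qed.

Lemma linear_map_sums (I : Type) (r : seq I) (F : I -> mat -> mat) :
  (forall i, linear_map (F i)) -> linear_map (fun X => \sum_(i <- r) F i X).
Proof.
move=> Fl a X Y; rewrite scaler_sumr -big_split/=.
by apply: eq_bigr => i _; rewrite Fl.
Qed.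

Lemma linear_map_form (phi : mat -> R) Z : linear_form phi ->
  linear_map (fun X => phi X *: Z).
Proof. by move=> fl a X Y; rewrite fl scalerDl scalerA. Qed.

(** One double sum read in two orders. With [g] the identity it shows that a trace does not depend
    on the coordinates; in general it is tr(gf) = tr(fg) between different spaces. *)
Lemma coord_system_cyclic (I J : finType) U V (e : I -> mat) eps (v : J -> mat) eta
    f g :
  coord_system U e eps -> coord_system V v eta ->
  linear_map f -> linear_map g -> maps f U V -> maps g V U ->
  \sum_i eps i (g (f (e i))) = \sum_j eta j (f (g (v j))).
Proof.
move=> [eU epsl eE] [vV etal vE] fl gl fUV gVU.
transitivity (\sum_i \sum_j eta j (f (e i)) * eps i (g (v j))).
  apply: eq_bigr => i _; rewrite {1}(vE (f (e i)) (fUV _ (eU i))).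
  rewrite (linear_map_sum _ _ _ gl) (linear_form_sum (epsl i)).
  by apply: eq_bigr => j _; rewrite linear_mapZ// (linear_formZ (epsl i)).
rewrite exchange_big/=; apply: eq_bigr => j _.
rewrite [in RHS](eE (g (v j)) (gVU _ (vV j))).
rewrite (linear_map_sum _ _ _ fl) (linear_form_sum (etal j)).
by apply: eq_bigr => i _; rewrite linear_mapZ// (linear_formZ (etal j)) mulrC.
Qed.

Lemma coord_linear_form m (X : m.-tuple mat) i : linear_form (coord X i).
Proof. by move=> a Y Z; rewrite linearP. Qed.

Lemma coord_system_vbasis U :
  coord_system U (fun i : 'I_(\dim U) => (vbasis U)`_i) (coord (vbasis U)).
Proof.
split=> [i|i|X]; [|exact: coord_linear_form|exact: coord_vbasis].
by rewrite vbasis_mem// mem_nth// size_tuple.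
Qed.

Lemma trace_onE (I : finType) U (e : I -> mat) eps f :
  coord_system U e eps -> linear_map f -> maps f U U ->
  trace_on U f = \sum_i eps i (f (e i)).
Proof.
move=> es fl fU.
exact: (coord_system_cyclic (coord_system_vbasis U) es fl linear_map_id fU).
Qed.

Lemma trace_onC U V f g : linear_map f -> linear_map g ->
  maps f U V -> maps g V U ->
  trace_on U (fun X => g (f X)) = trace_on V (fun X => f (g X)).
Proof.
by move=> fl gl; apply: (coord_system_cyclic
  (coord_system_vbasis U) (coord_system_vbasis V) fl gl).
Qed.

Lemma eq_trace_on U f g : (forall X, X \in U -> f X = g X) ->
  trace_on U f = trace_on U g.
Proof.
move=> fg; apply: eq_bigr => i _; rewrite fg//.
by rewrite vbasis_mem// mem_nth// size_tuple.
Qed.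

Lemma trace_onD U f g :
  trace_on U (fun X => f X + g X) = trace_on U f + trace_on U g.
Proof. by rewrite -big_split/=; apply: eq_bigr => i _; rewrite linearD. Qed.

Lemma trace_onZ U c f : trace_on U (fun X => c *: f X) = c * trace_on U f.
Proof. by rewrite mulr_sumr; apply: eq_bigr => i _; rewrite linearZ. Qed.

Lemma trace_onN U f : trace_on U (fun X => - f X) = - trace_on U f.
Proof. by rewrite -sumrN; apply: eq_bigr => i _; rewrite linearN. Qed.

Lemma trace_on_sum (I : Type) (r : seq I) U (F : I -> mat -> mat) :
  trace_on U (fun X => \sum_(i <- r) F i X) = \sum_(i <- r) trace_on U (F i).
Proof.
by rewrite exchange_big/=; apply: eq_bigr => i _; rewrite linear_sum.
Qed.

Lemma trace_on0 U f : (forall X, X \in U -> f X = 0) -> trace_on U f = 0.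
Proof.
move=> f0; rewrite (eq_trace_on (g := fun=> 0))//.
by apply: big1 => i _; rewrite linear0.
Qed.

(** Cyclicity with the inclusion of [V] in [U] as the second map. *)
Lemma trace_on_sub U V f : linear_map f -> (V <= U)%VS -> maps f U V ->
  trace_on U f = trace_on V f.
Proof.
move=> fl VU fUV.
apply: (trace_onC (g := id)) => //; exact: (subvP VU).
Qed.

Lemma trace_on_proj (I : finType) U (V : I -> {vspace mat}) (pr : I -> mat -> mat) f :
  (forall i, linear_map (pr i)) -> (forall i, (V i <= U)%VS) ->
  (forall i, maps (pr i) U (V i)) ->
  (forall X, X \in U -> X = \sum_i pr i X) ->
  linear_map f -> maps f U U ->
  trace_on U f = \sum_i trace_on (V i) (fun X => pr i (f X)).
Proof.
move=> prl VU prV prE fl fU.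
rewrite (eq_trace_on (g := fun X => \sum_i pr i (f X))); last first.
  by move=> X XU; apply: prE; exact: fU.
rewrite trace_on_sum; apply: eq_bigr => i _; apply: trace_on_sub => //.
- exact: linear_map_comp.
- by move=> X XU; apply: prV; exact: fU.
Qed.

Lemma trace_on_conj (h : 'End(mat)) U f f' :
  (U :&: lker h = 0)%VS -> linear_map f' -> maps f U U ->
  (forall X, X \in U -> f' (h X) = h (f X)) ->
  trace_on (h @: U) f' = trace_on U f.
Proof.
move=> Uh f'l fU f'h.
pose v := map_tuple h (vbasis U).
have vb : basis_of (h @: U)%VS v by exact: limg_basis_of Uh (vbasisP U).
have vE (i : 'I_(\dim U)) : v`_i = h (vbasis U)`_i.
  by rewrite (nth_map 0) ?size_tuple.
have vs : coord_system (h @: U)%VS (fun i : 'I_(\dim U) => v`_i) (coord v).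
  split=> [i|i|X Xh]; [|exact: coord_linear_form|exact: (coord_basis vb Xh)].
  by rewrite vE memv_img// vbasis_mem// mem_nth// size_tuple.
rewrite (trace_onE vs f'l) => [|_ /memv_imgP[X XU ->]]; last first.
  by rewrite f'h// memv_img// fU.
apply: eq_bigr => i _; rewrite vE f'h; last first.
  by rewrite vbasis_mem// mem_nth// size_tuple.
set Y := f _; have YU : Y \in U.
  by rewrite fU// vbasis_mem// mem_nth// size_tuple.
rewrite {1}(coord_vbasis YU) linear_sum/=.
under eq_bigr do rewrite linearZ/= -vE.
by rewrite (coord_sum_free _ _ (basis_free vb)).
Qed.

End Traces.

Section KillingForm.
Variables (R : realType) (n : nat).
Local Notation mat := 'M[R]_n.
Implicit Types (h : {vspace mat}) (X Y Z : mat).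

Definition subalgebra h := forall X Y, X \in h -> Y \in h -> lieb X Y \in h.

Lemma linear_map_lieb2 X Y : linear_map (fun Z => lieb X (lieb Y Z)).
Proof. by move=> a Z W; rewrite !lieb_linear_r. Qed.

Lemma killing_bilinear h : bilinear_form (killing h).
Proof.
split=> Z a X Y; rewrite /killing /trace_on mulr_sumr -big_split/=;
  apply: eq_bigr => i _.
  by rewrite lieb_linear_l linearP.
by rewrite lieb_linear_l lieb_linear_r linearP.
Qed.

Lemma killingC h X Y : maps (lieb X) h h -> maps (lieb Y) h h ->
  killing h X Y = killing h Y X.
Proof. by move=> Xh Yh; apply: trace_onC => //; exact: linear_map_lieb. Qed.

(** Both sides expand by the Jacobi identity into the trace of ad X ad Y ad Z minus a second trace,
    and the second traces agree by cyclicity. *)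
Lemma killing_invariant h X Y Z :
  maps (lieb X) h h -> maps (lieb Y) h h -> maps (lieb Z) h h ->
  killing h (lieb X Y) Z = killing h X (lieb Y Z).
Proof.
move=> Xh Yh Zh; rewrite /killing.
have lE U V W : lieb (lieb U V) W = lieb U (lieb V W) - lieb V (lieb U W).
  by rewrite (jacobi U V) addrK.
rewrite (eq_trace_on (g := fun W => lieb X (lieb Y (lieb Z W))
  - lieb Y (lieb X (lieb Z W)))) => [|W _]; last by rewrite lE.
rewrite [RHS](eq_trace_on (g := fun W => lieb X (lieb Y (lieb Z W))
  - lieb X (lieb Z (lieb Y W)))) => [|W _]; last first.
  by rewrite lE linear_mapB//; exact: linear_map_lieb.
rewrite !trace_onD !trace_onN; congr (_ - _).
apply: (trace_onC (f := fun W => lieb X (lieb Z W)) (g := lieb Y)) => //.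
- exact: linear_map_lieb2.
- exact: linear_map_lieb.
- by move=> W Wh; apply: Xh; exact: Zh.
Qed.

End KillingForm.

(** * One factor and the images of the ideals of the isotropy algebra *)

Section IsotropySide.
Variables (R : realType) (n t : nat) (h : {vspace 'M[R]_n}).
Local Notation mat := 'M[R]_n.
Variables (V : 'I_t.+1 -> {vspace mat}) (U : 'I_t.+1 -> seq mat).
Local Notation B := (killing h).
Hypothesis h_sub : subalgebra h.
Hypothesis V_h : forall l, (V l <= h)%VS.
Hypothesis V_sub : forall l, subalgebra (V l).
Hypothesis V_comm : forall l m X Y, l != m -> X \in V l -> Y \in V m ->
  lieb X Y = 0.
Hypothesis V_orth : forall l m X Y, l != m -> X \in V l -> Y \in V m ->
  B X Y = 0.
Hypothesis U_on : forall l, orthonormal_basis (fun X Y => - B X Y) (V l) (U l).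
Implicit Types X Y Z W : mat.

Let Bb := killing_bilinear h.
Let lL := @linear_map_lieb R n.
Let lL2 := @linear_map_lieb2 R n.

Definition horizontal : {vspace mat} := orthv B h (\sum_(l < t.+1) V l).
Local Notation pp := horizontal.

Definition proj_ideal l X : mat :=
  \sum_(i < size (U l)) (- B X (U l)`_i) *: (U l)`_i.
Local Notation pi := proj_ideal.

Definition proj_hor X : mat := X - \sum_(l < t.+1) pi l X.
Local Notation pr := proj_hor.

Lemma lieb_h X : X \in h -> maps (lieb X) h h.
Proof. by move=> Xh Y Yh; exact: h_sub. Qed.

Lemma BC X Y : X \in h -> Y \in h -> B X Y = B Y X.
Proof. by move=> Xh Yh; apply: killingC; exact: lieb_h. Qed.

Lemma Binv X Y Z : X \in h -> Y \in h -> Z \in h ->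
  B (lieb X Y) Z = B X (lieb Y Z).
Proof. by move=> Xh Yh Zh; apply: killing_invariant; exact: lieb_h. Qed.

Lemma Bskew X Y Z : X \in h -> Y \in h -> Z \in h ->
  B (lieb X Y) Z = - B Y (lieb X Z).
Proof. by move=> Xh Yh Zh; rewrite liebC (bformNl Bb) Binv. Qed.

Lemma ideal_h l X : X \in V l -> X \in h.
Proof. exact: (subvP (V_h l)). Qed.

Lemma horizontalP X :
  X \in pp <-> X \in h /\ forall l Y, Y \in V l -> B X Y = 0.
Proof.
have Bl Y : linear (fun Z => B Z Y : R^o) by move=> a Z W; rewrite Bb.1.
have Br Y : linear (fun Z => B Y Z : R^o) by move=> a Z W; rewrite Bb.2.
rewrite (mem_orthv _ _ _ Bl Br); split=> -[Xh XV]; split=> //.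
  by move=> l Y Yl; apply: XV; apply: (subvP (sumv_sup l _ (subvv _))).
move=> Y /memv_sumP[Ys YsV ->]; rewrite (bform_sumr Bb) big1// => l _.
exact: XV (YsV l _).
Qed.

Lemma horizontal_h X : X \in pp -> X \in h.
Proof. by case/horizontalP. Qed.

Lemma U_mem l i : (i < size (U l))%N -> (U l)`_i \in V l.
Proof.
by move=> il; rewrite (basis_mem (U_on l).1)// mem_nth.
Qed.

Lemma coord_system_ideal l :
  coord_system (V l) (fun i : 'I_(size (U l)) => (U l)`_i)
    (fun i X => - B X (U l)`_i).
Proof.
split=> [i|i a X Y|X Xl]; first exact: U_mem.
  by rewrite Bb.1; ring.
have [Ub Uo] := U_on l.
rewrite [LHS](coord_basis (X := in_tuple (U l)) Ub Xl).
apply: eq_bigr => i _; congr (_ *: _).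
rewrite [in RHS](coord_basis (X := in_tuple (U l)) Ub Xl) (bform_suml Bb).
rewrite (bigD1 i)//= (bformZl Bb) big1 => [|j ji]; last first.
  rewrite (bformZl Bb) -[B _ _]opprK Uo//.
  rewrite (_ : (j == i :> nat) = false); last exact: negbTE.
  by rewrite mulr0n oppr0 mulr0.
by rewrite addr0 -mulrN Uo// eqxx mulr1.
Qed.

Lemma proj_ideal_linear l : linear_map (pi l).
Proof.
by apply: linear_map_sums => i; apply: linear_map_form => a X Y; rewrite Bb.1; ring.
Qed.

Lemma proj_hor_linear : linear_map pr.
Proof.
apply: linear_map_add => //; apply: linear_map_opp; apply: linear_map_sums => l.
exact: proj_ideal_linear.
Qed.

Lemma proj_ideal_mem l X : pi l X \in V l.
Proof. by apply: memv_suml => i _; rewrite memvZ// U_mem. Qed.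

Lemma proj_ideal_id l X : X \in V l -> pi l X = X.
Proof. by move=> Xl; have [_ _ /(_ X Xl)] := coord_system_ideal l => /esym. Qed.

Lemma proj_ideal_other l m X : X \in V m -> m != l -> pi l X = 0.
Proof.
move=> Xm ml; apply: big1 => i _.
by rewrite (V_orth ml Xm (U_mem (ltn_ord i))) oppr0 scale0r.
Qed.

Lemma proj_ideal_hor l X : X \in pp -> pi l X = 0.
Proof.
move=> /horizontalP[_ XV]; apply: big1 => i _.
by rewrite (XV l _ (U_mem (ltn_ord i))) oppr0 scale0r.
Qed.

Lemma proj_hor_id X : X \in pp -> pr X = X.
Proof.
by move=> Xp; rewrite /pr big1 ?subr0// => l _; rewrite proj_ideal_hor.
Qed.

Lemma proj_hor_ideal l X : X \in V l -> pr X = 0.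
Proof.
move=> Xl; rewrite /pr (bigD1 l)//= proj_ideal_id// big1 ?addr0 ?subrr// => m ml.
by rewrite (proj_ideal_other Xl)// eq_sym.
Qed.

Lemma B_proj_ideal l X Y : X \in h -> Y \in V l -> B (pi l X) Y = B X Y.
Proof.
move=> Xh Yl; have [_ _ /(_ Y Yl) YE] := coord_system_ideal l.
rewrite [in RHS]YE (bform_sumr Bb) (bform_suml Bb); apply: eq_bigr => i _.
rewrite (bformZl Bb) (bformZr Bb) (BC (ideal_h Yl)) 1?mulrC ?mulNr ?mulrN 1?mulrC//.
exact: ideal_h (U_mem (ltn_ord i)).
Qed.

Lemma proj_hor_mem X : X \in h -> pr X \in pp.
Proof.
move=> Xh; apply/horizontalP; split.
  by rewrite memvB// memv_suml// => l _; exact: ideal_h (proj_ideal_mem l X).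
move=> l Y Yl; rewrite (bformBl Bb) (bform_suml Bb) (bigD1 l)//= B_proj_ideal//.
rewrite big1 ?addr0 ?subrr// => m ml.
exact: V_orth ml (proj_ideal_mem m X) Yl.
Qed.

(** Invariance moves ad(Z) to the other argument, where it preserves [V l] and kills every other
    [V m]. *)
Lemma lieb_ideal_hor l Z X : Z \in V l -> X \in pp -> lieb Z X \in pp.
Proof.
move=> Zl /horizontalP[Xh XV]; have Zh := ideal_h Zl.
apply/horizontalP; split; first exact: h_sub.
move=> m Y Ym; rewrite Bskew//; last exact: ideal_h Ym.
have [lm|lm] := eqVneq l m; last by rewrite (V_comm lm Zl Ym) (bform0r Bb) oppr0.
by rewrite (XV l) ?oppr0// V_sub// lm.
Qed.

Lemma lieb_hor_ideal l Z X : Z \in V l -> X \in pp -> lieb X Z \in pp.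
Proof. by move=> Zl Xp; rewrite liebC memvN (lieb_ideal_hor Zl). Qed.

Lemma trace_on_split f : linear_map f -> maps f h h ->
  trace_on h f = trace_on pp (fun X => pr (f X))
    + \sum_(l < t.+1) trace_on (V l) (fun X => pi l (f X)).
Proof.
move=> fl fh.
(* The one-element type indexes the horizontal summand. *)
pose W (s : 'I_1 + 'I_t.+1) := match s with inl _ => pp | inr l => V l end.
pose P (s : 'I_1 + 'I_t.+1) := match s with inl _ => pr | inr l => pi l end.
rewrite (trace_on_proj (V := W) (pr := P) _ _ _ _ fl fh).
- by rewrite big_sumType/= big_ord1.
- by case=> l; [exact: proj_hor_linear|exact: proj_ideal_linear].
- by case=> l //=; apply/subvP; exact: horizontal_h.
- by case=> l X Xh /=; [exact: proj_hor_mem|exact: proj_ideal_mem].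
- by move=> X Xh; rewrite big_sumType/= big_ord1 subrK.
Qed.

(** This is the form B(X, C Y) of the Casimir operator, by [casimir_formE]. It is written as a trace
    because it enters as a block of the trace that defines B. *)
Definition casimir_form l X Y : R :=
  trace_on (V l) (fun Z => pi l (lieb X (lieb Y Z))).
Local Notation N := casimir_form.

Lemma casimir_form_sum l X Y : X \in h -> Y \in h ->
  N l X Y = \sum_(i < size (U l)) - B (lieb X (lieb Y (U l)`_i)) (U l)`_i.
Proof.
move=> Xh Yh; rewrite /N (trace_onE (coord_system_ideal l)).
- apply: eq_bigr => i _; rewrite B_proj_ideal//; last exact: U_mem.
  by do 2!apply: h_sub => //; exact: ideal_h (U_mem (ltn_ord i)).
- by apply: linear_map_comp => //; exact: proj_ideal_linear.
- by move=> Z _; exact: proj_ideal_mem.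
Qed.

(** Invariance turns -B([X, [Y, u]], u) into -B(X, [u, [u, Y]]) for each [u] of the orthonormal
    basis. *)
Lemma casimir_formE l X Y : X \in h -> Y \in h ->
  N l X Y = B X (casimir (U l) Y).
Proof.
move=> Xh Yh; rewrite casimir_form_sum// /casimir (bformNr Bb) (bform_sumr Bb).
rewrite (big_nth 0) big_mkord -sumrN; apply: eq_bigr => i _; congr (- _).
have uh := ideal_h (U_mem (ltn_ord i)).
rewrite Bskew ?h_sub// [RHS]BC ?h_sub// [RHS]Bskew ?h_sub//.
by rewrite (liebC _ Y) (liebC _ X) (bformNl Bb) (bformNr Bb) opprK.
Qed.

Lemma casimir_formC l X Y : X \in h -> Y \in h -> N l X Y = N l Y X.
Proof.
move=> Xh Yh; rewrite !casimir_form_sum//; apply: eq_bigr => i _; congr (- _).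
have uh := ideal_h (U_mem (ltn_ord i)).
by rewrite (Bskew Xh (h_sub Yh uh) uh) (Bskew Yh (h_sub Xh uh) uh)
   (BC (h_sub Yh uh) (h_sub Xh uh)).
Qed.

(** The forms [N l] are removed twice: once as the trace over the ideals inside B, once as the paths
    from the horizontal space through [V l] and back, which have the same trace by cyclicity. *)
Lemma trace_hor_hor X Y : X \in pp -> Y \in pp ->
  trace_on pp (fun Z => pr (lieb X (pr (lieb Y Z)))) =
  B X Y - 2 * \sum_(l < t.+1) N l X Y.
Proof.
move=> Xp Yp; have Xh := horizontal_h Xp; have Yh := horizontal_h Yp.
have fh : maps (fun Z => lieb X (lieb Y Z)) h h.
  by move=> Z Zh; do 2!apply: h_sub => //.
have E : B X Y = trace_on pp (fun Z => pr (lieb X (lieb Y Z))) + \sum_l N l X Y.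
  by rewrite -(trace_on_split (lL2 X Y) fh).
have F l : trace_on pp (fun Z => pr (lieb X (pi l (lieb Y Z)))) = N l X Y.
  rewrite casimir_formC//.
  rewrite (@trace_onC _ _ pp (V l) (fun Z => pi l (lieb Y Z)) (fun Z => pr (lieb X Z))).
  - apply: eq_trace_on => Z Zl.
    by rewrite (proj_hor_id (lieb_hor_ideal Zl Xp)).
  - exact: linear_map_comp (proj_ideal_linear l) (lL Y).
  - exact: linear_map_comp proj_hor_linear (lL X).
  - by move=> Z _; exact: proj_ideal_mem.
  - by move=> Z Zl; rewrite proj_hor_mem// h_sub// (ideal_h Zl).
rewrite (eq_trace_on (g := fun Z => pr (lieb X (lieb Y Z))
    - \sum_l pr (lieb X (pi l (lieb Y Z))))) => [|Z Zp]; last first.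
  rewrite [pr (lieb Y Z)]/pr (linear_mapB _ _ (lL X)) (linear_mapB _ _ proj_hor_linear).
  by rewrite (linear_map_sum _ _ _ (lL X)) (linear_map_sum _ _ _ proj_hor_linear).
rewrite trace_onD trace_onN trace_on_sum; under eq_bigr do rewrite F.
by rewrite E; ring.
Qed.

(** In the trace over [h] the block of [V l] is the Killing form of [V l] itself, and the other
    ideals contribute nothing since they commute with [V l]. *)
Lemma trace_ideal_ideal l Z W : Z \in V l -> W \in V l ->
  trace_on pp (fun X => lieb Z (lieb W X)) = B Z W - killing (V l) Z W.
Proof.
move=> Zl Wl; have Zh := ideal_h Zl; have Wh := ideal_h Wl.
have fh : maps (fun X => lieb Z (lieb W X)) h h.
  by move=> X Xh; do 2!apply: h_sub => //.
have E1 : trace_on pp (fun X => pr (lieb Z (lieb W X))) =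
    trace_on pp (fun X => lieb Z (lieb W X)).
  apply: eq_trace_on => X Xp.
  by rewrite proj_hor_id// (lieb_ideal_hor Zl)// (lieb_ideal_hor Wl).
have E2 : trace_on (V l) (fun X => pi l (lieb Z (lieb W X))) = killing (V l) Z W.
  by apply: eq_trace_on => X Xl; rewrite proj_ideal_id// !V_sub.
rewrite [B Z W](trace_on_split (lL2 Z W) fh) (bigD1 l)//= big1 => [|m ml].
  by rewrite addr0 E1 E2 addrK.
apply: trace_on0 => X Xm; rewrite eq_sym in ml; rewrite (V_comm ml Wl Xm).
by rewrite (linear_map0 (lL Z)) (linear_map0 (proj_ideal_linear m)).
Qed.

Lemma trace_ideal_other l m Z W : l != m -> Z \in V l -> W \in V m ->
  trace_on pp (fun X => lieb Z (lieb W X)) = 0.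
Proof.
move=> lm Zl Wm; have Zh := ideal_h Zl; have Wh := ideal_h Wm.
have fh : maps (fun X => lieb Z (lieb W X)) h h.
  by move=> X Xh; do 2!apply: h_sub => //.
have := trace_on_split (lL2 Z W) fh; rewrite -/(B Z W) (V_orth lm Zl Wm).
have E1 : trace_on pp (fun X => pr (lieb Z (lieb W X))) =
    trace_on pp (fun X => lieb Z (lieb W X)).
  apply: eq_trace_on => X Xp.
  by rewrite proj_hor_id// (lieb_ideal_hor Zl)// (lieb_ideal_hor Wm).
rewrite E1 big1 ?addr0// => j _; apply: trace_on0 => X Xj.
have [mj|mj] := eqVneq m j; last first.
  by rewrite (V_comm mj Wm Xj) (linear_map0 (lL Z)) (linear_map0 (proj_ideal_linear j)).
rewrite mj in lm Wm; rewrite (V_comm lm Zl) ?V_sub//.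
exact: linear_map0 (proj_ideal_linear j).
Qed.

(** The full trace is B(X, Z) = 0, and on the ideals the composite takes horizontal values, hence
    has no diagonal part. *)
Lemma trace_hor_ideal l X Z : X \in pp -> Z \in V l ->
  trace_on pp (fun Y => pr (lieb X (lieb Z Y))) = 0.
Proof.
move=> Xp Zl; have Xh := horizontal_h Xp; have Zh := ideal_h Zl.
have fh : maps (fun Y => lieb X (lieb Z Y)) h h.
  by move=> Y Yh; do 2!apply: h_sub => //.
have := trace_on_split (lL2 X Z) fh; rewrite -/(B X Z).
have /horizontalP[_ /(_ l Z Zl) ->] := Xp.
rewrite [X in _ + X]big1 ?addr0// => m _; apply: trace_on0 => Y Ym.
apply: proj_ideal_hor.
have [lm|lm] := eqVneq l m; last first.
  by rewrite (V_comm lm Zl Ym) (linear_map0 (lL X)) mem0v.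
by apply: (lieb_hor_ideal (l := m)) => //; apply: V_sub => //; rewrite -lm.
Qed.

Lemma trace_ideal_hor l X Z : X \in pp -> Z \in V l ->
  trace_on pp (fun Y => lieb Z (pr (lieb X Y))) = 0.
Proof.
move=> Xp Zl; have Xh := horizontal_h Xp; have Zh := ideal_h Zl.
rewrite (@trace_onC _ _ pp pp (fun Y => pr (lieb X Y)) (lieb Z)).
- exact: (trace_hor_ideal Xp Zl).
- exact: linear_map_comp proj_hor_linear (lL X).
- exact: lL.
- by move=> Y Yp; rewrite proj_hor_mem// h_sub// (horizontal_h Yp).
- by move=> Y Yp; exact: lieb_ideal_hor Zl Yp.
Qed.

End IsotropySide.

(** * Ideals of the isotropy algebra and their images *)

Section IdealDecomposition.
Variables (R : realType) (n t : nat) (k : {vspace 'M[R]_n}).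
Variable k_ : 'I_t.+1 -> {vspace 'M[R]_n}.
Local Notation mat := 'M[R]_n.
Hypothesis k_sum : k = (\sum_(l < t.+1) k_ l)%VS.
Hypothesis k_dir : directv (\sum_(l < t.+1) k_ l).
Hypothesis k_center : lie_center k (k_ ord0).
Hypothesis k_simple : forall l, l != ord0 ->
  lie_ideal (k_ l) k /\ simple_lie_algebra (k_ l).
Implicit Types X Y Z W : mat.

Lemma ideal_k l X : X \in k_ l -> X \in k.
Proof. by move=> Xl; rewrite k_sum; apply: (subvP (sumv_sup l _ (subvv _))). Qed.

Lemma ideal_sub l : subalgebra (k_ l).
Proof.
move=> X Y Xl Yl; have [l0|l0] := eqVneq l ord0.
  rewrite l0 in Xl Yl *; have [_ XC] := (k_center X).1 Xl.
  by rewrite XC ?mem0v//; exact: (ideal_k Yl).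
by have [[_ kI] _] := k_simple l0; apply: kI => //; exact: (ideal_k Xl).
Qed.

Lemma ideal_cap l m X : l != m -> X \in k_ l -> X \in k_ m -> X = 0.
Proof.
move=> lm Xl Xm; apply/eqP; rewrite -memv0.
have /directv_sumP/(_ l isT) <- := k_dir.
rewrite memv_cap Xl/=; apply: (subvP (sumv_sup m _ (subvv _))) Xm.
by rewrite eq_sym.
Qed.

Lemma ideal_comm l m X Y : l != m -> X \in k_ l -> Y \in k_ m -> lieb X Y = 0.
Proof.
move=> lm Xl Ym; have Xk := ideal_k Xl; have Yk := ideal_k Ym.
have [l0|l0] := eqVneq l ord0.
  by rewrite l0 in Xl; have [_ ->] := (k_center X).1 Xl.
have [m0|m0] := eqVneq m ord0.
  by rewrite m0 in Ym; have [_ YC] := (k_center Y).1 Ym; rewrite liebC YC ?oppr0.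
have [[_ lI] _] := k_simple l0; have [[_ mI] _] := k_simple m0.
by apply: (ideal_cap lm); [rewrite liebC memvN; exact: lI|exact: mI].
Qed.

(** This makes the proportionality with [lam ord0 = 0] hold on the center too. *)
Lemma killing_center X Y : Y \in k_ ord0 -> killing (k_ ord0) X Y = 0.
Proof.
move=> Y0; apply: trace_on0 => Z Z0; have [_ YC] := (k_center Y).1 Y0.
by rewrite YC ?(ideal_k Z0)// /lieb mulmx0 mul0mx subrr.
Qed.

Section Projection.
Variables (h : {vspace mat}) (phi : 'End(mat)).
Hypothesis h_sub : subalgebra h.
Hypothesis phi_h : forall X, X \in k -> phi X \in h.
Hypothesis phi_lieb : forall X Y, X \in k -> Y \in k ->
  phi (lieb X Y) = lieb (phi X) (phi Y).
Local Notation V := (fun l => (phi @: k_ l)%VS).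
Local Notation B := (killing h).

Let Bb := killing_bilinear h.

Let phi_maps X : X \in k -> maps (lieb (phi X)) h h.
Proof. by move=> Xk Y Yh; apply: h_sub => //; exact: phi_h. Qed.

(* The elements of the simple ideal k_ l orthogonal to phi (k_ m) form an ideal
   containing [k_ l, k_ l], by invariance of the Killing form. *)
Lemma simple_image_orth l m X Y : l != ord0 -> l != m ->
  X \in k_ l -> Y \in k_ m -> B (phi X) (phi Y) = 0.
Proof.
move=> l0 lm Xl Ym; have [_ [[A [A' [Al Al' AA]]] kS]] := k_simple l0.
pose F Z W := B (phi Z) (phi W).
have Fl W : linear (fun Z => F Z W : R^o) by move=> a Z Z'; rewrite /F linearP Bb.1.
have Fr W : linear (fun Z => F W Z : R^o) by move=> a Z Z'; rewrite /F linearP Bb.2.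
pose I := orthv F (k_ l) (k_ m).
have IP Z : Z \in I <-> Z \in k_ l /\ forall W, W \in k_ m -> F Z W = 0.
  exact: mem_orthv.
have brI Z Z' : Z \in k_ l -> Z' \in k_ l -> lieb Z Z' \in I.
  move=> Zl Zl'; apply/IP; split=> [|W Wm]; first exact: ideal_sub.
  have Zk := ideal_k Zl; have Zk' := ideal_k Zl'; have Wk := ideal_k Wm.
  rewrite /F phi_lieb// killing_invariant; try exact: phi_maps.
  by rewrite -phi_lieb// (ideal_comm lm Zl' Wm) linear0 (bform0r Bb).
have Iid : lie_ideal I (k_ l).
  split=> [|Z W Zl /IP[Wl _]]; last exact: brI.
  by apply/subvP => Z /IP[].
have [I0|IE] := kS _ Iid; last by move: Xl; rewrite -IE => /IP[_]; exact.
by have := brI _ _ Al Al'; rewrite I0 memv0 (negbTE AA).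
Qed.

Lemma image_orth l m X Y : l != m -> X \in V l -> Y \in V m -> B X Y = 0.
Proof.
move=> lm /memv_imgP[Z Zl ->] /memv_imgP[W Wm ->].
have [l0|l0] := eqVneq l ord0; last exact: (simple_image_orth l0 lm).
have ml : m != l by rewrite eq_sym.
have m0 : m != ord0 by rewrite -l0.
rewrite killingC; [exact: (simple_image_orth m0 ml)| |].
  exact: phi_maps (ideal_k Zl).
exact: phi_maps (ideal_k Wm).
Qed.

(** The kernel is an ideal of a simple algebra, and it is proper because the image is nonzero. *)
Lemma simple_image_inj l : l != ord0 -> V l <> 0%VS -> (k_ l :&: lker phi = 0)%VS.
Proof.
move=> l0 Vl; have [_ [_ kS]] := k_simple l0.
have [//|E] : (k_ l :&: lker phi)%VS = 0%VS \/ (k_ l :&: lker phi)%VS = k_ l.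
  apply: kS; split=> [|X Y Xl]; first exact: capvSl.
  rewrite !memv_cap !memv_ker => /andP[Yl /eqP Y0]; rewrite ideal_sub//=.
  rewrite phi_lieb ?(ideal_k Xl) ?(ideal_k Yl)// Y0.
  by rewrite /lieb mulmx0 mul0mx subrr.
case: Vl; apply/eqP; rewrite -subv0; apply/subvP => _ /memv_imgP[X Xl ->].
by move: Xl; rewrite -E memv_cap memv_ker memv0 => /andP[].
Qed.

Lemma killing_image l X Y : (k_ l :&: lker phi = 0)%VS ->
  X \in k_ l -> Y \in k_ l -> killing (V l) (phi X) (phi Y) = killing (k_ l) X Y.
Proof.
move=> kl Xl Yl; apply: trace_on_conj => //.
- exact: linear_map_lieb2.
- by move=> Z Zl; do 2!apply: ideal_sub => //.
- move=> Z Zl; have Zk := ideal_k Zl; have Yk := ideal_k Yl.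
  by rewrite !phi_lieb ?(ideal_k Xl) ?(ideal_k (ideal_sub Yl Zl)).
Qed.

End Projection.
End IdealDecomposition.

(** * The Killing form of a direct sum *)

Section DirectSum.
Variables (R : realType) (n : nat) (g1 g2 : {vspace 'M[R]_n}).
Local Notation mat := 'M[R]_n.
Hypothesis g1_sub : subalgebra g1.
Hypothesis g2_sub : subalgebra g2.
Hypothesis g12_lieb : forall X Y, X \in g1 -> Y \in g2 -> lieb X Y = 0.
Hypothesis g12_cap : (g1 :&: g2 = 0)%VS.
Implicit Types X Y Z W : mat.
Local Notation G := (g1 + g2)%VS.
Local Notation q1 := (pi1 g1 g2).
Local Notation q2 := (pi2 g1 g2).

Lemma pi1_mem X : q1 X \in g1. Proof. exact: memv_pi. Qed.
Lemma pi2_mem X : q2 X \in g2. Proof. exact: memv_pi. Qed.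

Lemma pi_add X : X \in G -> q1 X + q2 X = X.
Proof. exact: daddv_pi_add. Qed.

Lemma pi1_id X : X \in g1 -> q1 X = X.
Proof. exact: daddv_pi_id. Qed.

Lemma pi2_id X : X \in g2 -> q2 X = X.
Proof. by apply: daddv_pi_id; rewrite capvC. Qed.

Lemma pi1_g2 X : X \in g2 -> q1 X = 0.
Proof.
move=> X2; have := pi_add (subvP (addvSr g1 g2) _ X2); rewrite (pi2_id X2) => E.
by apply: (addIr X); rewrite add0r.
Qed.

Lemma pi2_g1 X : X \in g1 -> q2 X = 0.
Proof.
move=> X1; have := pi_add (subvP (addvSl g1 g2) _ X1); rewrite (pi1_id X1) => E.
by apply: (addrI X); rewrite addr0.
Qed.

Lemma g1_G X : X \in g1 -> X \in G. Proof. exact: (subvP (addvSl g1 g2)). Qed.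
Lemma g2_G X : X \in g2 -> X \in G. Proof. exact: (subvP (addvSr g1 g2)). Qed.

Lemma lieb21 X Y : X \in g2 -> Y \in g1 -> lieb X Y = 0.
Proof. by move=> X2 Y1; rewrite liebC g12_lieb// oppr0. Qed.

Lemma liebDl X Y Z : lieb (X + Y) Z = lieb X Z + lieb Y Z.
Proof. by rewrite -[X in lieb (X + _)]scale1r lieb_linear_l scale1r. Qed.

Lemma liebDr X Y Z : lieb Z (X + Y) = lieb Z X + lieb Z Y.
Proof. by rewrite -[X in lieb _ (X + _)]scale1r lieb_linear_r scale1r. Qed.

Lemma lieb_pi X Y : X \in G -> Y \in G ->
  lieb X Y = lieb (q1 X) (q1 Y) + lieb (q2 X) (q2 Y).
Proof.
move=> XG YG; rewrite -{1}(pi_add XG) -{1}(pi_add YG) liebDl !liebDr.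
by rewrite (g12_lieb (pi1_mem X) (pi2_mem Y)) (lieb21 (pi2_mem X) (pi1_mem Y))
   addr0 add0r.
Qed.

Lemma G_sub : subalgebra G.
Proof.
move=> X Y XG YG; rewrite lieb_pi//; apply: memv_add.
  by apply: g1_sub; exact: pi1_mem.
by apply: g2_sub; exact: pi2_mem.
Qed.

Lemma pi1_lieb X Y : X \in G -> Y \in G -> q1 (lieb X Y) = lieb (q1 X) (q1 Y).
Proof.
move=> XG YG; rewrite lieb_pi// linearD/= (pi1_id (g1_sub (pi1_mem X) (pi1_mem Y))).
by rewrite (pi1_g2 (g2_sub (pi2_mem X) (pi2_mem Y))) addr0.
Qed.

Lemma pi2_lieb X Y : X \in G -> Y \in G -> q2 (lieb X Y) = lieb (q2 X) (q2 Y).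
Proof.
move=> XG YG; rewrite lieb_pi// linearD/= (pi2_id (g2_sub (pi2_mem X) (pi2_mem Y))).
by rewrite (pi2_g1 (g1_sub (pi1_mem X) (pi1_mem Y))) add0r.
Qed.

Lemma linear_map_lfun (f : 'End(mat)) : linear_map f.
Proof. by move=> a X Y; rewrite linearP. Qed.

Lemma killing_sum X Y : X \in G -> Y \in G ->
  killing G X Y = killing g1 (q1 X) (q1 Y) + killing g2 (q2 X) (q2 Y).
Proof.
move=> XG YG; rewrite /killing.
rewrite (trace_on_proj (I := bool) (V := fun s => if s then g1 else g2)
  (pr := fun s : bool => if s then q1 else q2)).
- rewrite big_bool/=; congr (_ + _); apply: eq_trace_on => Z Zg.
    have ZG := g1_G Zg.
    by rewrite !pi1_lieb ?G_sub// (pi1_id Zg).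
  have ZG := g2_G Zg.
  by rewrite !pi2_lieb ?G_sub// (pi2_id Zg).
- by case; exact: linear_map_lfun.
- by case; [exact: addvSl|exact: addvSr].
- by case=> Z _; [exact: pi1_mem|exact: pi2_mem].
- by move=> Z ZG; rewrite big_bool/= pi_add.
- exact: linear_map_lieb2.
- by move=> Z ZG; do 2!apply: G_sub => //.
Qed.

Local Notation gG := (gB g1 g2).

Lemma gB_bilinear : bilinear_form gG.
Proof.
by split=> Z a X Y; rewrite /gB ?(killing_bilinear _).1 ?(killing_bilinear _).2; ring.
Qed.

Lemma gBC X Y : X \in G -> Y \in G -> gG X Y = gG Y X.
Proof.
by move=> XG YG; rewrite /gB killingC// => Z ZG; exact: G_sub.
Qed.

Lemma gB_skew X Y Z : X \in G -> Y \in G -> Z \in G ->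
  gG (lieb X Y) Z = - gG Y (lieb X Z).
Proof.
move=> XG YG ZG; rewrite /gB liebC (bformNl (killing_bilinear _)).
by rewrite killing_invariant// => W WG; exact: G_sub.
Qed.

Lemma gB_g1 X Y : X \in g1 -> Y \in G -> gG X Y = - killing g1 X (q1 Y).
Proof.
move=> X1 YG; rewrite /gB (killing_sum (g1_G X1) YG) (pi1_id X1) (pi2_g1 X1).
by rewrite (bform0l (killing_bilinear _)) addr0.
Qed.

Lemma gB_g2 X Y : X \in g2 -> Y \in G -> gG X Y = - killing g2 X (q2 Y).
Proof.
move=> X2 YG; rewrite /gB (killing_sum (g2_G X2) YG) (pi2_id X2) (pi1_g2 X2).
by rewrite (bform0l (killing_bilinear _)) add0r.
Qed.

End DirectSum.

(** * What alignment says on the ideals of the isotropy algebra *)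

Section AlignedIdeals.
Variables (R : realType) (n t : nat) (g1 g2 k : {vspace 'M[R]_n}).
Variable k_ : 'I_t.+1 -> {vspace 'M[R]_n}.
Variables (c1 c2 : R) (lam : 'I_t.+1 -> R) (U1 U2 : 'I_t.+1 -> seq 'M[R]_n).
Local Notation mat := 'M[R]_n.
Hypothesis g1_sub : subalgebra g1.
Hypothesis g2_sub : subalgebra g2.
Hypothesis g12_lieb : forall X Y, X \in g1 -> Y \in g2 -> lieb X Y = 0.
Hypothesis g12_cap : (g1 :&: g2 = 0)%VS.
Local Notation G := (g1 + g2)%VS.
Hypothesis k_G : (k <= G)%VS.
Hypothesis k_sum : k = (\sum_(l < t.+1) k_ l)%VS.
Hypothesis k_dir : directv (\sum_(l < t.+1) k_ l).
Hypothesis k_center : lie_center k (k_ ord0).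
Hypothesis k_simple : forall l, l != ord0 ->
  lie_ideal (k_ l) k /\ simple_lie_algebra (k_ l).
Hypothesis k_aligned : aligned g1 g2 k_ c1 c2 lam.
Local Notation q1 := (pi1 g1 g2).
Local Notation q2 := (pi2 g1 g2).
Hypothesis U1_on : forall l, orthonormal_basis (fun X Y => - killing g1 X Y)
  (q1 @: k_ l)%VS (U1 l).
Hypothesis U2_on : forall l, orthonormal_basis (fun X Y => - killing g2 X Y)
  (q2 @: k_ l)%VS (U2 l).
Implicit Types X Y Z W : mat.
Local Notation gG := (gB g1 g2).
Local Notation B1 := (killing g1).
Local Notation B2 := (killing g2).
Local Notation BG := (killing G).

Lemma mem_kG X : X \in k -> X \in G. Proof. exact: (subvP k_G). Qed.

Lemma mem_klG l X : X \in k_ l -> X \in G.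
Proof. by move=> Xl; exact: mem_kG (ideal_k k_sum Xl). Qed.

Let q1_lieb X Y : X \in k -> Y \in k -> q1 (lieb X Y) = lieb (q1 X) (q1 Y).
Proof.
by move=> Xk Yk; rewrite (pi1_lieb g1_sub g2_sub g12_lieb g12_cap) ?mem_kG.
Qed.

Let q2_lieb X Y : X \in k -> Y \in k -> q2 (lieb X Y) = lieb (q2 X) (q2 Y).
Proof.
by move=> Xk Yk; rewrite (pi2_lieb g1_sub g2_sub g12_lieb g12_cap) ?mem_kG.
Qed.

Let q1_g1 X : X \in k -> q1 X \in g1. Proof. by move=> _; exact: pi1_mem. Qed.
Let q2_g2 X : X \in k -> q2 X \in g2. Proof. by move=> _; exact: pi2_mem. Qed.

Lemma c_facts : [/\ 0 < c1, 0 < c2, c1 != 0, c2 != 0 & c1 + c2 = c1 * c2].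
Proof.
have [_ [c10 c20 c12] _ _ _] := k_aligned.
have c1n : c1 != 0 by rewrite gt_eqF.
have c2n : c2 != 0 by rewrite gt_eqF.
split=> //; rewrite -[RHS]mulr1 -c12; field.
by apply/andP.
Qed.

(** Expanding in the orthonormal basis makes -B(X, X) a sum of squares of the coordinates. *)
Lemma orthonormal_pos h (U : seq mat) (V : {vspace mat}) X :
  orthonormal_basis (fun X Y => - killing h X Y) V U -> X \in V ->
  0 <= - killing h X X /\ (- killing h X X = 0 -> X = 0).
Proof.
(* The single subspace is treated as a family indexed by a one-element type, to reuse the expansion
   proved for families. *)
move=> Uon XV; have U1on (l : 'I_1) := Uon.
have [_ _ /(_ X XV) XE] := coord_system_ideal (V := fun _ : 'I_1 => V) U1on ord0.
have E : - killing h X X = \sum_(i < size U) (- killing h X U`_i) ^+ 2.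
  rewrite {2}XE (bform_sumr (killing_bilinear h)) -sumrN.
  by apply: eq_bigr => i _; rewrite (bformZr (killing_bilinear h)); ring.
rewrite E; split; first by apply: sumr_ge0 => i _; rewrite sqr_ge0.
move=> /eqP; rewrite psumr_eq0 => [/allP E0|i _]; last by rewrite sqr_ge0.
rewrite XE big1// => i _; have := E0 i (mem_index_enum _); rewrite sqrf_eq0.
by move=> /eqP ->; rewrite scale0r.
Qed.

(** On a simple ideal the projections are injective, so alignment gives B_i = B_{k_l} / (lam_l c_i).
    Adding over i and using 1/c1 + 1/c2 = 1 identifies B_{k_l} / lam_l with B. On the center the
    first two equalities are part of alignment. *)
Lemma killing_k l Z W : Z \in k_ l -> W \in k_ l ->
  [/\ B1 (q1 Z) (q1 W) = c1^-1 * BG Z W, B2 (q2 Z) (q2 W) = c2^-1 * BG Z W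
    & killing (k_ l) Z W = lam l * BG Z W].
Proof.
move=> Zl Wl; have [Vne [c10 c20 c12] lam0 ratio center] := k_aligned.
have [l0|l0] := eqVneq l ord0.
  rewrite l0 in Zl Wl *; have [-> ->] := center Z W Zl Wl; split=> //.
  by rewrite lam0 mul0r (killing_center k_sum k_center).
have [_ _ c1n c2n _] := c_facts.
have [laml r1 r2] := ratio l l0; have [V1n V2n] := Vne l l0.
have i1 := simple_image_inj k_sum k_center k_simple q1_lieb l0 V1n.
have i2 := simple_image_inj k_sum k_center k_simple q2_lieb l0 V2n.
have e1 := killing_image k_sum k_center k_simple q1_lieb i1 Zl Wl.
have e2 := killing_image k_sum k_center k_simple q2_lieb i2 Zl Wl.
have := r1 (q1 Z) (q1 W); have := r2 (q2 Z) (q2 W).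
rewrite e1 e2 => /(_ (memv_img _ Zl) (memv_img _ Wl)) E2.
move=> /(_ (memv_img _ Zl) (memv_img _ Wl)) E1.
have lamn : lam l != 0 by rewrite gt_eqF.
have ZG := mem_klG Zl; have WG := mem_klG Wl.
have b1 : B1 (q1 Z) (q1 W) = c1^-1 * ((lam l)^-1 * killing (k_ l) Z W).
  by rewrite E1; field; rewrite lamn c1n.
have b2 : B2 (q2 Z) (q2 W) = c2^-1 * ((lam l)^-1 * killing (k_ l) Z W).
  by rewrite E2; field; rewrite lamn c2n.
have bG : BG Z W = (lam l)^-1 * killing (k_ l) Z W.
  rewrite (killing_sum g1_sub g2_sub g12_lieb g12_cap ZG WG) b1 b2 -mulrDl.
  by rewrite c12 mul1r.
by rewrite b1 b2 bG; split=> //; field.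
Qed.

Lemma killing_kl l m Z W : l != m -> Z \in k_ l -> W \in k_ m ->
  [/\ B1 (q1 Z) (q1 W) = 0, B2 (q2 Z) (q2 W) = 0 & BG Z W = 0].
Proof.
move=> lm Zl Wm.
have e1 : B1 (q1 Z) (q1 W) = 0.
  apply: (image_orth k_sum k_dir k_center k_simple g1_sub q1_g1 q1_lieb lm);
    exact: memv_img.
have e2 : B2 (q2 Z) (q2 W) = 0.
  apply: (image_orth k_sum k_dir k_center k_simple g2_sub q2_g2 q2_lieb lm);
    exact: memv_img.
split=> //; rewrite (killing_sum g1_sub g2_sub g12_lieb g12_cap) ?e1 ?e2 ?addr0//.
  exact: mem_klG Zl.
exact: mem_klG Wm.
Qed.

Lemma gB_k_pos l Z : Z \in k_ l -> Z != 0 -> 0 < gG Z Z.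
Proof.
move=> Zl Z0; have ZG := mem_klG Zl.
have [p1 z1] := orthonormal_pos (U1_on l) (memv_img q1 Zl).
have [p2 z2] := orthonormal_pos (U2_on l) (memv_img q2 Zl).
have gE : gG Z Z = - B1 (q1 Z) (q1 Z) + - B2 (q2 Z) (q2 Z).
  by rewrite /gB (killing_sum g1_sub g2_sub g12_lieb g12_cap ZG ZG) opprD.
rewrite gE lt_neqAle addr_ge0// andbT eq_sym; apply: contra Z0.
rewrite paddr_eq0// => /andP[/eqP/z1 E1 /eqP/z2 E2].
by rewrite -(pi_add g12_cap ZG) E1 E2 addr0.
Qed.

End AlignedIdeals.

(** * Aligned spaces *)

Section AlignedPieces.
Variables (R : realType) (n t : nat) (g1 g2 k : {vspace 'M[R]_n}).
Variable k_ : 'I_t.+1 -> {vspace 'M[R]_n}.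
Variables (c1 c2 : R) (lam : 'I_t.+1 -> R) (U1 U2 : 'I_t.+1 -> seq 'M[R]_n).
Local Notation mat := 'M[R]_n.
Local Notation G := (g1 + g2)%VS.
Local Notation q1 := (pi1 g1 g2).
Local Notation q2 := (pi2 g1 g2).
Local Notation gG := (gB g1 g2).
Local Notation B1 := (killing g1).
Local Notation B2 := (killing g2).
Local Notation BG := (killing G).
Local Notation p := (pspace g1 g2 k).
Local Notation p1 := (pspace1 g1 g2 k).
Local Notation p2 := (pspace2 g1 g2 k).
Local Notation p3 := (fun l => pspace3 g1 g2 c1 c2 (k_ l)).
Hypothesis g1_sub : subalgebra g1.
Hypothesis g2_sub : subalgebra g2.
Hypothesis g12_lieb : forall X Y, X \in g1 -> Y \in g2 -> lieb X Y = 0.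
Hypothesis g12_cap : (g1 :&: g2 = 0)%VS.
Hypothesis k_sum : k = (\sum_(l < t.+1) k_ l)%VS.
Hypothesis kl_G : forall l Z, Z \in k_ l -> Z \in G.
Hypothesis kl_sub : forall l, subalgebra (k_ l).
Hypothesis kl_comm : forall l m X Y, l != m -> X \in k_ l -> Y \in k_ m ->
  lieb X Y = 0.
Hypothesis c1n : c1 != 0.
Hypothesis c2n : c2 != 0.
Hypothesis c12 : c1 + c2 = c1 * c2.
Hypothesis B1_k : forall l Z W, Z \in k_ l -> W \in k_ l ->
  B1 (q1 Z) (q1 W) = c1^-1 * BG Z W.
Hypothesis B2_k : forall l Z W, Z \in k_ l -> W \in k_ l ->
  B2 (q2 Z) (q2 W) = c2^-1 * BG Z W.
Hypothesis B_k : forall l Z W, Z \in k_ l -> W \in k_ l ->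
  killing (k_ l) Z W = lam l * BG Z W.
Hypothesis B1_kl : forall l m Z W, l != m -> Z \in k_ l -> W \in k_ m ->
  B1 (q1 Z) (q1 W) = 0.
Hypothesis B2_kl : forall l m Z W, l != m -> Z \in k_ l -> W \in k_ m ->
  B2 (q2 Z) (q2 W) = 0.
Hypothesis gB_pos : forall l Z, Z \in k_ l -> Z != 0 -> 0 < gG Z Z.
Hypothesis U1_on : forall l, orthonormal_basis (fun X Y => - B1 X Y)
  (q1 @: k_ l)%VS (U1 l).
Hypothesis U2_on : forall l, orthonormal_basis (fun X Y => - B2 X Y)
  (q2 @: k_ l)%VS (U2 l).
Implicit Types X Y Z W : mat.
Local Notation V1 := (fun l => (q1 @: k_ l)%VS).
Local Notation V2 := (fun l => (q2 @: k_ l)%VS).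

Let Gs := G_sub g1_sub g2_sub g12_lieb g12_cap.
Let gb := gB_bilinear g1 g2.
Let gC := gBC g1_sub g2_sub g12_lieb g12_cap.
Let gskew := gB_skew g1_sub g2_sub g12_lieb g12_cap.
Let BGsum := killing_sum g1_sub g2_sub g12_lieb g12_cap.
Let q1l := pi1_lieb g1_sub g2_sub g12_lieb g12_cap.
Let q2l := pi2_lieb g1_sub g2_sub g12_lieb g12_cap.
Let gg1 := gB_g1 g1_sub g2_sub g12_lieb g12_cap.
Let gg2 := gB_g2 g1_sub g2_sub g12_lieb g12_cap.
Let b1 := killing_bilinear g1.
Let b2 := killing_bilinear g2.

Lemma V1_h l : (V1 l <= g1)%VS.
Proof. by apply/subvP => _ /memv_imgP[X Xl ->]; exact: pi1_mem. Qed.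

Lemma V2_h l : (V2 l <= g2)%VS.
Proof. by apply/subvP => _ /memv_imgP[X Xl ->]; exact: pi2_mem. Qed.

Lemma V1_sub l : subalgebra (V1 l).
Proof.
move=> _ _ /memv_imgP[X Xl ->] /memv_imgP[Y Yl ->].
by rewrite -(q1l (kl_G Xl) (kl_G Yl)) memv_img// kl_sub.
Qed.

Lemma V2_sub l : subalgebra (V2 l).
Proof.
move=> _ _ /memv_imgP[X Xl ->] /memv_imgP[Y Yl ->].
by rewrite -(q2l (kl_G Xl) (kl_G Yl)) memv_img// kl_sub.
Qed.

Lemma V1_comm l m X Y : l != m -> X \in V1 l -> Y \in V1 m -> lieb X Y = 0.
Proof.
move=> lm /memv_imgP[Z Zl ->] /memv_imgP[W Wm ->].
by rewrite -(q1l (kl_G Zl) (kl_G Wm)) (kl_comm lm)// linear0.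
Qed.

Lemma V2_comm l m X Y : l != m -> X \in V2 l -> Y \in V2 m -> lieb X Y = 0.
Proof.
move=> lm /memv_imgP[Z Zl ->] /memv_imgP[W Wm ->].
by rewrite -(q2l (kl_G Zl) (kl_G Wm)) (kl_comm lm)// linear0.
Qed.

Lemma V1_orth l m X Y : l != m -> X \in V1 l -> Y \in V1 m -> B1 X Y = 0.
Proof.
by move=> lm /memv_imgP[Z Zl ->] /memv_imgP[W Wm ->]; exact: B1_kl lm Zl Wm.
Qed.

Lemma V2_orth l m X Y : l != m -> X \in V2 l -> Y \in V2 m -> B2 X Y = 0.
Proof.
by move=> lm /memv_imgP[Z Zl ->] /memv_imgP[W Wm ->]; exact: B2_kl lm Zl Wm.
Qed.

Lemma p1E : p1 = horizontal g1 V1.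
Proof. by rewrite /pspace1 /horizontal k_sum limg_sum. Qed.

Lemma p2E : p2 = horizontal g2 V2.
Proof. by rewrite /pspace2 /horizontal k_sum limg_sum. Qed.

Definition skew_lift Z : mat := q1 Z - (c2 / c1) *: q2 Z.
Local Notation P3 := skew_lift.

Lemma skew_lift_linear : linear_map P3.
Proof.
move=> a X Y; rewrite /P3 !linearP/=; move: (q1 X) (q1 Y) (q2 X) (q2 Y).
by move=> x y z w; apply/matrixP => i j; rewrite !mxE; ring.
Qed.

Lemma p3E l X : X \in p3 l <-> exists2 Z, Z \in k_ l & X = P3 Z.
Proof.
have E Z : P3 Z = (q1 - (c2 / c1) *: q2)%VF Z.
  by rewrite add_lfunE opp_lfunE scale_lfunE.
split=> [/memv_imgP[Z Zl ->]|[Z Zl ->]]; first by exists Z.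
by rewrite E memv_img.
Qed.

Lemma skew_lift_G Z : P3 Z \in G.
Proof.
rewrite memvB// ?memvZ//; first by apply: g1_G; exact: pi1_mem.
by apply: g2_G; exact: pi2_mem.
Qed.

Lemma pi1_skew_lift Z : q1 (P3 Z) = q1 Z.
Proof.
have ql := linear_map_lfun q1; rewrite /P3 (linear_mapB _ _ ql) (linear_mapZ _ _ ql).
rewrite (pi1_id g12_cap (pi1_mem g1 g2 Z)) (pi1_g2 g12_cap (pi2_mem g1 g2 Z)).
by rewrite scaler0 subr0.
Qed.

Lemma pi2_skew_lift Z : q2 (P3 Z) = - (c2 / c1) *: q2 Z.
Proof.
have ql := linear_map_lfun q2; rewrite /P3 (linear_mapB _ _ ql) (linear_mapZ _ _ ql).
rewrite (pi2_id g12_cap (pi2_mem g1 g2 Z)) (pi2_g1 g12_cap (pi1_mem g1 g2 Z)).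
by rewrite sub0r scaleNr.
Qed.

Lemma gB_pi X Y : X \in G -> Y \in G ->
  gG X Y = - B1 (q1 X) (q1 Y) - B2 (q2 X) (q2 Y).
Proof. by move=> XG YG; rewrite /gB (BGsum XG YG) opprD. Qed.

(** The coefficient c2/c1 is chosen for this cancellation: 1/c1 from the first factor against
    (c2/c1)(1/c2) from the second. *)
Lemma gB_skew_lift_k l m Z W : Z \in k_ l -> W \in k_ m -> gG (P3 Z) W = 0.
Proof.
move=> Zl Wm; rewrite gB_pi ?skew_lift_G ?(kl_G Wm)//.
rewrite pi1_skew_lift pi2_skew_lift (bformZl b2).
have [lm|lm] := eqVneq l m; last first.
  by rewrite (B1_kl lm Zl Wm) (B2_kl lm Zl Wm) mulr0 oppr0 addr0.
by rewrite -lm in Wm; rewrite (B1_k Zl Wm) (B2_k Zl Wm); field; rewrite c1n c2n.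
Qed.

(** The factor is 1/c1 + (c2/c1)^2 / c2 = (c1 + c2)/c1^2, which equals c2/c1 because c1 + c2 = c1
    c2. *)
Lemma gB_skew_lift l Z W : Z \in k_ l -> W \in k_ l ->
  gG (P3 Z) (P3 W) = c2 / c1 * gG Z W.
Proof.
move=> Zl Wl; rewrite gB_pi ?skew_lift_G//.
rewrite !pi1_skew_lift !pi2_skew_lift (bformZl b2) (bformZr b2).
rewrite (B1_k Zl Wl) (B2_k Zl Wl) /gB.
transitivity ((c1 + c2) / c1 ^+ 2 * - BG Z W); first by field; rewrite c1n c2n.
by rewrite c12; field.
Qed.

Lemma gB_skew_lift_other l m Z W : l != m -> Z \in k_ l -> W \in k_ m ->
  gG (P3 Z) (P3 W) = 0.
Proof.
move=> lm Zl Wm; rewrite gB_pi ?skew_lift_G//.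
rewrite !pi1_skew_lift !pi2_skew_lift (bformZl b2) (bformZr b2).
by rewrite (B1_kl lm Zl Wm) (B2_kl lm Zl Wm) !mulr0 oppr0 addr0.
Qed.

Let gkl_lin l (a : R) X Y Z : X \in k_ l -> Y \in k_ l -> Z \in k_ l ->
  gG (a *: X + Y) Z = a * gG X Z + gG Y Z.
Proof. by move=> _ _ _; rewrite gb.1. Qed.

Let gkl_sym l X Y : X \in k_ l -> Y \in k_ l -> gG X Y = gG Y X.
Proof. by move=> Xl Yl; rewrite gC// (kl_G Xl, kl_G Yl). Qed.

(** The dual frames built for the Ricci tensor are reused for [gB] on [k_ l], with the zero space as
    complement. *)
Let kl0 l : (k_ l :&: 0 = 0)%VS. Proof. exact: capv0. Qed.

Local Notation z l := (@frame R n (k_ l)).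
Local Notation z' l := (@dual R n 0%VS (k_ l) gG).

Lemma z_mem l a : z l a \in k_ l. Proof. exact: frame_mem. Qed.
Lemma z'_mem l a : z' l a \in k_ l. Proof. exact: dual_mem. Qed.

Lemma gB_expand l X : X \in k_ l -> X = \sum_a gG X (z' l a) *: z l a.
Proof.
move=> Xl; have := dual_expand (kl0 l) (@gkl_lin l) (@gkl_sym l) (@gB_pos l) X.
rewrite (pproj_id (kl0 l) Xl) => E; rewrite [LHS](esym E).
by apply: eq_bigr => a _; rewrite (pform_p gG (kl0 l) Xl (z'_mem a)).
Qed.

Lemma gB_expand' l X : X \in k_ l -> X = \sum_a gG X (z l a) *: z' l a.
Proof.
move=> Xl; have := frame_expand (kl0 l) (@gkl_lin l) (@gkl_sym l) (@gB_pos l) X.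
rewrite (pproj_id (kl0 l) Xl) => E; rewrite [LHS](esym E).
by apply: eq_bigr => a _; rewrite (pform_p gG (kl0 l) Xl (z_mem a)).
Qed.

(** Orthogonal projection onto p_3^l in the lifted frame; c1/c2 undoes the factor by which
    [skew_lift] scales [gB]. *)
Definition proj3 l X : mat := (c1 / c2) *: \sum_a gG X (P3 (z' l a)) *: P3 (z l a).

Lemma proj3_linear l : linear_map (proj3 l).
Proof.
apply: linear_map_scale; apply: linear_map_sums => a.
by apply: linear_map_form; exact: gb.1.
Qed.

Lemma proj3_mem l X : proj3 l X \in p3 l.
Proof.
rewrite memvZ// memv_suml// => a _; rewrite memvZ//; apply/p3E.
by exists (z l a); [exact: z_mem|].
Qed.

Lemma proj3_id l Z : Z \in k_ l -> proj3 l (P3 Z) = P3 Z.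
Proof.
move=> Zl; rewrite /proj3 {2}(gB_expand Zl) (linear_map_sum _ _ _ skew_lift_linear).
rewrite scaler_sumr; apply: eq_bigr => a _.
rewrite (gB_skew_lift Zl (z'_mem a)) (linear_mapZ _ _ skew_lift_linear) scalerA.
by congr (_ *: _); field; rewrite c1n c2n.
Qed.

Lemma proj3_0 l X : (forall Z, Z \in k_ l -> gG X (P3 Z) = 0) -> proj3 l X = 0.
Proof.
by move=> X0; rewrite /proj3 big1 ?scaler0// => a _; rewrite X0 ?z'_mem ?scale0r.
Qed.

Lemma proj3_k l m W : W \in k_ m -> proj3 l W = 0.
Proof.
move=> Wm; apply: proj3_0 => Z Zl.
by rewrite gC ?skew_lift_G ?(kl_G Wm)// (gB_skew_lift_k Zl Wm).
Qed.

Lemma p1P X : X \in p1 <-> X \in g1 /\ forall l Y, Y \in V1 l -> B1 X Y = 0.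
Proof. by rewrite p1E; exact: horizontalP. Qed.

Lemma p2P X : X \in p2 <-> X \in g2 /\ forall l Y, Y \in V2 l -> B2 X Y = 0.
Proof. by rewrite p2E; exact: horizontalP. Qed.

Lemma pP X : X \in p <-> X \in G /\ forall l Y, Y \in k_ l -> gG X Y = 0.
Proof.
have bG := killing_bilinear G.
have Bl Y : linear (fun Z => BG Z Y : R^o) by move=> a Z W; rewrite bG.1.
have Br Y : linear (fun Z => BG Y Z : R^o) by move=> a Z W; rewrite bG.2.
rewrite (mem_orthv _ _ _ Bl Br); split=> -[XG Xk]; split=> //.
  move=> l Y Yl; rewrite /gB Xk ?oppr0// k_sum.
  exact: (subvP (sumv_sup l _ (subvv _))).
rewrite k_sum => Y /memv_sumP[Ys Yk ->]; rewrite (bform_sumr bG) big1// => l _.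
by apply/eqP; rewrite -oppr_eq0; apply/eqP; exact: Xk (Yk l _).
Qed.

(** * The decomposition of the tangent space *)

Local Notation piece_index := (bool + 'I_t.+1)%type.

Definition piece (s : piece_index) : {vspace mat} :=
  match s with inl true => p1 | inl false => p2 | inr l => p3 l end.

Definition piece_proj (s : piece_index) : mat -> mat :=
  match s with
  | inl true => fun X => proj_hor g1 U1 (q1 X)
  | inl false => fun X => proj_hor g2 U2 (q2 X)
  | inr l => proj3 l
  end.

Lemma piece_proj_linear s : linear_map (piece_proj s).
Proof.
case: s => [[]|l] /=; last exact: proj3_linear.
  by apply: linear_map_comp; [exact: proj_hor_linear|exact: linear_map_lfun].
by apply: linear_map_comp; [exact: proj_hor_linear|exact: linear_map_lfun].
Qed.

Lemma piece_proj_mem s X : piece_proj s X \in piece s.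
Proof.
case: s => [[]|l] /=; last exact: proj3_mem.
  rewrite p1E; apply: proj_hor_mem => //; first exact: V1_h.
  - exact: V1_orth.
  - exact: pi1_mem.
rewrite p2E; apply: proj_hor_mem => //; first exact: V2_h.
- exact: V2_orth.
- exact: pi2_mem.
Qed.

Lemma piece_p s : (piece s <= p)%VS.
Proof.
apply/subvP => X; case: s => [[]|l] /=.
- move=> /p1P[X1 XV]; apply/pP; split=> [|l Y Yl]; first exact: g1_G.
  by rewrite gg1 ?(kl_G Yl)// (XV l) ?oppr0// memv_img.
- move=> /p2P[X2 XV]; apply/pP; split=> [|l Y Yl]; first exact: g2_G.
  by rewrite gg2 ?(kl_G Yl)// (XV l) ?oppr0// memv_img.
- move=> /p3E[Z Zl ->]; apply/pP; split=> [|m Y Ym]; first exact: skew_lift_G.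
  exact: gB_skew_lift_k Zl Ym.
Qed.

Lemma piece_proj_k s m W : W \in k_ m -> piece_proj s W = 0.
Proof.
move=> Wm; case: s => [[]|l] /=; last exact: (proj3_k _ Wm).
  by apply: (proj_hor_ideal V1_orth U1_on (l := m)); exact: memv_img.
by apply: (proj_hor_ideal V2_orth U2_on (l := m)); exact: memv_img.
Qed.

Lemma piece_G s X : X \in piece s -> X \in G.
Proof. by move=> /(subvP (piece_p s))/pP[]. Qed.

Lemma piece_p1_g1 X : X \in p1 -> X \in g1. Proof. by case/p1P. Qed.
Lemma piece_p2_g2 X : X \in p2 -> X \in g2. Proof. by case/p2P. Qed.

Lemma gB_piece_orth s r X Y : s != r -> X \in piece s -> Y \in piece r ->
  gG X Y = 0.
Proof.
have o12 U W : U \in p1 -> W \in p2 -> gG U W = 0.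
  move=> /piece_p1_g1 U1' /piece_p2_g2 W2.
  by rewrite (gg1 U1' (g2_G g1 W2)) (pi1_g2 g12_cap W2) (bform0r b1) oppr0.
have o13 l U W : U \in p1 -> W \in p3 l -> gG U W = 0.
  move=> /p1P[Ug UV] /p3E[Z Zl ->].
  by rewrite (gg1 Ug (skew_lift_G Z)) pi1_skew_lift (UV l) ?oppr0// memv_img.
have o23 l U W : U \in p2 -> W \in p3 l -> gG U W = 0.
  move=> /p2P[Ug UV] /p3E[Z Zl ->].
  rewrite (gg2 Ug (skew_lift_G Z)) pi2_skew_lift (bformZr b2) (UV l) ?mulr0 ?oppr0//.
  exact: memv_img.
move=> sr Xs Yr; have XG := piece_G Xs; have YG := piece_G Yr.
case: s r sr Xs Yr => [[]|l] [[]|m] //= sr Xs Yr.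
- exact: o12.
- exact: (o13 m).
- by rewrite gC//; exact: o12.
- exact: (o23 m).
- by rewrite gC//; exact: (o13 l).
- by rewrite gC//; exact: (o23 l).
- have lm : l != m by apply: contra sr => /eqP ->.
  by move: Xs Yr => /p3E[Z Zl ->] /p3E[W Wm ->]; exact: gB_skew_lift_other lm Zl Wm.
Qed.

Lemma piece_proj_id s X : X \in piece s -> piece_proj s X = X.
Proof.
case: s => [[]|l] /= Xs; last by move: Xs => /p3E[Z Zl ->]; exact: proj3_id.
  rewrite (pi1_id g12_cap (piece_p1_g1 Xs)); rewrite p1E in Xs.
  exact: (proj_hor_id U1_on Xs).
rewrite (pi2_id g12_cap (piece_p2_g2 Xs)); rewrite p2E in Xs.
exact: (proj_hor_id U2_on Xs).
Qed.

Lemma proj_hor0 h (U : 'I_t.+1 -> seq mat) : proj_hor h U 0 = 0.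
Proof. exact: (linear_map0 (@proj_hor_linear _ _ _ h U)). Qed.

Lemma piece_proj_other s r X : s != r -> X \in piece r -> piece_proj s X = 0.
Proof.
move=> sr Xr; have XG := piece_G Xr; case: s sr => [[]|l] /= sr; last first.
- apply: proj3_0 => Z Zl; rewrite gC ?skew_lift_G//.
  by apply: (gB_piece_orth sr) => //; apply/p3E; exists Z.
- case: r sr Xr => [[]|m] //= sr.
    by move=> /piece_p1_g1 X1; rewrite (pi2_g1 g12_cap X1) proj_hor0.
  move=> /p3E[Z Zm ->]; rewrite pi2_skew_lift.
  rewrite (linear_mapZ _ _ (@proj_hor_linear _ _ _ _ _)).
  by rewrite (proj_hor_ideal V2_orth U2_on (memv_img _ Zm)) scaler0.
- case: r sr Xr => [[]|m] //= sr.
    by move=> /piece_p2_g2 X2; rewrite (pi1_g2 g12_cap X2) proj_hor0.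
  move=> /p3E[Z Zm ->]; rewrite pi1_skew_lift.
  exact: (proj_hor_ideal V1_orth U1_on (memv_img _ Zm)).
Qed.

(** The components of [X] in the two images of [k_ l] come from elements [Z] and [W] of [k_ l].
    Orthogonality of [X] to [k_ l] ties them by W = -(c2/c1) Z, so that they combine into one
    lift. *)
Lemma piece_sum X : X \in p -> X = \sum_s piece_proj s X.
Proof.
move=> /pP[XG Xk]; rewrite big_sumType/= big_bool/=.
have XE : X = proj_hor g1 U1 (q1 X) + proj_hor g2 U2 (q2 X)
    + \sum_l (proj_ideal g1 U1 l (q1 X) + proj_ideal g2 U2 l (q2 X)).
  rewrite -[LHS](pi_add g12_cap XG) big_split/= addrACA /proj_hor.
  by rewrite !subrK.
rewrite [LHS]XE; congr (_ + _); apply: eq_bigr => l _.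
have /memv_imgP[Z Zl Z1] := proj_ideal_mem U1_on l (q1 X).
have /memv_imgP[W Wl W2] := proj_ideal_mem U2_on l (q2 X).
have ZG := kl_G Zl; have WG := kl_G Wl.
have X1Y Y : Y \in k_ l -> B1 (q1 X) (q1 Y) = B1 (q1 Z) (q1 Y).
  move=> Yl; rewrite -Z1 (B_proj_ideal g1_sub V1_h U1_on)//; first exact: pi1_mem.
  exact: memv_img.
have X2Y Y : Y \in k_ l -> B2 (q2 X) (q2 Y) = B2 (q2 W) (q2 Y).
  move=> Yl; rewrite -W2 (B_proj_ideal g2_sub V2_h U2_on)//; first exact: pi2_mem.
  exact: memv_img.
(* Chosen so that [gB X Y = gB T Y] for [Y] in [k_ l]; then [T] is orthogonal to itself and
   vanishes. *)
pose T := c1^-1 *: Z + c2^-1 *: W.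
have Tl : T \in k_ l by rewrite memvD// memvZ.
have T0 : T = 0.
  apply/eqP; apply: contraT => Tn; have := gB_pos Tl Tn.
  have := Xk l T Tl; rewrite gB_pi ?(kl_G Tl)// X1Y// X2Y//.
  rewrite (B1_k Zl Tl) (B2_k Wl Tl) => E.
  have -> : gG T T = 0 by rewrite {1}/T gb.1 (bformZl gb) /gB -[RHS]E; ring.
  by rewrite ltxx.
have WE : W = - (c2 / c1) *: Z.
  apply: (scalerI (_ : c2^-1 != 0)); first by rewrite invr_eq0.
  apply/eqP; rewrite -subr_eq0 -scalerN -[X in _ == X]T0 /T addrC.
  by rewrite scalerN scalerA mulrN mulrA mulVf// mul1r scaleNr opprK.
have ZE : proj_ideal g1 U1 l (q1 X) + proj_ideal g2 U2 l (q2 X) = P3 Z.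
  rewrite Z1 W2 WE (linear_mapZ _ _ (@linear_map_lfun _ _ q2)) /P3 scaleNr.
  by [].
rewrite ZE -[LHS](proj3_id Zl) /proj3; congr (_ *: _); apply: eq_bigr => a _.
congr (_ *: _); have z'l := z'_mem (l := l) a.
rewrite !gB_pi ?skew_lift_G// !pi1_skew_lift !pi2_skew_lift.
rewrite !(bformZl b2) !(bformZr b2) X1Y// X2Y// WE.
by rewrite (linear_mapZ _ _ (@linear_map_lfun _ _ q2)) (bformZl b2).
Qed.

Lemma p_cap_k : (p :&: k = 0)%VS.
Proof.
apply/eqP; rewrite -subv0; apply/subvP => X; rewrite memv_cap => /andP[/pP[XG Xo]].
rewrite {1}k_sum => /memv_sumP[Xs Xk XE].
rewrite memv0 XE big1// => l _; apply/eqP; apply: contraT => Xl0.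
have := Xo l (Xs l) (Xk l isT); rewrite XE (bform_suml gb) (bigD1 l)//= big1.
  by rewrite addr0 => E; have := gB_pos (Xk l isT) Xl0; rewrite E ltxx.
move=> m ml; have Xm := Xk m isT; have Xl := Xk l isT.
by rewrite gB_pi ?(kl_G Xm) ?(kl_G Xl)// (B1_kl ml Xm Xl) (B2_kl ml Xm Xl) oppr0 addr0.
Qed.

(** Subtracting the [gB]-orthogonal projection onto [k], built from dual frames of the mutually
    orthogonal ideals, leaves an element of [p]. *)
Lemma G_pk X : X \in G -> X \in (p + k)%VS.
Proof.
move=> XG; pose K := \sum_l \sum_a gG X (z' l a) *: z l a.
have Kl l : \sum_a gG X (z' l a) *: z l a \in k_ l.
  by apply: memv_suml => a _; rewrite memvZ// z_mem.
have Kk : K \in k.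
  by rewrite k_sum; apply: memv_sumr => l _; exact: Kl.
rewrite -[X](subrK K); apply: memv_add => //; apply/pP; split.
  rewrite memvB//; apply: memv_suml => l _; exact: kl_G (Kl l).
move=> m Y Ym; rewrite (bformBl gb) /K (bform_suml gb) (bigD1 m)//=.
rewrite [X in _ - (_ + X)]big1 ?addr0 => [|l lm]; last first.
  have Xl := Kl l.
  by rewrite gB_pi ?(kl_G Ym) ?(kl_G Xl)// (B1_kl lm Xl Ym) (B2_kl lm Xl Ym) oppr0 addr0.
apply/eqP; rewrite subr_eq0 (bform_suml gb) {1}(gB_expand' Ym) (bform_sumr gb).
apply/eqP; apply: eq_bigr => a _.
by rewrite (bformZl gb) (bformZr gb) mulrC (gkl_sym Ym (z_mem a)).
Qed.

(** * Brackets between the summands *)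

Lemma lieb_p1_lift l X Z : X \in p1 -> Z \in k_ l ->
  lieb X (P3 Z) = lieb X (q1 Z) /\ lieb X (q1 Z) \in p1.
Proof.
move=> Xp Zl; have X1 := piece_p1_g1 Xp; split.
  rewrite /P3 (linear_mapB _ _ (@linear_map_lieb _ _ X)) (linear_mapZ _ _ (@linear_map_lieb _ _ X)).
  by rewrite (g12_lieb X1 (pi2_mem _ _ _)) scaler0 subr0.
rewrite p1E in Xp *; apply: (lieb_hor_ideal g1_sub V1_h V1_sub V1_comm (l := l) _ Xp).
exact: (memv_img q1 Zl).
Qed.

Lemma lieb_p2_lift l X Z : X \in p2 -> Z \in k_ l ->
  lieb X (P3 Z) = - (c2 / c1) *: lieb X (q2 Z) /\ lieb X (q2 Z) \in p2.
Proof.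
move=> Xp Zl; have X2 := piece_p2_g2 Xp; split.
  rewrite /P3 (linear_mapB _ _ (@linear_map_lieb _ _ X)) (linear_mapZ _ _ (@linear_map_lieb _ _ X)).
  by rewrite (lieb21 g12_lieb X2 (pi1_mem _ _ _)) sub0r scaleNr.
rewrite p2E in Xp *; apply: (lieb_hor_ideal g2_sub V2_h V2_sub V2_comm (l := l) _ Xp).
exact: (memv_img q2 Zl).
Qed.

(** With r = c2/c1, the bracket has components [Z, W]_1 and r^2 [Z, W]_2. The coefficients solve a +
    b = 1 and a - r b = r^2; the part in [p] disappears when c1 = c2. *)
Lemma lieb_lift_lift Z W : Z \in G -> W \in G ->
  lieb (P3 Z) (P3 W) = (c2 / c1) *: lieb Z W + (1 - c2 / c1) *: P3 (lieb Z W).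
Proof.
move=> ZG WG; rewrite (lieb_pi g12_lieb g12_cap (skew_lift_G Z) (skew_lift_G W)).
rewrite !pi1_skew_lift !pi2_skew_lift /P3 (q1l ZG WG) (q2l ZG WG).
rewrite [lieb Z W](lieb_pi g12_lieb g12_cap ZG WG).
have lZ a (A A' : mat) : lieb (a *: A) (a *: A') = (a * a) *: lieb A A'.
  by rewrite /lieb -!scalemxAl -!scalemxAr !scalerA scalerBr.
rewrite lZ; move: (lieb (q1 Z) (q1 W)) (lieb (q2 Z) (q2 W)) => x y.
by apply/matrixP => i j; rewrite !mxE; field.
Qed.

Lemma lieb_k_lift Z W : Z \in G -> W \in G -> lieb Z (P3 W) = P3 (lieb Z W).
Proof.
move=> ZG WG; rewrite (lieb_pi g12_lieb g12_cap ZG (skew_lift_G W)).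
rewrite pi1_skew_lift pi2_skew_lift /P3 (q1l ZG WG) (q2l ZG WG).
by rewrite (linear_mapZ _ _ (@linear_map_lieb _ _ _)) scaleNr.
Qed.

Lemma skew_lift0 : P3 0 = 0. Proof. exact: linear_map0 skew_lift_linear. Qed.

Lemma lieb_k_piece l s Z X : Z \in k_ l -> X \in piece s -> lieb Z X \in piece s.
Proof.
move=> Zl Xs; have ZG := kl_G Zl; have XG := piece_G Xs.
case: s Xs => [[]|m] /= Xs.
- have X1 := piece_p1_g1 Xs; rewrite (lieb_pi g12_lieb g12_cap ZG XG).
  rewrite (pi1_id g12_cap X1) (pi2_g1 g12_cap X1) (linear_map0 (@linear_map_lieb _ _ _)) addr0.
  rewrite p1E in Xs *; apply: (lieb_ideal_hor g1_sub V1_h V1_sub V1_comm (l := l) _ Xs).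
  exact: (memv_img q1 Zl).
- have X2 := piece_p2_g2 Xs; rewrite (lieb_pi g12_lieb g12_cap ZG XG).
  rewrite (pi2_id g12_cap X2) (pi1_g2 g12_cap X2) (linear_map0 (@linear_map_lieb _ _ _)) add0r.
  rewrite p2E in Xs *; apply: (lieb_ideal_hor g2_sub V2_h V2_sub V2_comm (l := l) _ Xs).
  exact: (memv_img q2 Zl).
- move: Xs => /p3E[W Wm ->]; rewrite (lieb_k_lift ZG (kl_G Wm)).
  have [lm|lm] := eqVneq l m; last by rewrite (kl_comm lm Zl Wm) skew_lift0 mem0v.
  by rewrite -lm in Wm *; apply/p3E; exists (lieb Z W) => //; exact: kl_sub.
Qed.

(** * Block traces *)

Definition block_trace r s X Y : R :=
  trace_on (piece r) (fun Z => piece_proj r (lieb Y (piece_proj s (lieb X Z)))).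
Local Notation M := block_trace.

Definition weighted (w : piece_index -> R) X : mat := \sum_s w s *: piece_proj s X.

(* For q = gB o weighted x, the sums sigma and tau of the Ricci formula are
   multiples of Theta x x^-1 and Theta x^-1 x^-1. *)
Definition Theta w v X Y : R :=
  trace_on p (fun Z => weighted v (lieb Y (weighted w (lieb X Z)))).

Lemma weighted_linear w : linear_map (weighted w).
Proof.
by apply: linear_map_sums => s; apply: linear_map_scale; exact: piece_proj_linear.
Qed.

Lemma weighted_lieb_linear w v X Y :
  linear_map (fun Z => weighted v (lieb Y (weighted w (lieb X Z)))).
Proof.
apply: linear_map_comp; first exact: weighted_linear.
apply: linear_map_comp; first exact: linear_map_lieb.
apply: linear_map_comp; first exact: weighted_linear.
exact: linear_map_lieb.
Qed.

Lemma weighted_p w X : weighted w X \in p.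
Proof.
apply: memv_suml => s _; rewrite memvZ//.
exact: (subvP (piece_p s)) _ (piece_proj_mem s X).
Qed.

Lemma piece_proj_weighted w r X :
  piece_proj r (weighted w X) = w r *: piece_proj r X.
Proof.
rewrite /weighted (linear_map_sum _ _ _ (@piece_proj_linear r)) (bigD1 r)//= big1.
  rewrite addr0 (linear_mapZ _ _ (@piece_proj_linear r)).
  by rewrite (piece_proj_id (piece_proj_mem r X)).
move=> s sr; rewrite (linear_mapZ _ _ (@piece_proj_linear r)).
by rewrite (piece_proj_other _ (piece_proj_mem s X)) ?scaler0// eq_sym.
Qed.

Lemma ThetaE w v X Y : Theta w v X Y = \sum_r \sum_s v r * w s * M r s X Y.
Proof.
rewrite /Theta (trace_on_proj (V := piece) (pr := piece_proj)).
- apply: eq_bigr => r _.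
  rewrite (eq_trace_on (g := fun Z => \sum_s (v r * w s) *:
      piece_proj r (lieb Y (piece_proj s (lieb X Z))))) => [|Z Zr].
    by rewrite trace_on_sum; apply: eq_bigr => s _; rewrite trace_onZ.
  rewrite piece_proj_weighted [weighted w _]/weighted.
  rewrite (linear_map_sum _ _ _ (@linear_map_lieb _ _ Y)).
  rewrite (linear_map_sum _ _ _ (@piece_proj_linear r)) scaler_sumr.
  apply: eq_bigr => s _; rewrite (linear_mapZ _ _ (@linear_map_lieb _ _ Y)).
  by rewrite (linear_mapZ _ _ (@piece_proj_linear r)) scalerA.
- exact: piece_proj_linear.
- exact: piece_p.
- by move=> s Z _; exact: piece_proj_mem.
- exact: piece_sum.
- exact: weighted_lieb_linear.
- by move=> Z _; exact: weighted_p.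
Qed.

Let pl_lin s X : linear_map (fun Z => piece_proj s (lieb X Z)).
Proof. exact: linear_map_comp (piece_proj_linear s) (@linear_map_lieb _ _ X). Qed.

Lemma block_traceC r s X Y : M r s X Y = M s r Y X.
Proof.
apply: (trace_onC (f := fun Z => piece_proj s (lieb X Z))
  (g := fun Z => piece_proj r (lieb Y Z))); do ?exact: pl_lin.
- by move=> Z _; exact: piece_proj_mem.
- by move=> Z _; exact: piece_proj_mem.
Qed.

Lemma ThetaC w v X Y : Theta w v X Y = Theta v w Y X.
Proof.
rewrite !ThetaE exchange_big; apply: eq_bigr => s _; apply: eq_bigr => r _.
by rewrite block_traceC [v r * w s]mulrC.
Qed.

Lemma block_trace0 r s X Y :
  (forall Z, Z \in piece r -> piece_proj r (lieb Y (piece_proj s (lieb X Z))) = 0) ->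
  M r s X Y = 0.
Proof. exact: trace_on0. Qed.

Lemma piece_proj0 s : piece_proj s 0 = 0.
Proof. exact: linear_map0 (piece_proj_linear s). Qed.

Let lieb0 X : lieb X 0 = 0.
Proof. exact: linear_map0 (@linear_map_lieb _ _ X). Qed.

Lemma piece_proj_g1 X : X \in g1 -> piece_proj (inl false) X = 0.
Proof. by move=> X1 /=; rewrite (pi2_g1 g12_cap X1) proj_hor0. Qed.

Lemma piece_proj_g2 X : X \in g2 -> piece_proj (inl true) X = 0.
Proof. by move=> X2 /=; rewrite (pi1_g2 g12_cap X2) proj_hor0. Qed.

Lemma lieb_p1_G X Z : X \in p1 -> Z \in G -> lieb X Z \in g1.
Proof.
move=> /piece_p1_g1 X1 ZG; rewrite (lieb_pi g12_lieb g12_cap (g1_G g2 X1) ZG).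
rewrite (pi2_g1 g12_cap X1) (pi1_id g12_cap X1).
rewrite [lieb 0 _]liebC lieb0 oppr0 addr0; apply: g1_sub => //; exact: pi1_mem.
Qed.

Lemma lieb_p2_G X Z : X \in p2 -> Z \in G -> lieb X Z \in g2.
Proof.
move=> /piece_p2_g2 X2 ZG; rewrite (lieb_pi g12_lieb g12_cap (g2_G g1 X2) ZG).
rewrite (pi1_g2 g12_cap X2) (pi2_id g12_cap X2).
rewrite [lieb 0 _]liebC lieb0 oppr0 add0r; apply: g2_sub => //; exact: pi2_mem.
Qed.

Lemma lieb_p1_p2 X Z : X \in p1 -> Z \in p2 -> lieb X Z = 0.
Proof. by move=> /piece_p1_g1 X1 /piece_p2_g2; exact: g12_lieb. Qed.

Lemma lieb_p2_p1 X Z : X \in p2 -> Z \in p1 -> lieb X Z = 0.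
Proof. by move=> X2 Z1; rewrite liebC lieb_p1_p2// oppr0. Qed.

Lemma lieb_p1_p3 l X Z : X \in p1 -> Z \in p3 l -> lieb X Z \in p1.
Proof. by move=> X1 /p3E[W Wl ->]; have [-> ] := lieb_p1_lift X1 Wl. Qed.

Lemma lieb_p2_p3 l X Z : X \in p2 -> Z \in p3 l -> lieb X Z \in p2.
Proof. by move=> X1 /p3E[W Wl ->]; have [-> ?] := lieb_p2_lift X1 Wl; rewrite memvZ. Qed.

Lemma lieb_p3_p1 l X Z : X \in p3 l -> Z \in p1 -> lieb X Z \in p1.
Proof. by move=> Xl Z1; rewrite liebC memvN; exact: lieb_p1_p3 Z1 Xl. Qed.

Lemma lieb_p3_p2 l X Z : X \in p3 l -> Z \in p2 -> lieb X Z \in p2.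
Proof. by move=> Xl Z2; rewrite liebC memvN; exact: lieb_p2_p3 Z2 Xl. Qed.

Lemma lieb_p3_other l m X Z : l != m -> X \in p3 l -> Z \in p3 m -> lieb X Z = 0.
Proof.
move=> lm /p3E[W Wl ->] /p3E[W' Wm ->].
rewrite (lieb_lift_lift (kl_G Wl) (kl_G Wm)) (kl_comm lm Wl Wm) skew_lift0.
by rewrite !scaler0 addr0.
Qed.

Lemma piece_proj_lift_lift s l Z W : Z \in k_ l -> W \in k_ l ->
  piece_proj s (lieb (P3 Z) (P3 W)) =
  if s == inr l then (1 - c2 / c1) *: P3 (lieb Z W) else 0.
Proof.
move=> Zl Wl; have ZWl := kl_sub Zl Wl.
have Pl : P3 (lieb Z W) \in piece (inr l) by apply/p3E; exists (lieb Z W).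
rewrite (lieb_lift_lift (kl_G Zl) (kl_G Wl)) piece_proj_linear.
rewrite (piece_proj_k _ ZWl) scaler0 add0r (linear_mapZ _ _ (@piece_proj_linear s)).
by case: eqVneq => [->|sl]; rewrite ?(piece_proj_id Pl)// (piece_proj_other sl Pl) scaler0.
Qed.

Lemma block_trace_p1_2 r X Y : X \in p1 -> M r (inl false) X Y = 0.
Proof.
move=> X1; apply: block_trace0 => Z /piece_G ZG.
by rewrite (piece_proj_g1 (lieb_p1_G X1 ZG)) lieb0 piece_proj0.
Qed.

Lemma block_trace_p1_33 l m X Y : X \in p1 -> M (inr l) (inr m) X Y = 0.
Proof.
move=> X1; apply: block_trace0 => Z Zl; have Z1 := lieb_p1_p3 X1 Zl.
by rewrite (@piece_proj_other (inr m) (inl true) _ isT Z1) lieb0 piece_proj0.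
Qed.

Lemma block_trace_p2_1 r X Y : X \in p2 -> M r (inl true) X Y = 0.
Proof.
move=> X2; apply: block_trace0 => Z /piece_G ZG.
by rewrite (piece_proj_g2 (lieb_p2_G X2 ZG)) lieb0 piece_proj0.
Qed.

Lemma block_trace_p2_33 l m X Y : X \in p2 -> M (inr l) (inr m) X Y = 0.
Proof.
move=> X2; apply: block_trace0 => Z Zl; have Z2 := lieb_p2_p3 X2 Zl.
by rewrite (@piece_proj_other (inr m) (inl false) _ isT Z2) lieb0 piece_proj0.
Qed.

Local Notation N1 := (casimir_form g1 V1 U1).
Local Notation N2 := (casimir_form g2 V2 U2).

Lemma block_trace_p1_11 X Y : X \in p1 -> Y \in p1 ->
  M (inl true) (inl true) X Y = B1 X Y - 2 * \sum_l N1 l X Y.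
Proof.
move=> X1 Y1; have Xg := piece_p1_g1 X1; have Yg := piece_p1_g1 Y1.
rewrite block_traceC /M.
have X1' : X \in horizontal g1 V1 by rewrite -p1E.
have Y1' : Y \in horizontal g1 V1 by rewrite -p1E.
rewrite -(trace_hor_hor g1_sub V1_h V1_sub V1_comm V1_orth U1_on X1' Y1') -p1E.
apply: eq_trace_on => Z /piece_G ZG /=.
rewrite (pi1_id g12_cap (lieb_p1_G Y1 ZG)) (pi1_id g12_cap)//.
by apply: (lieb_p1_G X1); apply: (@piece_G (inl true)); rewrite /= p1E proj_hor_mem//;
  [exact: V1_h|exact: V1_orth|exact: lieb_p1_G Y1 ZG].
Qed.

Lemma block_trace_p2_22 X Y : X \in p2 -> Y \in p2 ->
  M (inl false) (inl false) X Y = B2 X Y - 2 * \sum_l N2 l X Y.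
Proof.
move=> X1 Y1; have Xg := piece_p2_g2 X1; have Yg := piece_p2_g2 Y1.
rewrite block_traceC /M.
have X1' : X \in horizontal g2 V2 by rewrite -p2E.
have Y1' : Y \in horizontal g2 V2 by rewrite -p2E.
rewrite -(trace_hor_hor g2_sub V2_h V2_sub V2_comm V2_orth U2_on X1' Y1') -p2E.
apply: eq_trace_on => Z /piece_G ZG /=.
rewrite (pi2_id g12_cap (lieb_p2_G Y1 ZG)) (pi2_id g12_cap)//.
by apply: (lieb_p2_G X1); apply: (@piece_G (inl false)); rewrite /= p2E proj_hor_mem//;
  [exact: V2_h|exact: V2_orth|exact: lieb_p2_G Y1 ZG].
Qed.

Lemma coord_system_k l :
  coord_system (k_ l) (fun a => z l a) (fun a X => gG X (z' l a)).
Proof. by split=> [a|a|X]; [exact: z_mem|exact: gb.1|exact: gB_expand]. Qed.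

(** The factor c1 compensates the 1/c1 by which [q1] scales the Killing form. *)
Lemma coord_system_V1 l : coord_system (V1 l) (fun a => q1 (z l a))
  (fun a X => - (c1 * B1 X (q1 (z' l a)))).
Proof.
split=> [a|a x X Y|_ /memv_imgP[Z Zl ->]]; first by rewrite memv_img// z_mem.
  by rewrite b1.1; ring.
rewrite {1}(gB_expand Zl) (linear_map_sum _ _ _ (@linear_map_lfun _ _ q1)).
apply: eq_bigr => a _; rewrite (linear_mapZ _ _ (@linear_map_lfun _ _ q1)).
by congr (_ *: _); rewrite (B1_k Zl (z'_mem a)) mulVKf.
Qed.

Lemma coord_system_V2 l : coord_system (V2 l) (fun a => q2 (z l a))
  (fun a X => - (c2 * B2 X (q2 (z' l a)))).
Proof.
split=> [a|a x X Y|_ /memv_imgP[Z Zl ->]]; first by rewrite memv_img// z_mem.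
  by rewrite b2.1; ring.
rewrite {1}(gB_expand Zl) (linear_map_sum _ _ _ (@linear_map_lfun _ _ q2)).
apply: eq_bigr => a _; rewrite (linear_mapZ _ _ (@linear_map_lfun _ _ q2)).
by congr (_ *: _); rewrite (B2_k Zl (z'_mem a)) mulVKf.
Qed.

Lemma coord_system_p3 l : coord_system (p3 l) (fun a => P3 (z l a))
  (fun a X => c1 / c2 * gG X (P3 (z' l a))).
Proof.
split=> [a|a x X Y|X /p3E[Z Zl ->]].
- by apply/p3E; exists (z l a) => //; exact: z_mem.
- by rewrite gb.1; ring.
- rewrite -{1}(proj3_id Zl) /proj3 scaler_sumr.
  by apply: eq_bigr => a _; rewrite scalerA.
Qed.

Lemma gB_proj3 l X W : W \in k_ l -> gG (proj3 l X) (P3 W) = gG X (P3 W).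
Proof.
move=> Wl; rewrite {2}(gB_expand' Wl) (linear_map_sum _ _ _ skew_lift_linear).
rewrite /proj3 (bformZl gb) (bform_suml gb) (bform_sumr gb) mulr_sumr.
apply: eq_bigr => a _; rewrite (linear_mapZ _ _ skew_lift_linear).
rewrite (bformZl gb) (bformZr gb) (gB_skew_lift (z_mem a) Wl).
by rewrite (gkl_sym Wl (z_mem a)); field; rewrite c1n c2n.
Qed.

(** Both traces use images of the same frame of [k_ l]. The coordinates of the lift carry c1/c2 and
    those of its image in [g1] carry c1, whence the quotient 1/c2. *)
Lemma block_trace_p1_31 l X Y : X \in p1 -> Y \in p1 ->
  M (inr l) (inl true) X Y = c2^-1 * N1 l X Y.
Proof.
move=> X1 Y1; have Xg := piece_p1_g1 X1; have Yg := piece_p1_g1 Y1.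
have fl : linear_map (fun Z => piece_proj (inr l) (lieb Y (piece_proj (inl true) (lieb X Z)))).
  exact: linear_map_comp (pl_lin (inr l) Y) (pl_lin (inl true) X).
rewrite /M (trace_onE (coord_system_p3 l) fl) => [|Z _]; last exact: piece_proj_mem.
rewrite (casimir_formC g1_sub V1_h U1_on)// /N1.
have gl : linear_map (fun Z => proj_ideal g1 U1 l (lieb Y (lieb X Z))).
  exact: linear_map_comp (@proj_ideal_linear _ _ _ g1 U1 l) (@linear_map_lieb2 _ _ Y X).
rewrite (trace_onE (coord_system_V1 l) gl) => [|Z _]; last exact: (proj_ideal_mem U1_on).
rewrite mulr_sumr; apply: eq_bigr => a _.
have zl := z_mem (l := l) a; have z'l := z'_mem (l := l) a.
have [E1 E2] := lieb_p1_lift X1 zl.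
rewrite E1 (@piece_proj_id (inl true) _ E2) /= gB_proj3// -/(z l a).
have YX : lieb Y (lieb X (q1 (z l a))) \in g1.
  by do 2!apply: g1_sub => //; exact: pi1_mem.
rewrite (gg1 YX (skew_lift_G _)) pi1_skew_lift.
rewrite (B_proj_ideal g1_sub V1_h U1_on YX (memv_img q1 z'l)).
by field; rewrite c2n.
Qed.

(** As for p_1, but -c2/c1 now enters twice, through the lift and through its coordinate:
    (c1/c2)(c2/c1)^2 divided by c2 is 1/c1. *)
Lemma block_trace_p2_32 l X Y : X \in p2 -> Y \in p2 ->
  M (inr l) (inl false) X Y = c1^-1 * N2 l X Y.
Proof.
move=> X1 Y1; have Xg := piece_p2_g2 X1; have Yg := piece_p2_g2 Y1.
have fl : linear_map (fun Z => piece_proj (inr l) (lieb Y (piece_proj (inl false) (lieb X Z)))).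
  exact: linear_map_comp (pl_lin (inr l) Y) (pl_lin (inl false) X).
rewrite /M (trace_onE (coord_system_p3 l) fl) => [|Z _]; last exact: piece_proj_mem.
rewrite (casimir_formC g2_sub V2_h U2_on)// /N2.
have gl : linear_map (fun Z => proj_ideal g2 U2 l (lieb Y (lieb X Z))).
  exact: linear_map_comp (@proj_ideal_linear _ _ _ g2 U2 l) (@linear_map_lieb2 _ _ Y X).
rewrite (trace_onE (coord_system_V2 l) gl) => [|Z _]; last exact: (proj_ideal_mem U2_on).
rewrite mulr_sumr; apply: eq_bigr => a _.
have zl := z_mem (l := l) a; have z'l := z'_mem (l := l) a.
have [E1 E2] := lieb_p2_lift X1 zl.
rewrite E1 (linear_mapZ _ _ (@piece_proj_linear (inl false))).
rewrite (@piece_proj_id (inl false) _ E2) (linear_mapZ _ _ (@linear_map_lieb _ _ Y)).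
rewrite /= gB_proj3// (bformZl gb).
have YX : lieb Y (lieb X (q2 (z l a))) \in g2.
  by do 2!apply: g2_sub => //; exact: pi2_mem.
rewrite (gg2 YX (skew_lift_G _)) pi2_skew_lift (bformZr b2).
rewrite (B_proj_ideal g2_sub V2_h U2_on YX (memv_img q2 z'l)).
by field; rewrite c1n c2n.
Qed.

Local Notation s1 := (inl true : piece_index).
Local Notation s2 := (inl false : piece_index).
Local Notation s3 l := (inr l : piece_index).

(** For arguments in p_1 the only surviving blocks are (p_1, p_1) and the two between p_1 and each
    p_3^l. *)
Lemma Theta_p1 w v X Y : X \in p1 -> Y \in p1 ->
  Theta w v X Y = v s1 * w s1 * (B1 X Y - 2 * \sum_l N1 l X Y)
    + \sum_l (v s1 * w (s3 l) + v (s3 l) * w s1) * (c2^-1 * N1 l X Y).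
Proof.
move=> X1 Y1; rewrite ThetaE big_sumType/= big_bool/=.
rewrite [X in _ + X + _]big1 => [|s _]; last first.
  by rewrite block_traceC block_trace_p1_2// mulr0.
rewrite addr0 big_sumType/= big_bool/= block_trace_p1_2// mulr0 addr0.
rewrite block_trace_p1_11// -addrA; congr (_ + _).
rewrite -big_split/=; apply: eq_bigr => l _; rewrite big_sumType/= big_bool/=.
rewrite block_trace_p1_2// mulr0 addr0 big1 => [|m _]; last first.
  by rewrite block_trace_p1_33// mulr0.
rewrite addr0 block_traceC !block_trace_p1_31//.
rewrite (casimir_formC g1_sub V1_h U1_on l (piece_p1_g1 Y1) (piece_p1_g1 X1)).
by ring.
Qed.

Lemma Theta_p2 w v X Y : X \in p2 -> Y \in p2 ->
  Theta w v X Y = v s2 * w s2 * (B2 X Y - 2 * \sum_l N2 l X Y)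
    + \sum_l (v s2 * w (s3 l) + v (s3 l) * w s2) * (c1^-1 * N2 l X Y).
Proof.
move=> X1 Y1; rewrite ThetaE big_sumType/= big_bool/=.
rewrite [X in X + _ + _]big1 => [|s _]; last first.
  by rewrite block_traceC block_trace_p2_1// mulr0.
rewrite add0r big_sumType/= big_bool/= block_trace_p2_1// mulr0 add0r.
rewrite block_trace_p2_22// -addrA; congr (_ + _).
rewrite -big_split/=; apply: eq_bigr => l _; rewrite big_sumType/= big_bool/=.
rewrite block_trace_p2_1// mulr0 add0r big1 => [|m _]; last first.
  by rewrite block_trace_p2_33// mulr0.
rewrite addr0 block_traceC !block_trace_p2_32//.
rewrite (casimir_formC g2_sub V2_h U2_on l (piece_p2_g2 Y1) (piece_p2_g2 X1)).
by ring.
Qed.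

Lemma killing_V1 l Z W : Z \in k_ l -> W \in k_ l ->
  killing (V1 l) (q1 Z) (q1 W) = killing (k_ l) Z W.
Proof.
move=> Zl Wl; have ZG := kl_G Zl; have WG := kl_G Wl.
rewrite /killing (trace_onE (coord_system_V1 l) (@linear_map_lieb2 _ _ _ _)); last first.
  by move=> U UV; apply: V1_sub (memv_img q1 Zl) (V1_sub (memv_img q1 Wl) UV).
rewrite (trace_onE (coord_system_k l) (@linear_map_lieb2 _ _ _ _)); last first.
  by move=> U Ul; do 2!apply: kl_sub => //.
apply: eq_bigr => a _; have zl := z_mem (l := l) a.
have WZl := kl_sub Wl zl.
rewrite -(q1l WG (kl_G zl)) -(q1l ZG (kl_G WZl)).
by rewrite (B1_k (kl_sub Zl WZl) (z'_mem a)) mulVKf.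
Qed.

Lemma killing_V2 l Z W : Z \in k_ l -> W \in k_ l ->
  killing (V2 l) (q2 Z) (q2 W) = killing (k_ l) Z W.
Proof.
move=> Zl Wl; have ZG := kl_G Zl; have WG := kl_G Wl.
rewrite /killing (trace_onE (coord_system_V2 l) (@linear_map_lieb2 _ _ _ _)); last first.
  by move=> U UV; apply: V2_sub (memv_img q2 Zl) (V2_sub (memv_img q2 Wl) UV).
rewrite (trace_onE (coord_system_k l) (@linear_map_lieb2 _ _ _ _)); last first.
  by move=> U Ul; do 2!apply: kl_sub => //.
apply: eq_bigr => a _; have zl := z_mem (l := l) a.
have WZl := kl_sub Wl zl.
rewrite -(q2l WG (kl_G zl)) -(q2l ZG (kl_G WZl)).
by rewrite (B2_k (kl_sub Zl WZl) (z'_mem a)) mulVKf.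
Qed.

Lemma lieb_lift_p1 Z U : Z \in G -> U \in p1 -> lieb (P3 Z) U = lieb (q1 Z) U.
Proof.
move=> ZG /piece_p1_g1 U1'.
rewrite (lieb_pi g12_lieb g12_cap (skew_lift_G Z) (g1_G g2 U1')).
by rewrite pi1_skew_lift (pi1_id g12_cap U1') (pi2_g1 g12_cap U1') lieb0 addr0.
Qed.

Lemma lieb_lift_p2 Z U : Z \in G -> U \in p2 ->
  lieb (P3 Z) U = - (c2 / c1) *: lieb (q2 Z) U.
Proof.
move=> ZG /piece_p2_g2 U2'.
rewrite (lieb_pi g12_lieb g12_cap (skew_lift_G Z) (g2_G g1 U2')).
rewrite pi2_skew_lift (pi2_id g12_cap U2') (pi1_g2 g12_cap U2') lieb0 add0r.
by rewrite liebC (linear_mapZ _ _ (@linear_map_lieb _ _ U)) -scalerN -liebC.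
Qed.

Lemma lieb_V1_p1 l Z U : Z \in k_ l -> U \in p1 -> lieb (q1 Z) U \in p1.
Proof.
move=> Zl Up; rewrite -(lieb_lift_p1 (kl_G Zl) Up).
by apply: (lieb_p3_p1 (l := l)) => //; apply/p3E; exists Z.
Qed.

Lemma lieb_V2_p2 l Z U : Z \in k_ l -> U \in p2 -> lieb (q2 Z) U \in p2.
Proof.
move=> Zl Up; rewrite p2E in Up *.
exact: (lieb_ideal_hor g2_sub V2_h V2_sub V2_comm (memv_img q2 Zl) Up).
Qed.

Lemma block_trace_p3_11 l m Z W : Z \in k_ l -> W \in k_ m ->
  M s1 s1 (P3 Z) (P3 W) = trace_on p1 (fun U => lieb (q1 W) (lieb (q1 Z) U)).
Proof.
move=> Zl Wm; apply: eq_trace_on => U Up.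
rewrite (lieb_lift_p1 (kl_G Zl) Up); have ZU := lieb_V1_p1 Zl Up.
rewrite (@piece_proj_id s1 _ ZU) (lieb_lift_p1 (kl_G Wm) ZU).
by rewrite (@piece_proj_id s1 _ (lieb_V1_p1 Wm ZU)).
Qed.

Lemma block_trace_p3_22 l m Z W : Z \in k_ l -> W \in k_ m ->
  M s2 s2 (P3 Z) (P3 W) =
  (c2 / c1) ^+ 2 * trace_on p2 (fun U => lieb (q2 W) (lieb (q2 Z) U)).
Proof.
move=> Zl Wm; rewrite -trace_onZ; apply: eq_trace_on => U Up.
rewrite (lieb_lift_p2 (kl_G Zl) Up); have ZU := lieb_V2_p2 Zl Up.
rewrite (linear_mapZ _ _ (@piece_proj_linear s2)) (@piece_proj_id s2 _ ZU).
rewrite (linear_mapZ _ _ (@linear_map_lieb _ _ _)) (lieb_lift_p2 (kl_G Wm) ZU).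
rewrite scalerA (linear_mapZ _ _ (@piece_proj_linear s2)).
by rewrite (@piece_proj_id s2 _ (lieb_V2_p2 Wm ZU)) mulrNN expr2.
Qed.

Lemma piece_proj_lieb_p3 l r s X Z : r != s -> X \in p3 l -> Z \in piece r ->
  piece_proj s (lieb X Z) = 0.
Proof.
move=> rs Xl; have sr : s != r by rewrite eq_sym.
case: r rs sr => [[]|m] /= rs sr Zr.
- exact: (@piece_proj_other s s1 _ sr (lieb_p3_p1 Xl Zr)).
- exact: (@piece_proj_other s s2 _ sr (lieb_p3_p2 Xl Zr)).
- have [lm|lm] := eqVneq l m; last by rewrite (lieb_p3_other lm Xl Zr) piece_proj0.
  rewrite -lm in Zr sr; move: Xl Zr => /p3E[W Wl ->] /p3E[W' Wl' ->].
  by rewrite (piece_proj_lift_lift s Wl Wl') (negbTE sr).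
Qed.

Lemma block_trace_p3_off l r s X Y : r != s -> X \in p3 l -> M r s X Y = 0.
Proof.
move=> rs Xl; apply: block_trace0 => Z Zr.
by rewrite (piece_proj_lieb_p3 rs Xl Zr) lieb0 piece_proj0.
Qed.

Lemma block_trace_p3_33 l Z W : Z \in k_ l -> W \in k_ l ->
  M (s3 l) (s3 l) (P3 Z) (P3 W) = (1 - c2 / c1) ^+ 2 * killing (k_ l) W Z.
Proof.
move=> Zl Wl.
have fl : linear_map (fun U => piece_proj (s3 l) (lieb (P3 W) (piece_proj (s3 l) (lieb (P3 Z) U)))).
  exact: linear_map_comp (pl_lin (s3 l) (P3 W)) (pl_lin (s3 l) (P3 Z)).
rewrite /M (trace_onE (coord_system_p3 l) fl) => [|U _]; last exact: piece_proj_mem.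
rewrite /killing (trace_onE (coord_system_k l) (@linear_map_lieb2 _ _ _ _)); last first.
  by move=> U Ul; do 2!apply: kl_sub => //.
rewrite mulr_sumr; apply: eq_bigr => a _; have zl := z_mem (l := l) a.
have Zz := kl_sub Zl zl.
rewrite (piece_proj_lift_lift _ Zl zl) eqxx (linear_mapZ _ _ (@linear_map_lieb _ _ _)).
rewrite (linear_mapZ _ _ (@piece_proj_linear (s3 l))).
rewrite (piece_proj_lift_lift _ Wl Zz) eqxx scalerA (bformZl gb).
rewrite (gB_skew_lift (kl_sub Wl Zz) (z'_mem a)).
by move: (gG _ _) => x; field; rewrite c1n c2n.
Qed.

Lemma block_trace_p3_other l m r X Y : l != m -> X \in p3 l -> Y \in p3 m ->
  M (s3 r) (s3 r) X Y = 0.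
Proof.
move=> lm Xl Ym; apply: block_trace0 => Z Zr.
have [lr|lr] := eqVneq l r; last by rewrite (lieb_p3_other lr Xl Zr) piece_proj0 lieb0 piece_proj0.
have mr : m != r by rewrite -lr eq_sym.
by rewrite (lieb_p3_other mr Ym (@piece_proj_mem (s3 r) _)) piece_proj0.
Qed.

(** Brackets with p_3^l preserve each summand modulo [k], so only diagonal blocks remain. On p_1 and
    p_2 the constants are 1/c_i - lam_l, a Killing form minus that of the ideal; (1 - c2/c1)^2 comes
    from the lifted bracket. *)
Lemma Theta_p3 w v l Z W : Z \in k_ l -> W \in k_ l ->
  Theta w v (P3 Z) (P3 W) =
  (v s1 * w s1 * ((1 - lam l * c1) / c1)
   + v s2 * w s2 * ((c2 / c1) ^+ 2 * ((1 - lam l * c2) / c2))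
   + v (s3 l) * w (s3 l) * ((1 - c2 / c1) ^+ 2 * lam l)) * BG Z W.
Proof.
move=> Zl Wl; have Xl : P3 Z \in p3 l by apply/p3E; exists Z.
have Yl : P3 W \in p3 l by apply/p3E; exists W.
have diag r : \sum_s v r * w s * M r s (P3 Z) (P3 W) = v r * w r * M r r (P3 Z) (P3 W).
  rewrite (bigD1 r)//= big1 ?addr0// => s sr.
  by rewrite (block_trace_p3_off _ _ Xl) ?mulr0// eq_sym.
rewrite ThetaE; under eq_bigr do rewrite diag.
rewrite big_sumType/= big_bool/= (bigD1 l)//= big1 ?addr0 => [|m ml]; last first.
  rewrite [M _ _ _ _](_ : _ = 0) ?mulr0//; apply: block_trace0 => U Um.
  by rewrite eq_sym in ml; rewrite (lieb_p3_other ml Xl Um) piece_proj0 lieb0 piece_proj0.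
have GC : BG W Z = BG Z W by have := gC (kl_G Wl) (kl_G Zl); rewrite /gB => /oppr_inj.
rewrite (block_trace_p3_11 Zl Wl) (block_trace_p3_22 Zl Wl) (block_trace_p3_33 Zl Wl).
rewrite p1E p2E.
rewrite (trace_ideal_ideal g1_sub V1_h V1_sub V1_comm V1_orth U1_on (memv_img q1 Wl) (memv_img q1 Zl)).
rewrite (trace_ideal_ideal g2_sub V2_h V2_sub V2_comm V2_orth U2_on (memv_img q2 Wl) (memv_img q2 Zl)).
rewrite (killing_V1 Wl Zl) (killing_V2 Wl Zl) (B_k Wl Zl) (B1_k Wl Zl) (B2_k Wl Zl) GC.
by field; rewrite c1n c2n.
Qed.

Lemma Theta0 w v X Y : (forall r s, M r s X Y = 0) -> Theta w v X Y = 0.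
Proof.
by move=> M0; rewrite ThetaE big1// => r _; rewrite big1// => s _; rewrite M0 mulr0.
Qed.

Lemma Theta_p1_p2 w v X Y : X \in p1 -> Y \in p2 -> Theta w v X Y = 0.
Proof.
move=> X1 Y2; apply: Theta0 => r s; case: s => [[]|m]; last first.
- case: r => [[]|l]; last exact: block_trace_p1_33; apply: block_trace0 => Z Zr.
    have Ym := lieb_p2_p3 Y2 (@piece_proj_mem (s3 m) (lieb X Z)).
    exact: (@piece_proj_other s1 s2 _ isT Ym).
  by rewrite (lieb_p1_p2 X1 Zr) piece_proj0 lieb0 piece_proj0.
- exact: block_trace_p1_2.
- apply: block_trace0 => Z Zr.
  by rewrite (lieb_p2_p1 Y2 (@piece_proj_mem s1 _)) piece_proj0.
Qed.

Lemma Theta_p1_p3 w v l X Y : X \in p1 -> Y \in p3 l -> Theta w v X Y = 0.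
Proof.
move=> X1 Yl; apply: Theta0 => r s; case: s => [[]|m]; last first.
- case: r => [[]|j]; last exact: block_trace_p1_33; apply: block_trace0 => Z Zr.
    exact: (@piece_proj_lieb_p3 l (s3 m) s1 _ _ isT Yl (@piece_proj_mem (s3 m) _)).
  by rewrite (lieb_p1_p2 X1 Zr) piece_proj0 lieb0 piece_proj0.
- exact: block_trace_p1_2.
- case: r => [[]|j]; last first.
  + apply: block_trace0 => Z Zr.
    exact: (@piece_proj_lieb_p3 l s1 (s3 j) _ _ isT Yl (@piece_proj_mem s1 _)).
  + by apply: block_trace0 => Z Zr; rewrite (lieb_p1_p2 X1 Zr) piece_proj0 lieb0 piece_proj0.
  (* The only block that does not vanish by the bracket relations alone: it is a mixed trace on the
     horizontal space of [g1]. *)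
  + move: Yl => /p3E[W Wl ->].
    have X1' : X \in horizontal g1 V1 by rewrite -p1E.
    rewrite -(trace_ideal_hor g1_sub V1_h V1_sub V1_comm V1_orth U1_on X1' (memv_img q1 Wl)).
    rewrite -p1E; apply: eq_trace_on => Z /piece_G ZG.
    have ZU := @piece_proj_mem s1 (lieb X Z).
    rewrite (lieb_lift_p1 (kl_G Wl) ZU) (@piece_proj_id s1 _ (lieb_V1_p1 Wl ZU)) /=.
    by rewrite (pi1_id g12_cap (lieb_p1_G X1 ZG)).
Qed.

Lemma Theta_p2_p3 w v l X Y : X \in p2 -> Y \in p3 l -> Theta w v X Y = 0.
Proof.
move=> X1 Yl; apply: Theta0 => r s; case: s => [[]|m]; last first.
- case: r => [[]|j]; last exact: block_trace_p2_33; apply: block_trace0 => Z Zr.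
    by rewrite (lieb_p2_p1 X1 Zr) piece_proj0 lieb0 piece_proj0.
  exact: (@piece_proj_lieb_p3 l (s3 m) s2 _ _ isT Yl (@piece_proj_mem (s3 m) _)).
- case: r => [[]|j]; last first.
  + apply: block_trace0 => Z Zr.
    exact: (@piece_proj_lieb_p3 l s2 (s3 j) _ _ isT Yl (@piece_proj_mem s2 _)).
  + move: Yl => /p3E[W Wl ->].
    have X1' : X \in horizontal g2 V2 by rewrite -p2E.
    rewrite -[RHS](mulr0 (- (c2 / c1))).
    rewrite -(trace_ideal_hor g2_sub V2_h V2_sub V2_comm V2_orth U2_on X1' (memv_img q2 Wl)).
    rewrite -p2E -trace_onZ; apply: eq_trace_on => Z /piece_G ZG.
    have ZU := @piece_proj_mem s2 (lieb X Z).
    rewrite (lieb_lift_p2 (kl_G Wl) ZU) (linear_mapZ _ _ (@piece_proj_linear s2)).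
    rewrite (@piece_proj_id s2 _ (lieb_V2_p2 Wl ZU)) /=.
    by rewrite (pi2_id g12_cap (lieb_p2_G X1 ZG)).
  + by apply: block_trace0 => Z Zr; rewrite (lieb_p2_p1 X1 Zr) piece_proj0 lieb0 piece_proj0.
- exact: block_trace_p2_1.
Qed.

Lemma Theta_p3_p3 w v l m X Y : l != m -> X \in p3 l -> Y \in p3 m ->
  Theta w v X Y = 0.
Proof.
move=> lm Xl Ym; apply: Theta0 => r s.
have [<-|rs] := eqVneq r s; last exact: (block_trace_p3_off _ rs Xl).
case: r => [[]|r]; last exact: (block_trace_p3_other _ lm Xl Ym).
  move: Xl Ym => /p3E[Z Zl ->] /p3E[W Wm ->].
  rewrite (block_trace_p3_11 Zl Wm) p1E; rewrite eq_sym in lm.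
  exact: (trace_ideal_other g1_sub V1_h V1_sub V1_comm V1_orth U1_on lm
    (memv_img q1 Wm) (memv_img q1 Zl)).
move: Xl Ym => /p3E[Z Zl ->] /p3E[W Wm ->].
rewrite (block_trace_p3_22 Zl Wm) p2E; rewrite eq_sym in lm.
by rewrite (trace_ideal_other g2_sub V2_h V2_sub V2_comm V2_orth U2_on lm
  (memv_img q2 Wm) (memv_img q2 Zl)) mulr0.
Qed.

(** * The metric and its weights *)

Variable q : mat -> mat -> R.
Variable x : piece_index -> R.
Hypothesis q_lin : forall (a : R) X Y Z, X \in p -> Y \in p -> Z \in p ->
  q (a *: X + Y) Z = a * q X Z + q Y Z.
Hypothesis q_sym : forall X Y, X \in p -> Y \in p -> q X Y = q Y X.
Hypothesis q_pos : forall X, X \in p -> X != 0 -> 0 < q X X.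
Hypothesis q_piece : forall s X Y, X \in piece s -> Y \in piece s ->
  q X Y = x s * gG X Y.
Hypothesis q_orth : forall s r X Y, s != r -> X \in piece s -> Y \in piece r ->
  q X Y = 0.
Hypothesis x_neq0 : forall s, x s != 0.
Local Notation P := (pproj k p).
Local Notation b := (pform k p q).
Local Notation e := (@frame R n p).
Local Notation e' := (@dual R n k p q).
Local Notation xi := (fun s => (x s)^-1).

Let bb := pform_bilinear k q_lin q_sym.
Let bC := pformC k q_sym.
Let bp X Y : X \in p -> Y \in p -> b X Y = q X Y.
Proof. exact: pform_p p_cap_k _ _. Qed.
Let piece_in s X : X \in piece s -> X \in p.
Proof. exact: (subvP (piece_p s)). Qed.
Let pr_in s X : piece_proj s X \in p.
Proof. exact: piece_in (piece_proj_mem s X). Qed.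
Let p_G X : X \in p -> X \in G. Proof. by case/pP. Qed.
Let P_in X : P X \in p. Proof. exact: memv_pi. Qed.

Lemma k_G X : X \in k -> X \in G.
Proof.
by rewrite k_sum => /memv_sumP[Xs Xk ->]; apply: memv_suml => l _; exact: kl_G (Xk l _).
Qed.

Lemma sub_pproj_k X : X \in G -> X - P X \in k.
Proof. by move=> XG; apply: (sub_pproj_mem p_cap_k); exact: G_pk. Qed.

Lemma gB_kp X Y : X \in k -> Y \in p -> gG X Y = 0.
Proof.
rewrite {1}k_sum => /memv_sumP[Xs Xk ->] /pP[YG Yo].
rewrite (bform_suml gb) big1// => l _.
by rewrite gC ?(kl_G (Xk l _))// (Yo l _ (Xk l isT)).
Qed.

Lemma gB_pproj X Y : X \in G -> Y \in p -> gG (P X) Y = gG X Y.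
Proof.
move=> XG Yp; apply/eqP; rewrite eq_sym -subr_eq0 -(bformBl gb).
by rewrite (gB_kp (sub_pproj_k XG) Yp).
Qed.

Lemma weighted_pproj w X : X \in G -> weighted w (P X) = weighted w X.
Proof.
move=> XG; apply/eqP; rewrite eq_sym -subr_eq0.
rewrite -(linear_mapB _ _ (weighted_linear w)).
move: (X - P X) (sub_pproj_k XG) => K; rewrite k_sum => /memv_sumP[Xs Xk ->].
rewrite (linear_map_sum _ _ _ (weighted_linear w)) big1// => l _.
by rewrite /weighted big1// => s _; rewrite (piece_proj_k s (Xk l isT)) scaler0.
Qed.

Lemma gB_weighted w X Y : X \in p -> Y \in p ->
  gG (weighted w X) Y = \sum_s w s * gG (piece_proj s X) (piece_proj s Y).
Proof.
move=> Xp Yp; rewrite /weighted (bform_suml gb); apply: eq_bigr => s _.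
rewrite (bformZl gb) {1}(piece_sum Yp) (bform_sumr gb) (bigD1 s)//= big1 ?addr0//.
move=> r rs; rewrite eq_sym in rs.
exact: gB_piece_orth rs (piece_proj_mem s X) (piece_proj_mem r Y).
Qed.

Lemma q_weighted X Y : X \in p -> Y \in p -> q X Y = gG (weighted x X) Y.
Proof.
move=> Xp Yp; rewrite gB_weighted// -bp// {1}(piece_sum Xp) (bform_suml bb).
apply: eq_bigr => s _; rewrite {1}(piece_sum Yp) (bform_sumr bb) (bigD1 s)//= big1.
  by rewrite addr0 bp// (q_piece (piece_proj_mem s X) (piece_proj_mem s Y)).
move=> r rs; rewrite eq_sym in rs.
by rewrite bp// (q_orth rs (piece_proj_mem s X) (piece_proj_mem r Y)).
Qed.

Lemma weightedK X : X \in p -> weighted x (weighted xi X) = X.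
Proof.
move=> Xp; rewrite [RHS](piece_sum Xp) [weighted x _]/weighted.
by apply: eq_bigr => s _; rewrite piece_proj_weighted scalerA divff// scale1r.
Qed.

(** With [form_gB], this translates between [gB], for which every ad is skew, and [q], in which the
    Ricci formula is stated. *)
Lemma gB_form X Y : X \in G -> Y \in p -> gG X Y = b (weighted xi X) Y.
Proof.
move=> XG Yp; rewrite bp ?weighted_p// q_weighted ?weighted_p//.
by rewrite -(weighted_pproj xi XG) weightedK// gB_pproj.
Qed.

Lemma form_gB X Y : X \in G -> Y \in G -> b X Y = gG (weighted x X) Y.
Proof.
move=> XG YG; have wp := weighted_p x X.
rewrite [LHS]q_weighted// (weighted_pproj x XG) gC ?p_G//.
by rewrite (gB_pproj YG wp) gC// p_G.
Qed.

Lemma form_trace f : linear_map f ->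
  \sum_a b (f (e a)) (e' a) = trace_on p (fun X => P (f X)).
Proof.
move=> fl; apply: eq_bigr => a _.
by rewrite (coord_frame p_cap_k q_lin q_sym q_pos _ (P_in _)) (pform_projl q p_cap_k).
Qed.

Lemma lieb_kp_piece s Z X : Z \in k -> X \in piece s -> lieb Z X \in piece s.
Proof.
rewrite {1}k_sum => /memv_sumP[Zs Zk ->] Xs; rewrite liebC memvN.
rewrite (linear_map_sum _ _ _ (@linear_map_lieb _ _ X)); apply: memv_suml => l _.
by rewrite liebC memvN; exact: lieb_k_piece (Zk l isT) Xs.
Qed.

Lemma lieb_kp Z X : Z \in k -> X \in p -> lieb Z X \in p.
Proof.
move=> Zk Xp; rewrite (piece_sum Xp) (linear_map_sum _ _ _ (@linear_map_lieb _ _ Z)).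
by apply: memv_suml => s _; apply: piece_in; exact: lieb_kp_piece (piece_proj_mem s X).
Qed.

Lemma piece_proj_lieb_k s Z X : Z \in k -> X \in p ->
  piece_proj s (lieb Z X) = lieb Z (piece_proj s X).
Proof.
move=> Zk Xp; rewrite {1}(piece_sum Xp) (linear_map_sum _ _ _ (@linear_map_lieb _ _ Z)).
rewrite (linear_map_sum _ _ _ (piece_proj_linear s)) (bigD1 s)//= big1 ?addr0.
  exact: piece_proj_id (lieb_kp_piece Zk (piece_proj_mem s X)).
move=> r rs; rewrite eq_sym in rs.
exact: piece_proj_other rs (lieb_kp_piece Zk (piece_proj_mem r X)).
Qed.

(** For [Z] in [k], ad(Z) preserves each summand, so it commutes with the weights and inherits
    skewness from [gB]. *)
Lemma q_skew_k Z X Y : Z \in k -> X \in p -> Y \in p ->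
  q (lieb Z X) Y + q X (lieb Z Y) = 0.
Proof.
move=> Zk Xp Yp; have ZX := lieb_kp Zk Xp; have ZY := lieb_kp Zk Yp.
rewrite !q_weighted// !gB_weighted// -big_split/= big1// => s _.
rewrite !piece_proj_lieb_k// (gskew (k_G Zk) (p_G (pr_in s X)) (p_G (pr_in s Y))).
by rewrite mulrN addNr.
Qed.

Lemma lieb_pp X Y : X \in p -> Y \in p -> lieb X Y \in (p + k)%VS.
Proof. by move=> Xp Yp; apply: G_pk; apply: Gs; exact: p_G. Qed.

Let e_in a : e a \in p. Proof. exact: frame_mem. Qed.
Let e'_in a : e' a \in p. Proof. exact: dual_mem. Qed.

Let P_lin : linear_map P. Proof. by move=> c X Y; exact: pproj_linear. Qed.

(** The [q]-adjoint of the projected ad(W) is minus its conjugate by [weighted x]. A trace is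
    invariant under adjoint and conjugation, so it equals its negative. *)
Lemma trace_lieb_p W : W \in p -> \sum_a b (lieb W (e a)) (e' a) = 0.
Proof.
move=> Wp; have WG := p_G Wp.
have adl := @linear_map_lieb _ _ W.
have wl := weighted_linear x; have wil := weighted_linear xi.
pose F X Y := b X (weighted xi (lieb W (weighted x Y))).
have Fb : bilinear_form F.
  split=> Z c X Y; rewrite /F ?bb.1//.
  by rewrite wl adl wil bb.2.
have step a : b (lieb W (e a)) (e' a) = - F (e a) (e' a).
  have We := Gs WG (p_G (e_in a)).
  have We' := Gs WG (p_G (weighted_p x (e' a))).
  rewrite [LHS]bC /F (form_gB (p_G (e'_in a)) We).
  rewrite (gC (p_G (weighted_p x (e' a))) We).
  rewrite (gskew WG (p_G (e_in a)) (p_G (weighted_p x (e' a)))); congr (- _).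
  by rewrite (gC (p_G (e_in a)) We') (gB_form We' (e_in a)) bC.
have E : \sum_a b (lieb W (e a)) (e' a) = - \sum_a b (lieb W (e a)) (e' a).
  rewrite {1}(eq_bigr _ (fun a _ => step a)) sumrN; congr (- _).
  rewrite (dual_swap k q_sym Fb) /F.
  under eq_bigr do rewrite bC.
  rewrite (form_trace (f := fun X => weighted xi (lieb W (weighted x X)))); last first.
    exact: linear_map_comp wil (linear_map_comp adl wl).
  rewrite (form_trace adl).
  transitivity (trace_on p (fun X => weighted xi (lieb W (weighted x X)))).
    by apply: eq_trace_on => X Xp; rewrite (pproj_id p_cap_k (weighted_p _ _)).
  rewrite (@trace_onC _ _ p p (weighted x) (fun X => weighted xi (lieb W X))) => //.
  - apply: eq_trace_on => X Xp.
    have WXG := Gs WG (p_G Xp).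
    by rewrite -(weighted_pproj xi WXG) weightedK.
  - exact: linear_map_comp wil adl.
  - by move=> X _; exact: weighted_p.
  - by move=> X _; exact: weighted_p.
by move/eqP: E; rewrite -addr_eq0 -mulr2n mulrn_eq0 => /eqP.
Qed.

(** The block of the trace over [k] is carried to [p] by cyclicity, since ad(Y) maps [k] into
    [p]. *)
Lemma killing_trace_pk X Y : X \in p -> Y \in p -> BG X Y =
  \sum_a b (lieb X (lieb Y (e a))) (e' a)
  + \sum_a b (lieb Y (lieb X (e a) - P (lieb X (e a)))) (e' a).
Proof.
move=> Xp Yp; have XG := p_G Xp; have YG := p_G Yp.
have adX := @linear_map_lieb _ _ X; have adY := @linear_map_lieb _ _ Y.
have Ql f : linear_map f -> linear_map (fun Z => f Z - P (f Z)).
  move=> fl; apply: linear_map_add => //; apply: linear_map_opp.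
  exact: linear_map_comp P_lin fl.
rewrite (form_trace (f := fun Z => lieb X (lieb Y Z))); last exact: linear_map_lieb2.
rewrite (form_trace (f := fun Z => lieb Y (lieb X Z - P (lieb X Z)))); last first.
  exact: linear_map_comp adY (Ql _ adX).
rewrite /killing (trace_on_proj (I := bool) (V := fun s => if s then p else k)
  (pr := fun s Z => if s then P Z else Z - P Z)).
- rewrite big_bool/=; congr (_ + _).
  rewrite (@trace_onC _ _ k p (lieb Y) (fun Z => lieb X Z - P (lieb X Z))).
  + apply: eq_trace_on => Z Zp.
    have Kk := sub_pproj_k (Gs XG (p_G Zp)).
    have YK : lieb Y (lieb X Z - P (lieb X Z)) \in p.
      by rewrite liebC memvN; exact: lieb_kp.
    by rewrite (pproj_id p_cap_k YK).
  + exact: adY.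
  + exact: Ql.
  + by move=> Z Zk; rewrite liebC memvN; exact: lieb_kp.
  + by move=> Z Zp; apply: sub_pproj_k; apply: Gs => //; exact: p_G.
- by case=> //; exact: Ql.
- by case; apply/subvP => Z; [exact: p_G|exact: k_G].
- by case=> Z ZG; [exact: P_in|exact: sub_pproj_k].
- by move=> Z _; rewrite big_bool/= addrC subrK.
- exact: linear_map_lieb2.
- by move=> Z ZG; do 2!apply: Gs => //.
Qed.

Lemma sigma_Theta X Y : X \in p -> Y \in p ->
  sigma k p q X Y = - Theta x xi X Y.
Proof.
move=> Xp Yp; have XG := p_G Xp; have YG := p_G Yp.
pose f Z := weighted xi (lieb Y (weighted x (lieb X Z))).
have fl : linear_map f by exact: weighted_lieb_linear.
transitivity (- \sum_a b (f (e a)) (e' a)).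
  rewrite -sumrN; apply: eq_bigr => a _.
  have eG := p_G (e_in a); have e'G := p_G (e'_in a).
  have wG := p_G (weighted_p x (lieb X (e a))).
  rewrite (form_gB (Gs XG eG) (Gs YG e'G)) -(gB_form (Gs YG wG) (e'_in a)).
  by rewrite (gskew YG wG e'G) opprK.
rewrite (form_trace fl); congr (- _).
by apply: eq_trace_on => Z _; rewrite (pproj_id p_cap_k (weighted_p _ _)).
Qed.

Lemma weighted_piece w s X : X \in piece s -> weighted w X = w s *: X.
Proof.
move=> Xs; rewrite /weighted (bigD1 s)//= (piece_proj_id Xs) big1 ?addr0// => r rs.
by rewrite (piece_proj_other rs Xs) scaler0.
Qed.

(** Each bracket paired with a vector of a summand becomes ad of that vector, at the cost of its
    weight and of one inverse weight operator. Duality then eliminates the inner sum. *)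
Lemma tau_Theta s r X Y : X \in piece s -> Y \in piece r ->
  tau k p q X Y = - (x s * x r * Theta xi xi X Y).
Proof.
move=> Xs Yr; have Xp := piece_in Xs; have Yp := piece_in Yr.
have XG := p_G Xp; have YG := p_G Yp.
pose f Z := weighted xi (lieb Y (weighted xi (lieb X Z))).
have fl : linear_map f by exact: weighted_lieb_linear.
have br l V A C : V \in piece l -> A \in p -> C \in p ->
    b (lieb A C) V = x l * b (weighted xi (lieb V A)) C.
  move=> Vl Ap Cp; have VG := piece_G Vl; have AG := p_G Ap; have CG := p_G Cp.
  rewrite bC (form_gB VG (Gs AG CG)) (weighted_piece x Vl) (bformZl gb).
  congr (_ * _); rewrite -(gB_form (Gs VG AG) Cp) [lieb V A]liebC (bformNl gb).
  by rewrite (gskew AG VG CG) opprK.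
rewrite /tau -mulrN.
transitivity (x s * x r * - \sum_a b (f (e a)) (e' a)); last first.
  rewrite (form_trace fl); congr (_ * - _).
  by apply: eq_trace_on => Z _; rewrite (pproj_id p_cap_k (weighted_p _ _)).
rewrite -sumrN mulr_sumr; apply: eq_bigr => a _.
have eG := p_G (e_in a); have e'G := p_G (e'_in a).
transitivity (x s * x r * \sum_c (b (weighted xi (lieb X (e a))) (e c)
    * b (weighted xi (lieb Y (e' a))) (e' c))).
  rewrite mulr_sumr; apply: eq_bigr => c _.
  by rewrite (br s X _ _ Xs (e_in a) (e_in c)) (br r Y _ _ Yr (e'_in a) (e'_in c)); ring.
congr (_ * _); under eq_bigr do rewrite mulrC.
rewrite (sum_pform_dual p_cap_k q_lin q_sym q_pos) bC.
have wp := weighted_p xi (lieb X (e a)).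
rewrite /f -(gB_form (Gs YG (p_G wp)) (e'_in a)) (gskew YG (p_G wp) e'G) opprK.
by rewrite bC -(gB_form (Gs YG e'G) wp) (gC (Gs YG e'G) (p_G wp)).
Qed.

Lemma ricci_Theta s r X Y : X \in piece s -> Y \in piece r ->
  ricci k p q X Y = 2^-1 * gG X Y + 2^-1 * Theta x xi X Y
    - 4^-1 * (x s * x r * Theta xi xi X Y).
Proof.
move=> Xs Yr; have Xp := piece_in Xs; have Yp := piece_in Yr.
have BC U W : U \in p -> W \in p -> BG U W = BG W U.
  by move=> Up Wp; have := gC (p_G Up) (p_G Wp); rewrite /gB => /oppr_inj.
rewrite (ricci_formula p_cap_k q_lin q_sym q_pos lieb_pp lieb_kp q_skew_k
  trace_lieb_p BC killing_trace_pk Xp Yp).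
by rewrite (sigma_Theta Xp Yp) (tau_Theta Xs Yr) /gB; ring.
Qed.

Lemma Theta_off s r w v X Y : s != r -> X \in piece s -> Y \in piece r ->
  Theta w v X Y = 0.
Proof.
case: s r => [[]|l] [[]|m] //= sr Xs Yr.
- exact: Theta_p1_p2.
- exact: (Theta_p1_p3 _ _ Xs Yr).
- by rewrite ThetaC; exact: Theta_p1_p2.
- exact: (Theta_p2_p3 _ _ Xs Yr).
- by rewrite ThetaC; exact: (Theta_p1_p3 _ _ Yr Xs).
- by rewrite ThetaC; exact: (Theta_p2_p3 _ _ Yr Xs).
- by apply: (Theta_p3_p3 _ _ _ Xs Yr); apply: contra sr => /eqP ->.
Qed.

Lemma ricci_off s r X Y : s != r -> X \in piece s -> Y \in piece r ->
  ricci k p q X Y = 0.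
Proof.
move=> sr Xs Yr; rewrite (ricci_Theta Xs Yr) (gB_piece_orth sr Xs Yr).
by rewrite !(Theta_off _ _ sr Xs Yr) !mulr0 subr0 addr0.
Qed.

(** Off the diagonal both [ricci] and [q] vanish, so proportionality on one summand extends to all
    of [p], and raising the index gives an eigenvector. *)
Lemma ricci_op_eigen s c X : X \in piece s ->
  (forall Y, Y \in piece s -> ricci k p q X Y = c * q X Y) ->
  ricci_op k p q X = c *: X.
Proof.
move=> Xs XE; have Xp := piece_in Xs.
have rE : {in p, forall Y, ricci k p q X Y = c * b X Y}.
  move=> Y Yp; have rb := ricci_sum_bilinear k q_lin q_sym.
  rewrite (ricciE p_cap_k q_lin q_sym q_pos trace_lieb_p Xp Yp).
  rewrite {1 2}(piece_sum Yp) (bform_sumr rb) (bform_sumr bb) mulr_sumr.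
  apply: eq_bigr => r _; have Yr := piece_proj_mem r Y.
  rewrite -(ricciE p_cap_k q_lin q_sym q_pos trace_lieb_p Xp (piece_in Yr)).
  rewrite (bp Xp (piece_in Yr)); have [sr|sr] := eqVneq s r; last first.
    by rewrite (ricci_off sr Xs Yr) (q_orth sr Xs Yr) mulr0.
  by rewrite XE// sr.
rewrite /ricci_op.
have -> : \matrix_(a, c) q (e a) (e c) = gram k p q.
  by apply/matrixP => i j; rewrite !mxE bp.
rewrite -[in RHS](pproj_id p_cap_k Xp) -(dual_expand p_cap_k q_lin q_sym q_pos X).
rewrite scaler_sumr; apply: eq_bigr => i _; rewrite -scaler_suml scalerA.
congr (_ *: _); rewrite -(linear_form_dual k q i (bb.2 X)) mulr_sumr.
by apply: eq_bigr => j _; rewrite rE//; ring.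
Qed.

(** * The Ricci eigenvalues *)

Lemma c1_sub1 : c1 - 1 != 0.
Proof.
have : c2 * (c1 - 1) != 0 by rewrite mulrBr mulr1 [c2 * c1]mulrC -c12 addrK.
by rewrite mulf_eq0 negb_or => /andP[].
Qed.

Lemma c2E : c2 = c1 / (c1 - 1).
Proof.
apply: (mulIf c1_sub1); rewrite divfK ?c1_sub1//.
by rewrite mulrBr mulr1 [c2 * c1]mulrC -c12 addrK.
Qed.

(* The terms in 1 / y cancel between the two traces. *)
Lemma casimir_sums (kap y : 'I_t.+1 -> R) (a c b : R) : a != 0 -> c != 0 ->
  2^-1 * b + 2^-1 * (a^-1 * a * (- b - 2 * \sum_l - (kap l * b))
      + \sum_l (a^-1 * y l + (y l)^-1 * a) * (c^-1 * - (kap l * b)))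
    - 4^-1 * (a * a * (a^-1 * a^-1 * (- b - 2 * \sum_l - (kap l * b))
      + \sum_l (a^-1 * (y l)^-1 + (y l)^-1 * a^-1) * (c^-1 * - (kap l * b)))) =
  ((2 * a)^-1 * (\sum_l (1 - y l / (c * a)) * kap l) + (4 * a)^-1) * (a * b).
Proof.
move=> a0 c0; rewrite sumrN -mulr_suml.
pose T1 := \sum_l y l * kap l; pose T2 := \sum_l (y l)^-1 * kap l.
have -> : \sum_l (a^-1 * y l + (y l)^-1 * a) * (c^-1 * - (kap l * b)) =
    - (c^-1 * (a^-1 * T1 + a * T2) * b).
  rewrite /T1 /T2 !mulr_sumr -big_split/= mulr_sumr mulr_suml -sumrN.
  by apply: eq_bigr => l _; ring.
have -> : \sum_l (a^-1 * (y l)^-1 + (y l)^-1 * a^-1) * (c^-1 * - (kap l * b)) =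
    - (2 * c^-1 * a^-1 * T2 * b).
  by rewrite /T2 !mulr_sumr mulr_suml -sumrN; apply: eq_bigr => l _; ring.
have -> : \sum_l (1 - y l / (c * a)) * kap l = \sum_l kap l - (c * a)^-1 * T1.
  by rewrite /T1 mulr_sumr -sumrB; apply: eq_bigr => l _; ring.
by move: (\sum_l kap l) T1 T2 => T0 T1 T2; field; rewrite a0 c0.
Qed.

Lemma ricci_p1 (kap : 'I_t.+1 -> R) X Y : X \in p1 -> Y \in p1 ->
  (forall l, casimir (U1 l) X = kap l *: X) ->
  ricci k p q X Y = ((2 * x s1)^-1 * (\sum_(l < t.+1)
      (1 - (c1 - 1) * x (s3 l) / (c1 * x s1)) * kap l) + (4 * x s1)^-1) * q X Y.
Proof.
move=> X1 Y1 Xcas; have Xg := piece_p1_g1 X1; have Yg := piece_p1_g1 Y1.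
have BE : B1 X Y = - gG X Y.
  by rewrite (gg1 Xg (piece_G (s := s1) Y1)) (pi1_id g12_cap Yg) opprK.
have NE l : N1 l X Y = - (kap l * gG X Y).
  rewrite (casimir_formC g1_sub V1_h U1_on)// (casimir_formE g1_sub V1_h U1_on)//.
  rewrite Xcas (bformZr b1) killingC ?BE ?mulrN// => Z Zg; exact: g1_sub.
rewrite (ricci_Theta (s := s1) (r := s1) X1 Y1) (q_piece (s := s1) X1 Y1).
rewrite !(Theta_p1 _ _ X1 Y1) BE.
under eq_bigr do rewrite NE.
under [X in _ + 2^-1 * (_ + X) - _]eq_bigr do rewrite NE.
under [X in _ - _ * (_ * (_ + X))]eq_bigr do rewrite NE.
(* Here [c] is c2, and c2 = c1/(c1 - 1) produces the factor (c1 - 1)/c1 of the formula; for p_2 it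
   is c1 and nothing has to be rewritten. *)
rewrite casimir_sums ?x_neq0//; congr ((_ * _ + _) * _).
apply: eq_bigr => l _; congr ((_ - _) * _); rewrite c2E.
by field; rewrite c1n c1_sub1 x_neq0.
Qed.

Lemma ricci_p2 (kap : 'I_t.+1 -> R) X Y : X \in p2 -> Y \in p2 ->
  (forall l, casimir (U2 l) X = kap l *: X) ->
  ricci k p q X Y = ((2 * x s2)^-1 * (\sum_(l < t.+1)
      (1 - x (s3 l) / (c1 * x s2)) * kap l) + (4 * x s2)^-1) * q X Y.
Proof.
move=> X1 Y1 Xcas; have Xg := piece_p2_g2 X1; have Yg := piece_p2_g2 Y1.
have BE : B2 X Y = - gG X Y.
  by rewrite (gg2 Xg (piece_G (s := s2) Y1)) (pi2_id g12_cap Yg) opprK.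
have NE l : N2 l X Y = - (kap l * gG X Y).
  rewrite (casimir_formC g2_sub V2_h U2_on)// (casimir_formE g2_sub V2_h U2_on)//.
  rewrite Xcas (bformZr b2) killingC ?BE ?mulrN// => Z Zg; exact: g2_sub.
rewrite (ricci_Theta (s := s2) (r := s2) X1 Y1) (q_piece (s := s2) X1 Y1).
rewrite !(Theta_p2 _ _ X1 Y1) BE.
under eq_bigr do rewrite NE.
under [X in _ + 2^-1 * (_ + X) - _]eq_bigr do rewrite NE.
under [X in _ - _ * (_ * (_ + X))]eq_bigr do rewrite NE.
by rewrite casimir_sums ?x_neq0.
Qed.

(** In [Theta x xi] the weights cancel on every diagonal block. Before division by the scale of [q],
    the metric therefore enters only through [Theta xi xi] and its prefactor. *)
Lemma ricci_p3 l X Y : X \in p3 l -> Y \in p3 l ->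
  ricci k p q X Y = ((c1 - 1) * lam l / (4 * x (s3 l))
      * (c1 ^+ 2 / (c1 - 1) ^+ 2 - x (s3 l) ^+ 2 / x s1 ^+ 2
         - x (s3 l) ^+ 2 / ((c1 - 1) ^+ 2 * x s2 ^+ 2))
    + (c1 - 1) * x (s3 l) / (4 * c1)
      * ((x s1 ^+ 2)^-1 + ((c1 - 1) * x s2 ^+ 2)^-1)) * q X Y.
Proof.
move=> Xl Yl; have x1n := x_neq0 s1; have x2n := x_neq0 s2; have x3n := x_neq0 (s3 l).
rewrite (ricci_Theta (s := s3 l) (r := s3 l) Xl Yl) (q_piece (s := s3 l) Xl Yl).
move: Xl Yl => /p3E[Z Zl ->] /p3E[W Wl ->].
rewrite !(Theta_p3 _ _ Zl Wl) (gB_skew_lift Zl Wl).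
have -> : BG Z W = - gG Z W by rewrite /gB opprK.
rewrite c2E; have c1s := c1_sub1; move: (gG Z W) => g.
by field; rewrite c1n x1n x2n x3n c1s.
Qed.

End AlignedPieces.

Theorem theorem1p2 (R : realType) (n t : nat)
    (G1 G2 K : set 'M[R]_n) (g1 g2 k : {vspace 'M[R]_n})
    (k_ : 'I_t.+1 -> {vspace 'M[R]_n})
    (c1 c2 : R) (lam : 'I_t.+1 -> R)
    (q1 q2 : nat)
    (p1_ : 'I_q1 -> {vspace 'M[R]_n}) (p2_ : 'I_q2 -> {vspace 'M[R]_n})
    (U1 U2 : 'I_t.+1 -> seq 'M[R]_n)
    (kap1 : 'I_t.+1 -> 'I_q1 -> R) (kap2 : 'I_t.+1 -> 'I_q2 -> R)
    (x1 x2 : R) (x3 : 'I_t.+1 -> R)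
    (g : 'M[R]_n -> 'M[R]_n -> R)
    (G := product_group G1 G2)
    (p := pspace g1 g2 k)
    (p1 := pspace1 g1 g2 k)
    (p2 := pspace2 g1 g2 k)
    (p3 := fun l : 'I_t.+1 => pspace3 g1 g2 c1 c2 (k_ l))
    (Rc := ricci k p g)
    (Ric := ricci_op k p g) :
  matrix_group G1 -> compact G1 -> connected G1 ->
  matrix_group G2 -> compact G2 -> connected G2 ->
  direct_product G1 G2 ->
  lie_algebra_of G1 g1 -> simple_lie_algebra g1 ->
  lie_algebra_of G2 g2 -> simple_lie_algebra g2 ->
  matrix_group K -> closed K -> K `<=` G -> lie_algebra_of K k ->
  almost_effective G K ->
  k = (\sum_(l < t.+1) k_ l)%VS -> directv (\sum_(l < t.+1) k_ l) ->
  lie_center k (k_ ord0) ->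
  (forall l, l != ord0 -> lie_ideal (k_ l) k /\ simple_lie_algebra (k_ l)) ->
  aligned g1 g2 k_ c1 c2 lam ->
  irreducible_decomposition K p1 p1_ ->
  irreducible_decomposition K p2 p2_ ->
  (forall l, orthonormal_basis (fun X Y => - killing g1 X Y)
               (pi1 g1 g2 @: k_ l)%VS (U1 l)) ->
  (forall l, orthonormal_basis (fun X Y => - killing g2 X Y)
               (pi2 g1 g2 @: k_ l)%VS (U2 l)) ->
  (forall l j X, X \in p1_ j -> casimir (U1 l) X = kap1 l j *: X) ->
  (forall l j X, X \in p2_ j -> casimir (U2 l) X = kap2 l j *: X) ->
  0 < x1 -> 0 < x2 -> (forall l, 0 < x3 l) ->
  invariant_metric K p g ->
  diagonal_metric (gB g1 g2) p1 p2 p3 x1 x2 x3 g ->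
  [/\ orthogonal_decomposition Rc p1 p2 p3,
      (forall j j' : 'I_q1, (j < j')%N ->
         orthogonal_on (gB g1 g2) (p1_ j) (p1_ j') ->
         orthogonal_on Rc (p1_ j) (p1_ j')) /\
      (forall j j' : 'I_q2, (j < j')%N ->
         orthogonal_on (gB g1 g2) (p2_ j) (p2_ j') ->
         orthogonal_on Rc (p2_ j) (p2_ j')),
      forall (j : 'I_q1) X, X \in p1_ j ->
        Ric X = ((2 * x1)^-1 * \sum_(l < t.+1)
                   (1 - (c1 - 1) * x3 l / (c1 * x1)) * kap1 l j
                 + (4 * x1)^-1) *: X,
      forall (j : 'I_q2) X, X \in p2_ j ->
        Ric X = ((2 * x2)^-1 * \sum_(l < t.+1)
                   (1 - x3 l / (c1 * x2)) * kap2 l j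
                 + (4 * x2)^-1) *: X
    & forall (l : 'I_t.+1) X, X \in p3 l ->
        Ric X = ((c1 - 1) * lam l / (4 * x3 l)
                   * (c1 ^+ 2 / (c1 - 1) ^+ 2 - x3 l ^+ 2 / x1 ^+ 2
                      - x3 l ^+ 2 / ((c1 - 1) ^+ 2 * x2 ^+ 2))
                 + (c1 - 1) * x3 l / (4 * c1)
                   * ((x1 ^+ 2)^-1 + ((c1 - 1) * x2 ^+ 2)^-1)) *: X].
Proof.
move=> G1m G1c _ G2m G2c _ G12 G1g g1s G2g g2s Km Kc KG Kk _ k_sum k_dir
  k_center k_simple k_al [p1E p1d _] [p2E p2d _] U1on U2on cas1 cas2
  x1p x2p x3p [g_lin g_sym g_pos _] [g_orth gp1 gp2 gp3].
have g1_sub : subalgebra g1 by move=> X Y; apply: lieb_lie_algebra G1m G1g.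
have g2_sub : subalgebra g2 by move=> X Y; apply: lieb_lie_algebra G2m G2g.
have g12l := lieb_direct_product G12 G1g G2g.
have g12c := capv_direct_product G12 G1g G2g.
(* The only inclusion between Lie algebras that has to be extracted from [K <= G]. *)
have k_G : (k <= g1 + g2)%VS.
  apply/subvP => X /Kk XK.
  by apply: (lie_product_group G1m G1c G2m G2c G12 G1g G2g) => s; apply: KG.
have [_ _ c1n c2n c12] := c_facts k_al.
have kk := killing_k g1_sub g2_sub g12l g12c k_G k_sum k_center k_simple k_al.
have kkl := killing_kl g1_sub g2_sub g12l g12c k_G k_sum k_dir k_center k_simple.
have kl_G := @mem_klG _ _ _ g1 g2 k k_ k_G k_sum.
have kl_sub := ideal_sub k_sum k_center k_simple.
have kl_comm := ideal_comm k_sum k_dir k_center k_simple.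
have B1_k l Z W (Zl : Z \in k_ l) (Wl : W \in k_ l) := let: And3 e _ _ := kk l Z W Zl Wl in e.
have B2_k l Z W (Zl : Z \in k_ l) (Wl : W \in k_ l) := let: And3 _ e _ := kk l Z W Zl Wl in e.
have B_k l Z W (Zl : Z \in k_ l) (Wl : W \in k_ l) := let: And3 _ _ e := kk l Z W Zl Wl in e.
have B1_kl l m Z W (lm : l != m) (Zl : Z \in k_ l) (Wl : W \in k_ m) :=
  let: And3 e _ _ := kkl l m Z W lm Zl Wl in e.
have B2_kl l m Z W (lm : l != m) (Zl : Z \in k_ l) (Wl : W \in k_ m) :=
  let: And3 _ e _ := kkl l m Z W lm Zl Wl in e.
have gBp := gB_k_pos g1_sub g2_sub g12l g12c k_G k_sum U1on U2on.
pose x s := match s with inl true => x1 | inl false => x2 | inr l => x3 l end.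
have g_piece s X Y : X \in piece g1 g2 k k_ c1 c2 s ->
    Y \in piece g1 g2 k k_ c1 c2 s -> g X Y = x s * gB g1 g2 X Y.
  by case: s => [[]|l]; [apply: gp1|apply: gp2|apply: gp3].
have orthE (F : 'M[R]_n -> 'M[R]_n -> R) : orthogonal_decomposition F p1 p2 p3 <->
    forall s r X Y, s != r -> X \in piece g1 g2 k k_ c1 c2 s ->
    Y \in piece g1 g2 k k_ c1 c2 r -> F X Y = 0.
  split=> [[h12 h13 h23 h33] [[]|l] [[]|m] X Y // sr Xs Yr|o].
  - by case: (h12 X Y Xs Yr).
  - by case: (h13 m X Y Xs Yr).
  - by case: (h12 Y X Yr Xs).
  - by case: (h23 m X Y Xs Yr).
  - by case: (h13 l Y X Yr Xs).
  - by case: (h23 l Y X Yr Xs).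
  - by case: (h33 l m _ X Y Xs Yr).
  split=> [X Y Xs Yr|l X Y Xs Yr|l X Y Xs Yr|l m lm X Y Xs Yr]; split.
  - exact: (o (inl true) (inl false)).
  - exact: (o (inl false) (inl true)).
  - exact: (o (inl true) (inr l)).
  - exact: (o (inr l) (inl true)).
  - exact: (o (inl false) (inr l)).
  - exact: (o (inr l) (inl false)).
  - exact: (o (inr l) (inr m)).
  - by apply: (o (inr m) (inr l)) => //; rewrite eq_sym.
have g_orth' := (orthE g).1 g_orth.
have x_neq0 s : x s != 0 by case: s => [[]|l]; apply: lt0r_neq0 => /=.
have rp1 := ricci_p1 g1_sub g2_sub g12l g12c k_sum kl_G kl_sub kl_comm c1n c2n
  c12 B1_k B2_k B1_kl B2_kl gBp U1on U2on g_lin g_sym g_pos g_piece g_orth'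
  x_neq0.
have rp2 := ricci_p2 g1_sub g2_sub g12l g12c k_sum kl_G kl_sub kl_comm c1n c2n
  c12 B1_k B2_k B1_kl B2_kl gBp U1on U2on g_lin g_sym g_pos g_piece g_orth'
  x_neq0.
have rp3 := ricci_p3 g1_sub g2_sub g12l g12c k_sum kl_G kl_sub kl_comm c1n c2n
  c12 B1_k B2_k B_k B1_kl B2_kl gBp U1on U2on g_lin g_sym g_pos g_piece g_orth'
  x_neq0.
have off := ricci_off g1_sub g2_sub g12l g12c k_sum kl_G kl_sub kl_comm c1n c2n
  c12 B1_k B2_k B1_kl B2_kl gBp U1on U2on g_lin g_sym g_pos g_piece g_orth'
  x_neq0.
have eig := ricci_op_eigen g1_sub g2_sub g12l g12c k_sum kl_G kl_sub kl_comm c1n c2n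
  c12 B1_k B2_k B1_kl B2_kl gBp U1on U2on g_lin g_sym g_pos g_piece g_orth'
  x_neq0.
have p1j j X : X \in p1_ j -> X \in p1.
  by apply: subvP; rewrite p1E (sumv_sup j).
have p2j j X : X \in p2_ j -> X \in p2.
  by apply: subvP; rewrite p2E (sumv_sup j).
(* The Casimir scalar is used at the first argument alone, so the second may run over all of p_1.
   This serves both the eigenvectors and the orthogonality of distinct irreducible summands. *)
have Rc1 j X Y : X \in p1_ j -> Y \in p1 -> _ :=
  fun Xj Y1 => rp1 (kap1^~ j) X Y (p1j j X Xj) Y1 (fun l => cas1 l j X Xj).
have Rc2 j X Y : X \in p2_ j -> Y \in p2 -> _ :=
  fun Xj Y2 => rp2 (kap2^~ j) X Y (p2j j X Xj) Y2 (fun l => cas2 l j X Xj).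
split.
- by apply/orthE => s r X Y; apply: off.
(* With one argument in an irreducible summand, [Rc] is a multiple of [gB], so it inherits
   orthogonality from [gB]. *)
- split=> j j' _ o X Y Xj Yj'; have [XY0 YX0] := o X Y Xj Yj'.
    have [X1 Y1] := (p1j j X Xj, p1j j' Y Yj').
    by rewrite /Rc (Rc1 j)// (Rc1 j')// !gp1// XY0 YX0 !mulr0.
  have [X2 Y2] := (p2j j X Xj, p2j j' Y Yj').
  by rewrite /Rc (Rc2 j)// (Rc2 j')// !gp2// XY0 YX0 !mulr0.
- move=> j X Xj; apply: (eig (inl true)) => [|Y Y1]; first exact: p1j Xj.
  exact: Rc1.
- move=> j X Xj; apply: (eig (inl false)) => [|Y Y2]; first exact: p2j Xj.
  exact: Rc2.
- by move=> l X Xl; apply: (eig (inr l)) => // Y Yl; apply: rp3.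
Qed.
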